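(* Let $F$ be any field. Then every $4$-dimensional nilpotent associative algebra over $F$ is isomorphic to at least one of the algebras in the following list (an algebra occurs in the list only when the stated restrictions on $F$ and on the parameters, which lie in $F$, are satisfied). Algebras $A_{4,k}$ and $A_{4,l}$ (with any admissible parameters) with $k\neq l$ are not isomorphic, and isomorphism between members of the same parametrized family is exactly as described. 1. $A_{4,1}=\langle a,b,c,d \mid \ \rangle$. 2. $A_{4,2}=\langle a,b,c,d \mid a^2=b\rangle$. 3. $A_{4,3}^\delta=\langle a,b,c,d\mid a^2=c,\ b^2=\delta c\rangle$, $\delta\neq 0$; $A_{4,3}^\delta\cong A_{4,3}^\epsilon$ if and only if there is $\nu\in F^*$ with $\delta=\nu^2\epsilon$. 4. $A_{4,4}^\delta=\langle a,b,c,d\mid a^2=c,\ b^2=\delta c,\ ab=c\rangle$, $\delta\in F$; for different $\delta$ these are not isomorphic. 5. $A_{4,5}=\langle a,b,c,d\mid ab=c,\ ba=-c\rangle$. 6. $A_{4,6}=\langle a,b,c,d\mid a^2=b,\ ab=ba=c\rangle$. 7. $A_{4,7}=\langle a,b,c,d\mid a^2=bc=d,\ cb=-d\rangle$, $\mathrm{char}(F)\neq 2$. 8. $A_{4,8}^{\alpha,\beta}=\langle a,b,c,d\mid a^2=d,\ b^2=\alpha d,\ c^2=\beta d\rangle$, $\alpha,\beta\neq 0$; $A_{4,8}^{\alpha,\beta}\cong A_{4,8}^{\gamma,\delta}$ if and only if the quadratic forms $\alpha x^2+\beta y^2+\alpha\beta z^2$ and $\gamma x^2+\delta y^2+\gamma\delta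 z^2$ over $F$ are equivalent. 9. $A_{4,9}^{\alpha,\beta}=\langle a,b,c,d\mid a^2=\alpha d,\ b^2=d,\ bc=d,\ c^2=\beta d\rangle$, $\alpha\neq 0$; for $\alpha,\gamma\neq 0$, $A_{4,9}^{\alpha,\beta}\cong A_{4,9}^{\gamma,\delta}$ if and only if $\beta=\delta$ and there are $s,t\in F$ with $t^2-st+\delta s^2=\frac{\alpha}{\gamma}$. 10. $A_{4,10}^\alpha=\langle a,b,c,d\mid a^2=d,\ ab=d,\ b^2=\alpha d,\ bc=d,\ cb=d\rangle$, $\alpha\in F$; if $\mathrm{char}(F)\neq 2$ then $A_{4,10}^\alpha\cong A_{4,10}^0$; if $\mathrm{char}(F)=2$ then $A_{4,10}^\alpha\cong A_{4,10}^\beta$ if and only if there is $T\in F$ with $T^2+T+\alpha+\beta=0$. 11. $A_{4,11}=\langle a,b,c,d\mid a^2=d,\ ab=d,\ cb=d,\ c^2=-d\rangle$. 12. $A_{4,12}=\langle a,b,c,d\mid a^2=b,\ ab=ba=d,\ ac=d,\ c^2=d\rangle$. 13. $A_{4,13}=\langle a,b,c,d\mid a^2=b,\ ab=ba=d,\ c^2=d\rangle$. 14. $A_{4,14}=\langle a,b,c,d\mid a^2=b,\ ab=ba=d,\ ac=d\rangle$. 15. $A_{4,15}=\langle a,b,c,d\mid a^2=b,\ ab=ba=c,\ b^2=ac=ca=d\rangle$. 16. $A_{4,16}=\langle a,b,c,d\mid a^2=c,\ ba=d\rangle$. 17. $A_{4,17}^\delta=\langle a,b,c,d\mid a^2=c,\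 ab=ba=d,\ b^2=\delta c+d\rangle$, $\mathrm{char}(F)=2$; $A_{4,17}^\delta\cong A_{4,17}^\epsilon$ if and only if there is $T\in F$ with $T^2+T+\delta+\epsilon=0$. 18. $A_{4,18}^\delta=\langle a,b,c,d\mid a^2=c,\ ab=d,\ ba=-d,\ b^2=\delta c\rangle$, $\delta \in F$. If $\mathrm{char}(F)\neq 2$ then $A_{4,18}^\delta\cong A_{4,18}^\epsilon$ if and only if there is $\nu\in F^*$ with $\epsilon=\nu^2\delta$. If $\mathrm{char}(F)=2$ then $A_{4,18}^\delta\cong A_{4,18}^\epsilon$ if and only if there are $u,v,x,y\in F$ with $uy+vx\neq 0$, $u^2+v^2\delta\neq 0$ and $\epsilon=\frac{x^2+y^2\delta}{u^2+v^2\delta}$. 19. $A_{4,19}^\delta=\langle a,b,c,d\mid a^2=c,\ ab=d,\ ba=c+d,\ b^2=\delta c\rangle$, $\mathrm{char}(F)=2$; $A_{4,19}^\delta\cong A_{4,19}^\epsilon$ if and only if there is $T\in F$ with $T^2+T+\delta+\epsilon=0$. 20. $A_{4,20}=\langle a,b,c,d\mid a^2=c,\ ab=d,\ ba=c\rangle$. 21. $A_{4,21}^\delta=\langle a,b,c,d\mid a^2=c,\ ab=d,\ ba=\delta d\rangle$, $\delta\neq -1$; for different $\delta$ these are not isomorphic. 22. $A_{4,22}=\langle a,b,c,d\mid a^2=c,\ ab=d,\ ba=c+d,\ b^2=c\rangle$, only for $F=\mathbb{F}_3$. 23. $A_{4,23}^\delta=\langle a,b,c,d\mid a^2=c,\ ab=ba=d,\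 b^2=-\delta c\rangle$, $\delta\neq 0$, $\mathrm{char}(F)\neq 2$; $A_{4,23}^\delta\cong A_{4,23}^\epsilon$ if and only if there is $\nu\in F^*$ with $\epsilon=\nu^2\delta$. 24. $A_{4,24}=\langle a,b,c,d\mid a^2=c,\ ab=d,\ ba=-c,\ b^2=c\rangle$, $\mathrm{char}(F)\neq 2$. 25. $A_{4,25}^{\alpha,\beta,\gamma}=\langle a,b,c,d\mid a^2=c,\ ab=d,\ ba=-\beta c+\alpha d,\ b^2=-\gamma c\rangle$, $\mathrm{char}(F)\neq 2$, $\alpha\neq\pm1$, $\gamma\neq 0$, $\sigma^2\neq-\gamma$, where $\sigma=\frac{\beta}{1-\alpha}$. Furthermore $A_{4,25}^{\alpha,\beta,\gamma}\cong A_{4,25}^{\alpha',\beta',\gamma'}$ if and only if there are $\varphi,\nu\in F^*$ with $(\sigma')^2+\gamma'=\varphi^2(\sigma^2+\gamma)$ (where $\sigma'=\frac{\beta'}{1-\alpha'}$), $\gamma=\nu^2\gamma'$ and, setting $\psi=\nu\varphi$, letting $\omega_1=\pm1$ be such that $-\omega_1\neq\frac{1+\alpha}{1-\alpha}\psi$ and defining $$\lambda=\frac{\psi(1+\alpha)-\omega_1(1-\alpha)}{\psi(1+\alpha)+\omega_1(1-\alpha)}\quad\text{and}\quad \mu=\sigma'(1-\lambda),$$ we have $\alpha'=\lambda$, $\beta'=\mu$, or $\alpha'=\lambda^{-1}$, $\beta'=-\mu\lambda^{-1}$ (the latter alternative only making sense when $\lambda\neq0$). 26. $A_{4,26}^{\alpha,\beta,\gamma}=\langle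 a,b,c,d\mid a^2=c,\ ab=d,\ ba=\beta c+\alpha d,\ b^2=\gamma c\rangle$, $\mathrm{char}(F)=2$, $\alpha\neq 1$, $\gamma\neq0$. Furthermore $A_{4,26}^{\alpha,\beta,\gamma}\cong A_{4,26}^{\alpha',\beta',\gamma'}$ if and only if there is $\nu\in F^*$ with $\gamma=\nu^2\gamma'$ and $\sigma=\nu\sigma'$ (where $\sigma=\frac{\beta}{1+\alpha}$, $\sigma'=\frac{\beta'}{1+\alpha'}$), and an $h\in H_{\alpha,\beta,\gamma}$ with $\frac{1}{1+\alpha'}=\frac{1}{1+\alpha}+h$, where $$H_{\alpha,\beta,\gamma}=\left\{\frac{\sigma uv+\gamma v^2}{u^2+\gamma v^2}\ \middle|\ u,v\in F,\ u^2+\gamma v^2\neq 0\right\},$$ which is an additive subgroup of $F$.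
   Context: Algebras are associative algebras over $F$, not assumed unital; an algebra $A$ is nilpotent if all products of $n$ elements vanish for some $n$. $F^*=F\setminus\{0\}$. Notation: $\langle a,b,c,d\mid\text{relations}\rangle$ denotes the algebra with vector space basis $a,b,c,d$ whose multiplication is determined by the listed products of basis elements, all products of basis elements not listed being zero. Two quadratic forms in three variables over $F$ are equivalent if one is obtained from the other by an invertible linear change of variables over $F$. *)

(* Defs.v *)
From HB Require Import structures.
From mathcomp Require Import all_boot all_algebra ring.

Set Implicit Arguments.
Unset Strict Implicit.
Unset Printing Implicit Defensive.

Import GRing.Theory.
Local Open Scope ring_scope.

(* Finite-dimensional associative algebras, not assumed unital (the ring
   structures of the library all have a unit). *)
Record algebra (F : fieldType) := Algebra {
  carrier :> vectType F;
  amul : {bilinear carrier -> carrier -> carrier};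
  amulA : associative amul
}.

(* [foldl] runs over the products of [n.+1] elements: a product of zero
   elements has no meaning without a unit. *)
Definition nilpotent (F : fieldType) (A : algebra F) : Prop :=
  exists n : nat, forall (x : A) (s : seq A),
    size s = n -> foldl (amul A) x s = 0.

Definition alg_iso (F : fieldType) (A B : algebra F) : Prop :=
  exists2 f : {linear A -> B}, bijective f & {morph f : x y / amul A x y >-> amul B x y}.

Notation "A ≅ B" := (alg_iso A B) (at level 70, no associativity).

(* An entry [(i, j, v)] of [r] prescribes the product [v] of the [i]-th and
   [j]-th basis vectors; pairs that do not occur in [r] have product zero. *)
Section TableMul.
Variable F : fieldType.

Definition table := seq ('I_4 * 'I_4 * 'rV[F]_4).

Definition table_mul (r : table) (x y : 'rV[F]_4) : 'rV[F]_4 :=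
  \sum_(t <- r) (x 0 t.1.1 * y 0 t.1.2) *: t.2.

Lemma table_mul_bilinear (r : table) :
  bilinear_for
    (GRing.Scale.Law.clone _ _ *:%R _) (GRing.Scale.Law.clone _ _ *:%R _)
    (table_mul r).
Proof.
split=> [z k x y | z k x y]; rewrite /= /table_mul scaler_sumr -big_split /=;
  apply: eq_bigr => t _; rewrite !mxE scalerA -scalerDl; congr (_ *: _); ring.
Qed.

HB.instance Definition _ (r : table) :=
  bilinear_isBilinear.Build F _ _ _ _ _ (table_mul r) (table_mul_bilinear r).

End TableMul.

Inductive listed (F : fieldType) : Type :=
| A4_1
| A4_2
| A4_3 of F
| A4_4 of F
| A4_5
| A4_6
| A4_7
| A4_8 of F & F
| A4_9 of F & F
| A4_10 of F
| A4_11
| A4_12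
| A4_13
| A4_14
| A4_15
| A4_16
| A4_17 of F
| A4_18 of F
| A4_19 of F
| A4_20
| A4_21 of F
| A4_22
| A4_23 of F
| A4_24
| A4_25 of F & F & F
| A4_26 of F & F & F.

Arguments A4_1 {F}.
Arguments A4_2 {F}.
Arguments A4_5 {F}.
Arguments A4_6 {F}.
Arguments A4_7 {F}.
Arguments A4_11 {F}.
Arguments A4_12 {F}.
Arguments A4_13 {F}.
Arguments A4_14 {F}.
Arguments A4_15 {F}.
Arguments A4_16 {F}.
Arguments A4_20 {F}.
Arguments A4_22 {F}.
Arguments A4_24 {F}.

Definition listed_number (F : fieldType) (L : listed F) : nat :=
  match L with
  | A4_1 => 1
  | A4_2 => 2
  | A4_3 _ => 3
  | A4_4 _ => 4
  | A4_5 => 5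
  | A4_6 => 6
  | A4_7 => 7
  | A4_8 _ _ => 8
  | A4_9 _ _ => 9
  | A4_10 _ => 10
  | A4_11 => 11
  | A4_12 => 12
  | A4_13 => 13
  | A4_14 => 14
  | A4_15 => 15
  | A4_16 => 16
  | A4_17 _ => 17
  | A4_18 _ => 18
  | A4_19 _ => 19
  | A4_20 => 20
  | A4_21 _ => 21
  | A4_22 => 22
  | A4_23 _ => 23
  | A4_24 => 24
  | A4_25 _ _ _ => 25
  | A4_26 _ _ _ => 26
  end%N.

Section Listed.
Variable F : fieldType.

Local Notation a := (@Ordinal 4 0 isT).
Local Notation b := (@Ordinal 4 1 isT).
Local Notation c := (@Ordinal 4 2 isT).
Local Notation d := (@Ordinal 4 3 isT).
Local Notation e i := (delta_mx 0 i : 'rV[F]_4).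

Definition products (L : listed F) : table F :=
  match L with
  | A4_1 => [::]
  | A4_2 => [:: (a, a, e b)]
  | A4_3 delta => [:: (a, a, e c); (b, b, delta *: e c)]
  | A4_4 delta => [:: (a, a, e c); (b, b, delta *: e c); (a, b, e c)]
  | A4_5 => [:: (a, b, e c); (b, a, - e c)]
  | A4_6 => [:: (a, a, e b); (a, b, e c); (b, a, e c)]
  | A4_7 => [:: (a, a, e d); (b, c, e d); (c, b, - e d)]
  | A4_8 alpha beta =>
      [:: (a, a, e d); (b, b, alpha *: e d); (c, c, beta *: e d)]
  | A4_9 alpha beta =>
      [:: (a, a, alpha *: e d); (b, b, e d); (b, c, e d); (c, c, beta *: e d)]
  | A4_10 alpha =>
      [:: (a, a, e d); (a, b, e d); (b, b, alpha *: e d);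
          (b, c, e d); (c, b, e d)]
  | A4_11 => [:: (a, a, e d); (a, b, e d); (c, b, e d); (c, c, - e d)]
  | A4_12 =>
      [:: (a, a, e b); (a, b, e d); (b, a, e d); (a, c, e d); (c, c, e d)]
  | A4_13 => [:: (a, a, e b); (a, b, e d); (b, a, e d); (c, c, e d)]
  | A4_14 => [:: (a, a, e b); (a, b, e d); (b, a, e d); (a, c, e d)]
  | A4_15 =>
      [:: (a, a, e b); (a, b, e c); (b, a, e c);
          (b, b, e d); (a, c, e d); (c, a, e d)]
  | A4_16 => [:: (a, a, e c); (b, a, e d)]
  | A4_17 delta =>
      [:: (a, a, e c); (a, b, e d); (b, a, e d); (b, b, delta *: e c + e d)]
  | A4_18 delta =>
      [:: (a, a, e c); (a, b, e d); (b, a, - e d); (b, b, delta *: e c)]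
  | A4_19 delta =>
      [:: (a, a, e c); (a, b, e d); (b, a, e c + e d); (b, b, delta *: e c)]
  | A4_20 => [:: (a, a, e c); (a, b, e d); (b, a, e c)]
  | A4_21 delta => [:: (a, a, e c); (a, b, e d); (b, a, delta *: e d)]
  | A4_22 => [:: (a, a, e c); (a, b, e d); (b, a, e c + e d); (b, b, e c)]
  | A4_23 delta =>
      [:: (a, a, e c); (a, b, e d); (b, a, e d); (b, b, - delta *: e c)]
  | A4_24 => [:: (a, a, e c); (a, b, e d); (b, a, - e c); (b, b, e c)]
  | A4_25 alpha beta gamma =>
      [:: (a, a, e c); (a, b, e d); (b, a, - beta *: e c + alpha *: e d);
          (b, b, - gamma *: e c)]
  | A4_26 alpha beta gamma =>
      [:: (a, a, e c); (a, b, e d); (b, a, beta *: e c + alpha *: e d);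
          (b, b, gamma *: e c)]
  end.

Definition admissible (L : listed F) : Prop :=
  match L with
  | A4_3 delta => delta != 0
  | A4_7 => 2%N \notin [pchar F]
  | A4_8 alpha beta => alpha != 0 /\ beta != 0
  | A4_9 alpha beta => alpha != 0
  | A4_17 delta => 2%N \in [pchar F]
  | A4_19 delta => 2%N \in [pchar F]
  | A4_21 delta => delta != -1
  | A4_22 => exists f : {rmorphism 'F_3 -> F}, bijective f
  | A4_23 delta => delta != 0 /\ 2%N \notin [pchar F]
  | A4_24 => 2%N \notin [pchar F]
  | A4_25 alpha beta gamma =>
      [/\ 2%N \notin [pchar F], alpha != 1, alpha != -1, gamma != 0 &
          (beta / (1 - alpha)) ^+ 2 != - gamma]
  | A4_26 alpha beta gamma =>
      [/\ 2%N \in [pchar F], alpha != 1 & gamma != 0]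
  | _ => True
  end.

Lemma table_mulE (r : table F) (x y : 'rV[F]_4) k :
  table_mul r x y 0 k = \sum_(t <- r) x 0 t.1.1 * y 0 t.1.2 * t.2 0 k.
Proof. by rewrite summxE; apply: eq_bigr => t _; rewrite !mxE. Qed.

Lemma table_mul_assoc0 (m : nat) (r : table F) :
    all (fun t : 'I_4 * 'I_4 * 'rV[F]_4 =>
                   [&& (t.1.1 < m)%N, (t.1.2 < m)%N &
                       [forall k : 'I_4, (k < m)%N ==> (t.2 0 k == 0)]]) r ->
  associative (table_mul r).
Proof.
move/allP=> rP x y z.
have mul0 u v (k : 'I_4) : (k < m)%N -> table_mul r u v 0 k = 0.
  move=> km; rewrite table_mulE big_seq big1 // => t /rP/and3P[_ _].
  by move/forallP/(_ k); rewrite km => /eqP->; rewrite mulr0.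
apply/rowP=> k; rewrite !table_mulE !big_seq !big1 // => t /rP/and3P[t1 t2 _];
  by rewrite mul0 ?(mul0r, mulr0).
Qed.

Lemma products_assoc (L : listed F) : associative (table_mul (products L)).
Proof.
case: L => *; first [
  by apply: (@table_mul_assoc0 1); rewrite /= ?andbT //;
     repeat (apply/andP; split); apply/forallP => -[[|k] ?] //=; rewrite !mxE
| by apply: (@table_mul_assoc0 2); rewrite /= ?andbT;
     repeat (apply/andP; split); apply/forallP => -[[|[|k]] ?] //=;
     rewrite !mxE /= ?(mulr0, addr0, oppr0)
| by apply: (@table_mul_assoc0 3); rewrite /= ?andbT;
     repeat (apply/andP; split); apply/forallP => -[[|[|[|k]]] ?] //=;
     rewrite !mxE /= ?(mulr0, addr0, oppr0)
| move=> x y z; apply/rowP=> k; rewrite !(table_mulE, big_cons, big_nil) /=;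
  by rewrite !mxE /=; ring ].
Qed.

Definition listed_alg (L : listed F) : algebra F :=
  @Algebra F 'rV[F]_4 (table_mul (products L)) (@products_assoc L).

End Listed.

Coercion listed_alg : listed >-> algebra.

(* Ternary quadratic forms as functions on F^3; over any field, F_2 included,
   such a function determines the coefficients of the form. *)
Definition qf_equiv (F : fieldType) (p q : 'rV[F]_3 -> F) : Prop :=
  exists2 P : 'M[F]_3, P \in unitmx & forall v, q v = p (v *m P).

Definition diag_qf (F : fieldType) (r s t : F) (v : 'rV[F]_3) : F :=
  let x := v 0 (@Ordinal 3 0 isT) in
  let y := v 0 (@Ordinal 3 1 isT) in
  let z := v 0 (@Ordinal 3 2 isT) in
  r * x ^+ 2 + s * y ^+ 2 + t * z ^+ 2.

Definition H26 (F : fieldType) (alpha beta gamma h : F) : Prop :=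
  let sigma := beta / (1 + alpha) in
  exists u v : F,
    u ^+ 2 + gamma * v ^+ 2 != 0 /\
    h = (sigma * u * v + gamma * v ^+ 2) / (u ^+ 2 + gamma * v ^+ 2).

Definition additive_subgroup (F : fieldType) (H : F -> Prop) : Prop :=
  [/\ H 0, forall x y, H x -> H y -> H (x + y) & forall x, H x -> H (- x)].

(* Main.v *)
(** Let A be nilpotent of dimension 4. If A^3 = 0 and dim A^2 <= 1, then A is determined by a
    bilinear form on F^3 up to congruence and scaling, and the normal forms come from splitting
    off the kernel of its alternating part. If A^3 = 0 and dim A^2 = 2, then A has two
    generators a, b; the symmetric tensors among the two quadratic relations contain one that can
    be diagonalized (unless A is commutative of characteristic 2), so that b^2 is a multiple of
    a^2, and the remaining relation is normalized by explicit substitutions. If A^3 <> 0, then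
    associativity forces A to be an algebra on a, a^2, a^3 and one more element, or to be
    generated by a single element.

    Isomorphisms between algebras of the first two kinds are congruences of forms, hence
    solutions of a few polynomial equations in the entries of a 2 x 2 or 3 x 3 matrix; the
    parameter conditions are read off from discriminants, similitude factors and Arf invariants.
    Members of different families are separated by isomorphism invariants. *)

Require Import Defs.
From HB Require Import structures.
From mathcomp Require Import all_boot all_algebra ring.
From mathcomp Require Import boolp.

Set Implicit Arguments.
Unset Strict Implicit.
Unset Printing Implicit Defensive.

Import GRing.Theory.
Local Open Scope ring_scope.

(** An isomorphism matters only through its action modulo elements that multiply to zero. It thus
    reduces to a small matrix: 3 x 3 with a scalar for [bf], 2 x 2 for [pair_alg]. All listed
    algebras except [A4_15] and [A4_16] are therefore transported to the three parametrized tables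
    [bf], [pair_alg] and [chain_alg].

    The obstacle is characteristic 2, where a quadratic form no longer determines a symmetric
    bilinear form. The criterion for [A4_8] then rests on the multiplicativity of quaternion norms.
    The conditions T^2 + T + ... = 0 come from quadratic forms with non-zero polar form. For [A4_25]
    and [A4_26] the matrix of an isomorphism is, up to scaling its second row, that of an element z
    = u + v w of a quadratic algebra with w^2 = -gamma' or w^2 = gamma', and the criteria are
    statements about multiplication there.

    Implications between polynomial systems are proved by explicit cofactors; the long polynomials
    given to [lincomb] are such certificates and carry no further meaning. *)

Lemma alg_iso_sym (F : fieldType) (A B : algebra F) : A ≅ B -> B ≅ A.
Proof.
case=> f [g fK gK] fM.
pose g' : {linear B -> A} :=
  HB.pack g (GRing.isLinear.Build _ _ _ _ g (can2_linear fK gK)).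
exists g'; first by exists f.
by move=> x y /=; apply: (can_inj fK); rewrite gK fM !gK.
Qed.

Lemma alg_iso_trans (F : fieldType) (A B C : algebra F) :
  A ≅ B -> B ≅ C -> A ≅ C.
Proof.
case=> f bf fM [g bg gM]; exists (g \o f); first exact: bij_comp.
by move=> x y /=; rewrite fM gM.
Qed.

(** * Coordinates in F^4 and algebras given by tables *)

Definition vec (F : fieldType) (a b c d : F) : 'rV[F]_4 :=
  \row_(i < 4) nth 0 [:: a; b; c; d] i.

Notation i0 := (@Ordinal 4 0 isT).
Notation i1 := (@Ordinal 4 1 isT).
Notation i2 := (@Ordinal 4 2 isT).
Notation i3 := (@Ordinal 4 3 isT).

Lemma ord4P (P : 'I_4 -> Prop) : P i0 -> P i1 -> P i2 -> P i3 -> forall i, P i.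
Proof.
move=> P0 P1 P2 P3 [[|[|[|[|//]]]] Hi]; have -> := eq_irrelevance Hi isT; done.
Qed.

Lemma sum_ord4 (V : nmodType) (g : 'I_4 -> V) :
  \sum_(i < 4) g i = g i0 + g i1 + g i2 + g i3.
Proof.
rewrite !big_ord_recr big_ord0 /= add0r.
by do !congr (_ + _); congr g; apply: val_inj.
Qed.

Section Vec.
Variable F : fieldType.
Implicit Types v w : 'rV[F]_4.

Lemma vecE v : v = vec (v 0 i0) (v 0 i1) (v 0 i2) (v 0 i3).
Proof. by apply/rowP; apply: ord4P; rewrite !mxE. Qed.

Lemma vec_coord (a b c d : F) :
  ((vec a b c d 0 i0 = a) * (vec a b c d 0 i1 = b)) *
  ((vec a b c d 0 i2 = c) * (vec a b c d 0 i3 = d)).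
Proof. by rewrite !mxE. Qed.

Lemma vecP (a b c d a' b' c' d' : F) :
  a = a' -> b = b' -> c = c' -> d = d' -> vec a b c d = vec a' b' c' d'.
Proof. by move=> -> -> -> ->. Qed.

Lemma vec_inj (a b c d a' b' c' d' : F) :
  vec a b c d = vec a' b' c' d' -> [/\ a = a', b = b', c = c' & d = d'].
Proof.
move=> h; split;
  [move/rowP: h => /(_ i0)|move/rowP: h => /(_ i1)|move/rowP: h => /(_ i2)
  |move/rowP: h => /(_ i3)]; by rewrite !mxE.
Qed.

Lemma vec0 : 0 = vec 0 0 0 0 :> 'rV[F]_4.
Proof. by apply/rowP; apply: ord4P; rewrite !mxE. Qed.

Lemma scale_vec k a b c d : k *: vec a b c d = vec (k * a) (k * b) (k * c) (k * d) :> 'rV[F]_4.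
Proof. by apply/rowP; apply: ord4P; rewrite !mxE. Qed.

Lemma add_vec a b c d a' b' c' d' :
  vec a b c d + vec a' b' c' d' = vec (a + a') (b + b') (c + c') (d + d') :> 'rV[F]_4.
Proof. by apply/rowP; apply: ord4P; rewrite !mxE. Qed.

Lemma opp_vec a b c d : - vec a b c d = vec (- a) (- b) (- c) (- d) :> 'rV[F]_4.
Proof. by apply/rowP; apply: ord4P; rewrite !mxE. Qed.

Lemma delta_vec :
  ((delta_mx 0 i0 = vec 1 0 0 0 :> 'rV[F]_4) * (delta_mx 0 i1 = vec 0 1 0 0 :> 'rV[F]_4)) *
  ((delta_mx 0 i2 = vec 0 0 1 0 :> 'rV[F]_4) * (delta_mx 0 i3 = vec 0 0 0 1 :> 'rV[F]_4)).
Proof. by do !split; apply/rowP; apply: ord4P; rewrite !mxE. Qed.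

End Vec.

Section TableAlg.
Variables (F : fieldType) (r : table F) (rA : associative (table_mul r)).

Definition table_alg : algebra F := @Algebra F 'rV[F]_4 (table_mul r) rA.

(** Every normal form is reached through this lemma: by bilinearity, the linear map that sends the
    standard basis to [X] is multiplicative as soon as it is so on pairs of basis vectors. *)
Lemma iso_basis (A : algebra F) (X : 'I_4 -> A) :
  \dim (fullv : {vspace A}) = 4%N ->
  (forall v : 'rV[F]_4, \sum_i v 0 i *: X i = 0 -> v = 0) ->
  (forall i j, amul A (X i) (X j) =
     \sum_k table_mul r (delta_mx 0 i) (delta_mx 0 j) 0 k *: X k) ->
  A ≅ table_alg.
Proof.
move=> dimA freeX mulX; apply: alg_iso_sym.
pose f0 (v : 'rV[F]_4) : A := \sum_i v 0 i *: X i.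
have f0L : linear f0.
  move=> k v w; rewrite /f0 scaler_sumr -big_split; apply: eq_bigr => i _ /=.
  by rewrite !mxE scalerDl scalerA.
pose f : {linear table_alg -> A} :=
  HB.pack f0 (GRing.isLinear.Build _ _ _ _ f0 f0L).
have kf : lker (linfun f) = 0%VS.
  apply/eqP; rewrite -subv0; apply/subvP => v; rewrite memv_ker lfunE /=.
  by move/eqP/freeX => ->; rewrite mem0v.
have kf' : lker (linfun f) == 0%VS by rewrite kf.
have fE z : linfun f z = f z by exact: lfunE.
exists f.
  exists ((linfun f)^-1)%VF => x; rewrite -[f _]fE; first exact: lker0_lfunK.
  apply: limg_lfunVK.
  (* An injective linear map between spaces of dimension 4 is onto. *)
  suff -> : limg (linfun f) = fullv by rewrite memvf.
  apply/eqP; rewrite eqEdim subvf /= dimA limg_dim_eq ?kf ?capv0 //.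
  by rewrite dimvf /dim /= mul1n.
move=> x y /=; rewrite /f0.
rewrite linear_sumlz /=; under [RHS]eq_bigr do rewrite linear_sumr /=.
transitivity (\sum_i \sum_j (x 0 i * y 0 j) *: amul A (X i) (X j)); last first.
  by apply: eq_bigr => i _; apply: eq_bigr => j _;
    rewrite linearZl_LR linearZ /= scalerA.
under [RHS]eq_bigr => i _ do under eq_bigr => j _ do rewrite mulX scaler_sumr.
under [RHS]eq_bigr => i _ do rewrite exchange_big /=.
rewrite [RHS]exchange_big /=; apply: eq_bigr => k _.
have -> : table_mul r x y 0 k =
  \sum_i \sum_j (x 0 i * y 0 j) * table_mul r (delta_mx 0 i) (delta_mx 0 j) 0 k.
  rewrite table_mulE; under [RHS]eq_bigr => i _ do
    under eq_bigr => j _ do rewrite table_mulE mulr_sumr.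
  under [RHS]eq_bigr => i _ do rewrite exchange_big /=.
  rewrite [RHS]exchange_big /=; apply: eq_bigr => t _.
  rewrite (bigD1 t.1.1) //= (bigD1 t.1.2) //= [X in _ + X + _]big1 ?addr0.
    rewrite !mxE !eqxx /= !mul1r big1 ?addr0 // => i ni.
    by rewrite big1 // => j _; rewrite !mxE /= eq_sym (negPf ni) !(mul0r, mulr0).
  by move=> j nj; rewrite !mxE /= ![_ == j]eq_sym (negPf nj) !(mul0r, mulr0).
rewrite scaler_suml; apply: eq_bigr => i _; rewrite scaler_suml.
by apply: eq_bigr => j _; rewrite scalerA.
Qed.

End TableAlg.

Notation j0 := (@Ordinal 3 0 isT).
Notation j1 := (@Ordinal 3 1 isT).
Notation j2 := (@Ordinal 3 2 isT).

Lemma ord3P (P : 'I_3 -> Prop) : P j0 -> P j1 -> P j2 -> forall i, P i.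
Proof. move=> P0 P1 P2 [[|[|[|//]]] Hi]; have -> := eq_irrelevance Hi isT; done. Qed.

Lemma sum_ord3 (V : nmodType) (g : 'I_3 -> V) : \sum_(i < 3) g i = g j0 + g j1 + g j2.
Proof.
rewrite !big_ord_recr big_ord0 /= add0r.
by do !congr (_ + _); congr g; apply: val_inj.
Qed.

(** Polymorphic because it describes both families of vectors and permutations of the basis. *)
Definition row4 (T : Type) (a b c d : T) (i : 'I_4) : T :=
  match nat_of_ord i with 0%N => a | 1%N => b | 2%N => c | _ => d end.

(** * Algebras given by a bilinear form, by two generators, or by a chain a, a^2, a^3 *)

Section Families.
Variable F : fieldType.
Implicit Types M N P : 'M[F]_3.
Local Notation e i := (delta_mx 0 i : 'rV[F]_4).

Definition bf_table M : table F :=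
  [:: (i0, i0, M j0 j0 *: e i3); (i0, i1, M j0 j1 *: e i3); (i0, i2, M j0 j2 *: e i3);
      (i1, i0, M j1 j0 *: e i3); (i1, i1, M j1 j1 *: e i3); (i1, i2, M j1 j2 *: e i3);
      (i2, i0, M j2 j0 *: e i3); (i2, i1, M j2 j1 *: e i3); (i2, i2, M j2 j2 *: e i3)].

(** The basis is a, b, a^2, ab: these two products are independent, and the other two are expressed
    by them. *)
Definition pair_table (al be ga ep : F) : table F :=
  [:: (i0, i0, e i2); (i0, i1, e i3); (i1, i0, be *: e i2 + al *: e i3);
      (i1, i1, ga *: e i2 + ep *: e i3)].

(** The basis is a, a^2, c, a^3. Correcting c by a multiple of a^2 achieves ca = 0, so that only ac
    = s a^3 and c^2 = t a^3 remain as data. *)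
Definition chain_table (s t : F) : table F :=
  [:: (i0, i0, e i1); (i0, i1, e i3); (i1, i0, e i3); (i0, i2, s *: e i3);
      (i2, i2, t *: e i3)].

Lemma bf_tableA M : associative (table_mul (bf_table M)).
Proof.
apply: (@table_mul_assoc0 _ 3); rewrite /= ?andbT;
  repeat (apply/andP; split); apply/forallP => -[[|[|[|k]]] ?] //=;
  by rewrite !mxE /= ?mulr0.
Qed.

Lemma pair_tableA al be ga ep : associative (table_mul (pair_table al be ga ep)).
Proof.
apply: (@table_mul_assoc0 _ 2); rewrite /= ?andbT;
  repeat (apply/andP; split); apply/forallP => -[[|[|k]] ?] //=;
  by rewrite !mxE /= ?(mulr0, addr0).
Qed.

Lemma chain_tableA s t : associative (table_mul (chain_table s t)).
Proof.
move=> x y z; apply/rowP=> k; rewrite !(table_mulE, big_cons, big_nil) /=.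
by rewrite !mxE /=; ring.
Qed.

Definition bf M : algebra F := table_alg (@bf_tableA M).
Definition pair_alg al be ga ep : algebra F := table_alg (@pair_tableA al be ga ep).
Definition chain_alg s t : algebra F := table_alg (@chain_tableA s t).

Lemma bfE M (x y : 'rV[F]_4) : amul (bf M) x y = vec 0 0 0
  (M j0 j0 * x 0 i0 * y 0 i0 + M j0 j1 * x 0 i0 * y 0 i1 + M j0 j2 * x 0 i0 * y 0 i2 +
   M j1 j0 * x 0 i1 * y 0 i0 + M j1 j1 * x 0 i1 * y 0 i1 + M j1 j2 * x 0 i1 * y 0 i2 +
   M j2 j0 * x 0 i2 * y 0 i0 + M j2 j1 * x 0 i2 * y 0 i1 + M j2 j2 * x 0 i2 * y 0 i2).
Proof.
by apply/rowP; apply: ord4P; rewrite /= !(table_mulE, big_cons, big_nil) !mxE /=; ring.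
Qed.

Lemma pairE al be ga ep (x y : 'rV[F]_4) : amul (pair_alg al be ga ep) x y = vec 0 0
  (x 0 i0 * y 0 i0 + be * (x 0 i1 * y 0 i0) + ga * (x 0 i1 * y 0 i1))
  (x 0 i0 * y 0 i1 + al * (x 0 i1 * y 0 i0) + ep * (x 0 i1 * y 0 i1)).
Proof.
by apply/rowP; apply: ord4P; rewrite /= !(table_mulE, big_cons, big_nil) !mxE /=; ring.
Qed.

Lemma chainE s t (x y : 'rV[F]_4) : amul (chain_alg s t) x y = vec 0
  (x 0 i0 * y 0 i0) 0
  (x 0 i0 * y 0 i1 + x 0 i1 * y 0 i0 + s * (x 0 i0 * y 0 i2) + t * (x 0 i2 * y 0 i2)).
Proof.
by apply/rowP; apply: ord4P; rewrite /= !(table_mulE, big_cons, big_nil) !mxE /=; ring.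
Qed.

Lemma dim_rV4 : \dim (fullv : {vspace 'rV[F]_4}) = 4%N.
Proof. by rewrite dimvf /dim /= mul1n. Qed.

(** Some listed tables put their products on b or c, whereas [bf] uses only d and [chain_alg] uses b
    and d; a permutation of the basis bridges the difference. *)
Lemma iso_perm (L : listed F) (r : table F) (rA : associative (table_mul r)) (p : 'I_4 -> 'I_4) :
  injective p ->
  (forall x y : 'rV[F]_4,
     table_mul (products L) (\row_(i < 4) x 0 (p i)) (\row_(i < 4) y 0 (p i)) =
     \row_(i < 4) table_mul r x y 0 (p i)) ->
  L ≅ table_alg rA.
Proof.
move=> p_inj pM; apply: alg_iso_sym; have [q pK qK] := injF_bij p_inj.
pose f0 (v : 'rV[F]_4) : 'rV[F]_4 := \row_i v 0 (p i).
have f0L : linear f0 by move=> k v w; apply/rowP => i; rewrite !mxE.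
pose f : {linear table_alg rA -> listed_alg L} :=
  HB.pack f0 (GRing.isLinear.Build _ _ _ _ f0 f0L).
exists f => [|x y]; last by rewrite /= /f0 pM.
by exists (fun v : 'rV[F]_4 => \row_i v 0 (q i)) => v; apply/rowP => i;
  rewrite /= /f0 !mxE ?pK ?qK.
Qed.

Definition mx3 (a b c d e f g h i : F) : 'M[F]_3 :=
  \matrix_(k, l) nth 0 (nth [::] [:: [:: a; b; c]; [:: d; e; f]; [:: g; h; i]] k) l.

Ltac iso_perm_tac :=
  move=> x y; apply/rowP; apply: ord4P;
  rewrite /= !mxE !(table_mulE, big_cons, big_nil) /= !mxE /=; ring.

Ltac iso_same := apply: (@iso_perm _ _ _ id) => //; iso_perm_tac.

Definition perm_b (i : 'I_4) : 'I_4 := row4 i0 i3 i1 i2 i.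
Definition perm_c (i : 'I_4) : 'I_4 := row4 i0 i1 i3 i2 i.

Lemma perm_b_inj : injective perm_b.
Proof. by apply: ord4P; apply: ord4P. Qed.
Lemma perm_c_inj : injective perm_c.
Proof. by apply: ord4P; apply: ord4P. Qed.

Lemma listed1 : (A4_1 : listed F) ≅ bf 0.
Proof. iso_same. Qed.
Lemma listed2 : (A4_2 : listed F) ≅ bf (mx3 1 0 0 0 0 0 0 0 0).
Proof. apply: (iso_perm _ perm_b_inj) => //; iso_perm_tac. Qed.
Lemma listed3 delta : A4_3 delta ≅ bf (mx3 1 0 0 0 delta 0 0 0 0).
Proof. apply: (iso_perm _ perm_c_inj) => //; iso_perm_tac. Qed.
Lemma listed4 delta : A4_4 delta ≅ bf (mx3 1 1 0 0 delta 0 0 0 0).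
Proof. apply: (iso_perm _ perm_c_inj) => //; iso_perm_tac. Qed.
Lemma listed5 : (A4_5 : listed F) ≅ bf (mx3 0 1 0 (-1) 0 0 0 0 0).
Proof. apply: (iso_perm _ perm_c_inj) => //; iso_perm_tac. Qed.
Lemma listed7 : (A4_7 : listed F) ≅ bf (mx3 1 0 0 0 0 1 0 (-1) 0).
Proof. iso_same. Qed.
Lemma listed8 al be : A4_8 al be ≅ bf (mx3 1 0 0 0 al 0 0 0 be).
Proof. iso_same. Qed.
Lemma listed9 al be : A4_9 al be ≅ bf (mx3 al 0 0 0 1 1 0 0 be).
Proof. iso_same. Qed.
Lemma listed10 al : A4_10 al ≅ bf (mx3 1 1 0 0 al 1 0 1 0).
Proof. iso_same. Qed.
Lemma listed11 : (A4_11 : listed F) ≅ bf (mx3 1 1 0 0 0 0 0 1 (-1)).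
Proof. iso_same. Qed.
Lemma listed6 : (A4_6 : listed F) ≅ chain_alg 0 0.
Proof. apply: (iso_perm _ perm_c_inj) => //; iso_perm_tac. Qed.
Lemma listed12 : (A4_12 : listed F) ≅ chain_alg 1 1.
Proof. iso_same. Qed.
Lemma listed13 : (A4_13 : listed F) ≅ chain_alg 0 1.
Proof. iso_same. Qed.
Lemma listed14 : (A4_14 : listed F) ≅ chain_alg 1 0.
Proof. iso_same. Qed.
Lemma listed17 de : A4_17 de ≅ pair_alg 1 0 de 1.
Proof. iso_same. Qed.
Lemma listed18 de : A4_18 de ≅ pair_alg (-1) 0 de 0.
Proof. iso_same. Qed.
Lemma listed19 de : A4_19 de ≅ pair_alg 1 1 de 0.
Proof. iso_same. Qed.
Lemma listed20 : (A4_20 : listed F) ≅ pair_alg 0 1 0 0.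
Proof. iso_same. Qed.
Lemma listed21 de : A4_21 de ≅ pair_alg de 0 0 0.
Proof. iso_same. Qed.
Lemma listed22 : (A4_22 : listed F) ≅ pair_alg 1 1 1 0.
Proof. iso_same. Qed.
Lemma listed23 de : A4_23 de ≅ pair_alg 1 0 (- de) 0.
Proof. iso_same. Qed.
Lemma listed24 : (A4_24 : listed F) ≅ pair_alg 0 (-1) 1 0.
Proof. iso_same. Qed.
Lemma listed25 al be ga : A4_25 al be ga ≅ pair_alg al (- be) (- ga) 0.
Proof. iso_same. Qed.
Lemma listed26 al be ga : A4_26 al be ga ≅ pair_alg al be ga 0.
Proof. iso_same. Qed.

End Families.

(** * Isomorphism criteria *)

Section Criteria.
Variable F : fieldType.
Implicit Types M N P : 'M[F]_3.

Lemma mx3E (a b c d e f g h i : F) :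
  ((mx3 a b c d e f g h i j0 j0 = a) * (mx3 a b c d e f g h i j0 j1 = b) *
   (mx3 a b c d e f g h i j0 j2 = c)) *
  ((mx3 a b c d e f g h i j1 j0 = d) * (mx3 a b c d e f g h i j1 j1 = e) *
   (mx3 a b c d e f g h i j1 j2 = f)) *
  ((mx3 a b c d e f g h i j2 j0 = g) * (mx3 a b c d e f g h i j2 j1 = h) *
   (mx3 a b c d e f g h i j2 j2 = i)).
Proof. by rewrite !mxE. Qed.

Lemma mx3P M : M = mx3 (M j0 j0) (M j0 j1) (M j0 j2) (M j1 j0) (M j1 j1) (M j1 j2)
  (M j2 j0) (M j2 j1) (M j2 j2).
Proof. by apply/matrixP; apply: ord3P; apply: ord3P; rewrite mx3E. Qed.

Lemma mx3_inj (a b c d e f g h i a' b' c' d' e' f' g' h' i' : F) :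
  mx3 a b c d e f g h i = mx3 a' b' c' d' e' f' g' h' i' ->
  [/\ a = a', b = b' & c = c'] /\ [/\ d = d', e = e' & f = f'] /\
  [/\ g = g', h = h' & i = i'].
Proof.
move/matrixP => E.
have := E j0 j0; have := E j0 j1; have := E j0 j2; have := E j1 j0; have := E j1 j1.
have := E j1 j2; have := E j2 j0; have := E j2 j1; have := E j2 j2.
by rewrite !mx3E.
Qed.

Lemma mul_mx3 (a b c d e f g h i a' b' c' d' e' f' g' h' i' : F) :
  mx3 a b c d e f g h i *m mx3 a' b' c' d' e' f' g' h' i' =
  mx3 (a * a' + b * d' + c * g') (a * b' + b * e' + c * h') (a * c' + b * f' + c * i')
      (d * a' + e * d' + f * g') (d * b' + e * e' + f * h') (d * c' + e * f' + f * i')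
      (g * a' + h * d' + i * g') (g * b' + h * e' + i * h') (g * c' + h * f' + i * i').
Proof.
by apply/matrixP; apply: ord3P; apply: ord3P; rewrite mxE sum_ord3 !mx3E.
Qed.

Lemma tr_mx3 (a b c d e f g h i : F) :
  (mx3 a b c d e f g h i)^T = mx3 a d g b e h c f i.
Proof. by apply/matrixP; apply: ord3P; apply: ord3P; rewrite mxE !mx3E. Qed.

Lemma scale_mx3 (k a b c d e f g h i : F) :
  k *: mx3 a b c d e f g h i =
  mx3 (k * a) (k * b) (k * c) (k * d) (k * e) (k * f) (k * g) (k * h) (k * i).
Proof. by apply/matrixP; apply: ord3P; apply: ord3P; rewrite mxE !mx3E. Qed.

Lemma det_mx3 (a b c d e f g h i : F) :
  \det (mx3 a b c d e f g h i) =
  a * (e * i - f * h) - b * (d * i - f * g) + c * (d * h - e * g).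
Proof.
rewrite (expand_det_row _ j0) sum_ord3 !mx3E /cofactor !(expand_det_row _ ord0) !big_ord_recl !big_ord0 /cofactor !det_mx11.
by rewrite !mxE /= /bump /=; ring.
Qed.

(** The scalar [c] is the factor by which an isomorphism stretches the line that contains all
    products. *)
Definition similar_forms M N : Prop :=
  exists2 P : 'M[F]_3, P \in unitmx & exists2 c : F, c != 0 & P *m N *m P^T = c *: M.

Lemma similar_forms_sym M N : similar_forms M N -> similar_forms N M.
Proof.
case=> P uP [c c0 E]; exists (invmx P); first by rewrite unitmx_inv.
exists c^-1; first by rewrite invr_neq0.
rewrite -[M](scalerK c0) -E -!scalemxAr -!scalemxAl !mulmxA mulVmx // mul1mx.
by rewrite -mulmxA -trmx_mul mulVmx // trmx1 mulmx1.
Qed.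

Lemma similar_forms_trans M N Q :
  similar_forms M N -> similar_forms N Q -> similar_forms M Q.
Proof.
case=> P uP [c c0 E] [R uR [d d0 E']]; exists (P *m R); first by rewrite unitmx_mul uP.
exists (d * c); first by rewrite mulf_neq0.
rewrite trmx_mul !mulmxA -[P *m R *m Q]mulmxA -[P *m (R *m Q) *m _]mulmxA E'.
by rewrite -scalemxAr -scalemxAl E scalerA.
Qed.

(** The rows of [P] and the last basis vector multiplied by the scalar form a basis of [bf N] whose
    multiplication table is that of [bf M]. *)
Lemma iso_similar M N : similar_forms M N -> bf M ≅ bf N.
Proof.
case=> P uP [k k0 E]; apply: alg_iso_sym; apply: (@iso_basis _ _ _ (bf N) (@row4 (bf N)
   (vec (P j0 j0) (P j0 j1) (P j0 j2) 0) (vec (P j1 j0) (P j1 j1) (P j1 j2) 0)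
   (vec (P j2 j0) (P j2 j1) (P j2 j2) 0) (vec 0 0 0 k))).
- exact: dim_rV4.
- move=> v; rewrite sum_ord4 /row4 /= !scale_vec !add_vec vec0.
  case/vec_inj => e0 e1 e2; rewrite !mulr0 !add0r => /eqP.
  rewrite mulf_eq0 (negPf k0) orbF => /eqP v3.
  pose w : 'rV[F]_3 := \row_(i < 3) nth 0 [:: v 0 i0; v 0 i1; v 0 i2] i.
  have wE : (w 0 j0 = v 0 i0) * (w 0 j1 = v 0 i1) * (w 0 j2 = v 0 i2) by rewrite /w !mxE.
  have : w *m P = 0.
    by apply/rowP; apply: ord3P; rewrite mxE sum_ord3 !wE [RHS]mxE; [ rewrite -[RHS]e0|rewrite -[RHS]e1|rewrite -[RHS]e2]; ring.
  move/(congr1 (mulmx^~ (invmx P))); rewrite mulmxK // mul0mx => /rowP w0.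
  have := w0 j0; have := w0 j1; have := w0 j2; rewrite !wE !mxE => w2 w1 w0'.
  by rewrite [v]vecE w0' w1 w2 v3.
have Eij i j := congr1 (fun A : 'M_3 => A i j) E.
have := Eij j0 j0; have := Eij j0 j1; have := Eij j0 j2; have := Eij j1 j0.
have := Eij j1 j1; have := Eij j1 j2; have := Eij j2 j0; have := Eij j2 j1.
have := Eij j2 j2; rewrite !(mxE, sum_ord3).
move=> E22 E21 E20 E12 E11 E10 E02 E01 E00.
apply: ord4P; apply: ord4P; rewrite sum_ord4 /row4 /= !(bfE, delta_vec, vec_coord);
  rewrite !scale_vec !add_vec;
  apply: vecP; rewrite ?(mulr0, mul0r, addr0, add0r, mulr1, mul1r) //;
  rewrite [RHS]mulrC -?E00 -?E01 -?E02 -?E10 -?E11 -?E12 -?E20 -?E21 -?E22; ring.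
Qed.

(** As [M] is not 0, the last basis vector is a multiple of a product, so [f] maps it to a non-zero
    multiple of itself, which gives the scalar. Where invertibility of [P] is wanted, [similar_gram]
    recovers it from determinants. *)
Lemma similar_of_iso M N : M != 0 -> bf M ≅ bf N ->
  exists P, exists2 c : F, c != 0 & P *m N *m P^T = c *: M.
Proof.
move=> M0 [f [g fK gK] fM].
pose q (i : 'I_3) : 'rV[F]_4 := nth 0 [:: vec 1 0 0 0; vec 0 1 0 0; vec 0 0 1 0] i.
pose fq (i : 'I_3) (k : 'I_4) : F := (f (q i) : 'rV[F]_4) 0 k.
pose P := mx3 (fq j0 i0) (fq j0 i1) (fq j0 i2) (fq j1 i0) (fq j1 i1) (fq j1 i2)
  (fq j2 i0) (fq j2 i1) (fq j2 i2).
have Mq i j : amul (bf M) (q i) (q j) = M i j *: vec 0 0 0 1.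
  by move: i j; apply: ord3P; apply: ord3P; rewrite /q /= bfE !vec_coord scale_vec;
    apply: vecP; rewrite ?(mulr0, mul0r, addr0, add0r, mulr1, mul1r).
have Nf i j : amul (bf N) (f (q i)) (f (q j)) = (P *m N *m P^T) i j *: vec 0 0 0 1.
  rewrite bfE scale_vec !mulr0 !mulr1; congr vec; rewrite /P [N]mx3P tr_mx3 !mul_mx3.
  by move: i j; apply: ord3P; apply: ord3P; rewrite !mx3E /fq; ring.
have E i j : M i j *: (f (vec 0 0 0 1) : 'rV[F]_4) = (P *m N *m P^T) i j *: vec 0 0 0 1.
  by rewrite -Nf -fM Mq linearZ.
have [i [j Mij]] : exists i j, M i j != 0.
  apply: contrapT => H; case/eqP: M0; apply/matrixP => i j; rewrite mxE.
  by apply/eqP; apply: contrapT => /negP nz; apply: H; exists i, j.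
exists P; exists ((P *m N *m P^T) i j / M i j).
  apply/negP => /eqP c0.
  have f0 : f (vec 0 0 0 1) = 0.
    by rewrite -[f _](scalerK Mij) E scalerA mulrC c0 scale0r.
  have : vec 0 0 0 1 = 0 :> 'rV[F]_4 by apply: (can_inj fK); rewrite f0 linear0.
  rewrite vec0 => /vec_inj[_ _ _ h]; by move/eqP: h; rewrite oner_eq0.
apply/matrixP => i' j'; rewrite [RHS]mxE.
have fE : f (vec 0 0 0 1) = vec 0 0 0 ((P *m N *m P^T) i j / M i j).
  by rewrite -[f _](scalerK Mij) E scalerA scale_vec; apply: vecP;
    rewrite ?mulr0 ?mulr1 // mulrC.
have := E i' j'; rewrite fE !scale_vec => /vec_inj[_ _ _]; rewrite mulr1 => <-.
by rewrite mulrC.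
Qed.

End Criteria.

(** * Isomorphisms of two-generator algebras as 2 x 2 matrices *)

Section PairIso.
Variable F : fieldType.

Lemma det2_eq0 (u v x y : F) : u * y - v * x = 0 ->
  exists k l, [/\ (k != 0) || (l != 0), k * u + l * x = 0 & k * v + l * y = 0].
Proof.
move=> D; have [x0|x0] := eqVneq x 0; last first.
  exists x, (- u); rewrite x0; split=> //; first by ring.
  by rewrite -[RHS]oppr0 -D; ring.
have [y0|y0] := eqVneq y 0; last first.
  exists y, (- v); rewrite y0; split=> //; last by ring.
  by rewrite -[RHS]D; ring.
by exists 0, 1; rewrite oner_eq0 orbT x0 y0; split=> //; ring.
Qed.

(* Coordinates of the product of [(u, v, _, _)] and [(x, y, _, _)] in [pair_alg]. *)
Definition pc (be ga u v x y : F) := u * x + be * (v * x) + ga * (v * y).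
Definition pd (al ep u v x y : F) := u * y + al * (v * x) + ep * (v * y).

Lemma pair_vecE al be ga ep (u v w z u' v' w' z' : F) :
  amul (pair_alg al be ga ep) (vec u v w z) (vec u' v' w' z') =
  vec 0 0 (pc be ga u v u' v') (pd al ep u v u' v').
Proof. by rewrite pairE !vec_coord. Qed.

Lemma pair_tableE al be ga ep (u v w z u' v' w' z' : F) :
  table_mul (pair_table al be ga ep) (vec u v w z) (vec u' v' w' z') =
  vec 0 0 (pc be ga u v u' v') (pd al ep u v u' v').
Proof. exact: pair_vecE. Qed.

(** Let p = (u, v) and q = (x, y). A linear form on the span of c and d that kills p^2 and pq also
    kills qp and q^2 by the four relations. Since yp - vq and uq - xp are the old generators times
    the determinant, it then kills a^2 = c and ab = d, so it is 0. *)
Lemma pair_gens_neq0 (al be ga ep al' be' ga' ep' u v x y : F) :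
  u * y - v * x != 0 ->
  pc be' ga' x y u v = be * pc be' ga' u v u v + al * pc be' ga' u v x y ->
  pd al' ep' x y u v = be * pd al' ep' u v u v + al * pd al' ep' u v x y ->
  pc be' ga' x y x y = ga * pc be' ga' u v u v + ep * pc be' ga' u v x y ->
  pd al' ep' x y x y = ga * pd al' ep' u v u v + ep * pd al' ep' u v x y ->
  pc be' ga' u v u v * pd al' ep' u v x y - pd al' ep' u v u v * pc be' ga' u v x y != 0.
Proof.
move=> D c3 d3 c4 d4; apply/negP => /eqP D2.
have [k [l [kl e1 e2]]] : exists k l, [/\ (k != 0) || (l != 0),
    k * pc be' ga' u v u v + l * pd al' ep' u v u v = 0 &
    k * pc be' ga' u v x y + l * pd al' ep' u v x y = 0].
  by apply: det2_eq0; rewrite -[RHS]D2; ring.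
have e3 : k * pc be' ga' x y u v + l * pd al' ep' x y u v = 0.
  rewrite c3 d3; transitivity (be * (k * pc be' ga' u v u v + l * pd al' ep' u v u v) +
    al * (k * pc be' ga' u v x y + l * pd al' ep' u v x y)); first by ring.
  by rewrite e1 e2; ring.
have e4 : k * pc be' ga' x y x y + l * pd al' ep' x y x y = 0.
  rewrite c4 d4; transitivity (ga * (k * pc be' ga' u v u v + l * pd al' ep' u v u v) +
    ep * (k * pc be' ga' u v x y + l * pd al' ep' u v x y)); first by ring.
  by rewrite e1 e2; ring.
have D0 : (u * y - v * x) ^+ 2 != 0 by rewrite expf_neq0.
case/orP: kl => /negP; apply; rewrite -(mulrI_eq0 _ (mulfI D0)); apply/eqP.
  transitivity (y ^+ 2 * (k * pc be' ga' u v u v + l * pd al' ep' u v u v)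
    - v * y * (k * pc be' ga' u v x y + l * pd al' ep' u v x y)
    - v * y * (k * pc be' ga' x y u v + l * pd al' ep' x y u v)
    + v ^+ 2 * (k * pc be' ga' x y x y + l * pd al' ep' x y x y)).
    by rewrite /pc /pd; ring.
  by rewrite e1 e2 e3 e4; ring.
transitivity (- (x * y) * (k * pc be' ga' u v u v + l * pd al' ep' u v u v)
    + u * y * (k * pc be' ga' u v x y + l * pd al' ep' u v x y)
    + v * x * (k * pc be' ga' x y u v + l * pd al' ep' x y u v)
    - u * v * (k * pc be' ga' x y x y + l * pd al' ep' x y x y)).
  by rewrite /pc /pd; ring.
by rewrite e1 e2 e3 e4; ring.
Qed.

(** The parts of the images of a and b in A^2 annihilate everything, so only the matrix (u, v; x, y)
    modulo A^2 counts; the four equations say that the images satisfy the relations for ba and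
    b^2. *)
Lemma pair_iso (al be ga ep al' be' ga' ep' : F) :
  pair_alg al be ga ep ≅ pair_alg al' be' ga' ep' <->
  exists u v x y, u * y - v * x != 0 /\
  [/\ pc be' ga' x y u v = be * pc be' ga' u v u v + al * pc be' ga' u v x y,
      pd al' ep' x y u v = be * pd al' ep' u v u v + al * pd al' ep' u v x y,
      pc be' ga' x y x y = ga * pc be' ga' u v u v + ep * pc be' ga' u v x y &
      pd al' ep' x y x y = ga * pd al' ep' u v u v + ep * pd al' ep' u v x y].
Proof.
split=> [[f [g fK gK] fM]|[u [v [x [y [D [c3 d3 c4 d4]]]]]]].
  pose fa : 'rV[F]_4 := f (vec 1 0 0 0); pose fb : 'rV[F]_4 := f (vec 0 1 0 0).
  have faE : f (vec 1 0 0 0) = vec (fa 0 i0) (fa 0 i1) (fa 0 i2) (fa 0 i3).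
    exact: vecE.
  have fbE : f (vec 0 1 0 0) = vec (fb 0 i0) (fb 0 i1) (fb 0 i2) (fb 0 i3).
    exact: vecE.
  move: (fa 0 i0) (fa 0 i1) (fa 0 i2) (fa 0 i3) (fb 0 i0) (fb 0 i1) (fb 0 i2)
    (fb 0 i3) faE fbE => u v w z x y w' z' faE fbE {fa fb}.
  have cE : f (vec 0 0 1 0) = vec 0 0 (pc be' ga' u v u v) (pd al' ep' u v u v).
    rewrite -(pair_vecE al' be' ga' ep' u v w z u v w z) -faE -fM pair_vecE.
    by congr (f _); apply: vecP; rewrite /pc /pd; ring.
  have dE : f (vec 0 0 0 1) = vec 0 0 (pc be' ga' u v x y) (pd al' ep' u v x y).
    rewrite -(pair_vecE al' be' ga' ep' u v w z x y w' z') -faE -fbE -fM pair_vecE.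
    by congr (f _); apply: vecP; rewrite /pc /pd; ring.
  have lin k l : f (vec 0 0 k l) =
      vec 0 0 (k * pc be' ga' u v u v + l * pc be' ga' u v x y)
              (k * pd al' ep' u v u v + l * pd al' ep' u v x y).
    transitivity (k *: f (vec 0 0 1 0) + l *: f (vec 0 0 0 1)).
      rewrite -!linearZ -linearD /= !scale_vec add_vec.
      by congr (f _); apply: vecP; ring.
    by rewrite cE dE !scale_vec add_vec; apply: vecP; ring.
  exists u, v, x, y; split.
    (* A singular matrix would send some non-zero k a + l b into A^2, and its product with a, which
       is k c + l d, to 0. *)
    apply/negP => /eqP /det2_eq0[k [l [kl e1 e2]]].
    have : f (vec 0 0 k l) = f 0.
      have -> : vec 0 0 k l = amul (pair_alg al be ga ep) (vec 1 0 0 0) (vec k l 0 0).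
        by rewrite pair_vecE; apply: vecP; rewrite /pc /pd; ring.
      have -> : vec k l 0 0 = k *: vec 1 0 0 0 + l *: vec 0 1 0 0.
        by rewrite !scale_vec add_vec; apply: vecP; ring.
      rewrite fM linearD !linearZ /= faE fbE !scale_vec add_vec e1 e2 pair_vecE.
      by rewrite linear0 [RHS]vec0; apply: vecP; rewrite /pc /pd; ring.
    move/(can_inj fK); rewrite [RHS]vec0 => /vec_inj[_ _ k0 l0].
    by move: kl; rewrite k0 l0 eqxx.
  have := fM (vec 0 1 0 0) (vec 1 0 0 0); have := fM (vec 0 1 0 0) (vec 0 1 0 0).
  rewrite faE fbE !pair_vecE !lin.
  move=> /vec_inj[_ _ h1 h2] /vec_inj[_ _ h3 h4]; split.
  - by rewrite -h3; congr (_ * _ + _ * _); rewrite /pc /pd; ring.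
  - by rewrite -h4; congr (_ * _ + _ * _); rewrite /pc /pd; ring.
  - by rewrite -h1; congr (_ * _ + _ * _); rewrite /pc /pd; ring.
  - by rewrite -h2; congr (_ * _ + _ * _); rewrite /pc /pd; ring.
have D2 := pair_gens_neq0 D c3 d3 c4 d4.
apply: alg_iso_sym; apply: (@iso_basis _ _ _ (pair_alg al' be' ga' ep')
  (@row4 (pair_alg al' be' ga' ep') (vec u v 0 0) (vec x y 0 0)
   (vec 0 0 (pc be' ga' u v u v) (pd al' ep' u v u v))
   (vec 0 0 (pc be' ga' u v x y) (pd al' ep' u v x y)))).
- exact: dim_rV4.
- move=> t; rewrite sum_ord4 /row4 /= !scale_vec !add_vec [X in _ = X]vec0.
  case/vec_inj; rewrite !mulr0 !addr0 !add0r => e0 e1 e2 e3.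
  have det0 (p q r s k l : F) : p * s - q * r != 0 ->
      k * p + l * r = 0 -> k * q + l * s = 0 -> k = 0 /\ l = 0.
    move=> dn h1 h2; split; apply: (mulfI dn); rewrite mulr0.
      transitivity (s * (k * p + l * r) - r * (k * q + l * s)); first by ring.
      by rewrite h1 h2; ring.
    transitivity (p * (k * q + l * s) - q * (k * p + l * r)); first by ring.
    by rewrite h1 h2; ring.
  have [t0 t1] := det0 _ _ _ _ _ _ D e0 e1; have [t2 t3] := det0 _ _ _ _ _ _ D2 e2 e3.
  by rewrite [t]vecE t0 t1 t2 t3; exact: esym (vec0 F).
apply: ord4P; apply: ord4P; rewrite sum_ord4 /row4 /= !delta_vec;
  rewrite !pair_tableE !vec_coord !scale_vec !add_vec;
  apply: vecP; rewrite ?c3 ?d3 ?c4 ?d4 /pc /pd; ring.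
Qed.

End PairIso.

Lemma lincomb (R : zmodType) (a b c d : R) : c = d -> a - b = c - d -> a = b.
Proof. by move=> ->; rewrite subrr => /eqP; rewrite subr_eq0 => /eqP. Qed.

Definition eqM (R : pzRingType) (k x y : R) (h : x = y) : k * x = k * y :=
  congr1 ( *%R k) h.
Definition eqD (V : zmodType) (x y x' y' : V) (h : x = y) (h' : x' = y') :
  x + x' = y + y' := f_equal2 +%R h h'.

(* Proves a = b when a - b is the difference of the two sides of h, a linear combination of
   hypotheses built with eqD and eqM. In characteristic 2 a multiple of 2 = 0 absorbs the
   even coefficients. *)
Ltac lincomb h := apply: (lincomb h); ring.

Lemma alg_iso_congr (F : fieldType) (A B A' B' : algebra F) :
  A ≅ A' -> B ≅ B' -> (A ≅ B <-> A' ≅ B').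
Proof.
move=> hA hB; split=> h.
  exact: alg_iso_trans (alg_iso_sym hA) (alg_iso_trans h hB).
exact: alg_iso_trans hA (alg_iso_trans h (alg_iso_sym hB)).
Qed.

(** * Isomorphisms within the families 17 to 26 *)

Section PairCriteria.
Variable F : fieldType.

Lemma pchar2_eq0 : (2%N \in [pchar F]) -> 2%:R = 0 :> F.
Proof. exact: pcharf0. Qed.

Lemma pchar2_neq0 : (2%N \notin [pchar F]) -> 2%:R != 0 :> F.
Proof. by rewrite inE. Qed.

(** The algebra is commutative with a single relation, the binary quadratic form Y^2 + XY + de X^2
    up to a scalar; in characteristic 2 the class of [de] modulo the elements T^2 + T is its Arf
    invariant. *)
Lemma iso17 (de ep : F) : 2%N \in [pchar F] ->
  (A4_17 de ≅ A4_17 ep <-> exists T : F, T ^+ 2 + T + de + ep = 0).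
Proof.
move=> /pchar2_eq0 h2; apply: iff_trans (alg_iso_congr (listed17 de) (listed17 ep)) _.
apply: iff_trans (pair_iso _ _ _ _ _ _ _ _) _; split.
  case=> u [v [x [y [D [_ _ c4 d4]]]]]; move: c4 d4; rewrite /pc /pd => c4 d4.
  (* The numerator is the bilinear form YY' + YX' + de XX', whose diagonal is the relation, at the
     columns (u, x) and (v, y) of the matrix; the denominator is the value of the polar form
     there. *)
  exists ((x * y + x * v + de * u * v) / (u * y - v * x)).
  set D' := u * y - v * x in D *.
  suff E : (x * y + x * v + de * u * v) ^+ 2 + (x * y + x * v + de * u * v) * D' +
      (de + ep) * D' ^+ 2 = 0.
    by apply: (mulfI (expf_neq0 2 D)); rewrite mulr0 -[RHS]E; field.
  pose N1 := y ^+ 2 + v * y + de * v ^+ 2; rewrite /D'.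
  by apply: (lincomb (eqD (eqD (eqM N1 c4) (eqM (ep * (N1 + D')) d4)) (eqM (
    de * ep * u * v * y ^+ 2 - de * ep * u * v ^+ 2 * x + 2%:R * de * ep * u * v ^+ 2 * y + de *
    ep * u ^+ 2 * v * y - de * ep * v ^+ 2 * x * y + 2%:R * de * ep * v ^+ 3 * y + de * u * v ^+
    2 * x + de * u ^+ 2 * v * y + de * u ^+ 2 * y ^+ 2 + de ^+ 2 * ep * u * v ^+ 3 + de ^+ 2 *
    ep * v ^+ 4 + de ^+ 2 * u ^+ 2 * v ^+ 2 - ep * u * v * x * y + ep * u * v * y ^+ 2 - ep * u
    * x * y ^+ 2 + ep * u ^+ 2 * y ^+ 2 + ep * v * x ^+ 2 * y + ep * v ^+ 2 * y ^+ 2 - ep * x *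
    y ^+ 3 - ep * y ^+ 4 + u * v * x * y + u * x * y ^+ 2) h2))); rewrite /N1 /D'; ring.
case=> T hT; exists 1, 0, T, 1; split; first by rewrite mulr1 mul0r subr0 oner_eq0.
rewrite /pc /pd; split; try ring.
  by lincomb (eqD hT (eqM (- T - de) h2)).
by lincomb (eqM T h2).
Qed.

(** All squares are multiples of a^2, and squaring is the form X^2 + XY + de Y^2, again classified
    up to a scalar by its Arf invariant. The witness T is built as for [iso17], from the target form
    at the rows of the matrix. *)
Lemma iso19 (de ep : F) : 2%N \in [pchar F] ->
  (A4_19 de ≅ A4_19 ep <-> exists T : F, T ^+ 2 + T + de + ep = 0).
Proof.
move=> /pchar2_eq0 h2; apply: iff_trans (alg_iso_congr (listed19 de) (listed19 ep)) _.
apply: iff_trans (pair_iso _ _ _ _ _ _ _ _) _; split.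
  case=> u [v [x [y [D [c3 _ c4 _]]]]]; move: c3 c4; rewrite /pc /pd => c3 c4.
  exists ((u * x + v * x + ep * v * y) / (u * y - v * x)).
  set D' := u * y - v * x in D *.
  suff E : (u * x + v * x + ep * v * y) ^+ 2 + (u * x + v * x + ep * v * y) * D' +
      (de + ep) * D' ^+ 2 = 0.
    by apply: (mulfI (expf_neq0 2 D)); rewrite mulr0 -[RHS]E; field.
  pose N := u ^+ 2 + u * v + ep * v ^+ 2; rewrite /D'.
  by apply: (lincomb (eqD (eqD (eqM N c4) (eqM (de * (N + D')) c3)) (eqM (
    2%:R * de * ep * u * v ^+ 3 + 2%:R * de * ep * u ^+ 2 * v ^+ 2 + de * ep ^+ 2 * v ^+ 4 + de
    * u ^+ 2 * v ^+ 2 + 2%:R * de * u ^+ 3 * v + de * u ^+ 4) h2))); rewrite /N /D'; ring.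
case=> T hT; exists 1, 0, T, 1; split; first by rewrite mulr1 mul0r subr0 oner_eq0.
rewrite /pc /pd; split; try ring.
  by lincomb (eqD hT (eqM (- de) h2)).
by lincomb (eqM T h2).
Qed.

(** All squares are multiples of a^2, and squaring is the form X^2 + de Y^2 up to a scalar; away
    from characteristic 2 its discriminant modulo squares decides. *)
Lemma iso18_odd (de ep : F) : 2%N \notin [pchar F] ->
  (A4_18 de ≅ A4_18 ep <-> exists2 nu : F, nu != 0 & ep = nu ^+ 2 * de).
Proof.
move=> /pchar2_neq0 h2; apply: iff_trans (alg_iso_congr (listed18 de) (listed18 ep)) _.
apply: iff_trans (pair_iso _ _ _ _ _ _ _ _) _; split.
  case=> u [v [x [y [D [c3 d3 c4 d4]]]]].
  have D2 := pair_gens_neq0 D c3 d3 c4 d4; move: D2 c3 c4; rewrite /pc /pd => D2 c3 c4.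
  have N0 : u ^+ 2 + ep * v ^+ 2 != 0.
    apply: contraNN D2 => /eqP N0; apply/eqP.
    by lincomb (eqM (u * y - v * x) N0).
  have S0 : u * x + ep * v * y = 0.
    by apply: (mulfI h2); rewrite mulr0; lincomb c3.
  have E : ep * (u * y - v * x) ^+ 2 = de * (u ^+ 2 + ep * v ^+ 2) ^+ 2.
    by lincomb (eqD (eqM (u ^+ 2 + ep * v ^+ 2) c4) (eqM (- (u * x + ep * v * y)) S0)).
  exists ((u ^+ 2 + ep * v ^+ 2) / (u * y - v * x)).
    by rewrite mulf_neq0 ?invr_neq0.
  by apply: (mulIf (expf_neq0 2 D)); rewrite E; field.
case=> nu nu0 ->; exists nu, 0, 0, 1; split; first by rewrite mulr1 mul0r subr0.
by rewrite /pc /pd; split; ring.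
Qed.

(** In characteristic 2 the squaring form X^2 + de Y^2 is additive and every basis is orthogonal for
    it, so the new parameter is the ratio of its values at any two independent vectors, the first
    value being non-zero. *)
Lemma iso18_char2 (de ep : F) : 2%N \in [pchar F] ->
  (A4_18 de ≅ A4_18 ep <-> exists u v x y : F,
     [/\ u * y + v * x != 0, u ^+ 2 + v ^+ 2 * de != 0 &
         ep = (x ^+ 2 + y ^+ 2 * de) / (u ^+ 2 + v ^+ 2 * de)]).
Proof.
move=> /pchar2_eq0 h2.
(* [pair_iso] computes the products of the images with the parameter of the target, while the
   formula obtains [ep] from [de]; hence [de] has to be the target. *)
have -> : A4_18 de ≅ A4_18 ep <-> A4_18 ep ≅ A4_18 de by split; exact: alg_iso_sym.
apply: iff_trans (alg_iso_congr (listed18 ep) (listed18 de)) _.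
apply: iff_trans (pair_iso _ _ _ _ _ _ _ _) _; split.
  case=> u [v [x [y [D [c3 d3 c4 d4]]]]].
  have D2 := pair_gens_neq0 D c3 d3 c4 d4; move: D2 c3 c4; rewrite /pc /pd => D2 c3 c4.
  have N0 : u ^+ 2 + v ^+ 2 * de != 0.
    apply: contraNN D2 => /eqP N0; apply/eqP.
    by lincomb (eqM (u * y - v * x) N0).
  exists u, v, x, y; split=> //.
    by apply: contraNN D => /eqP D0; apply/eqP; lincomb (eqD D0 (eqM (- (v * x)) h2)).
  by apply: (mulIf N0); rewrite divfK //; lincomb (eqM (-1) c4).
case=> u [v [x [y [D N0 E]]]]; exists u, v, x, y; split.
  by apply: contraNN D => /eqP D0; apply/eqP; lincomb (eqD D0 (eqM (v * x) h2)).
have {}E : ep * (u ^+ 2 + v ^+ 2 * de) = x ^+ 2 + y ^+ 2 * de by rewrite E divfK.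
rewrite /pc /pd; split.
- by lincomb (eqM (x * u + de * y * v) h2).
- by ring.
- by lincomb (eqM (-1) E).
- by ring.
Qed.

(** An element of square zero has no component along a. So b goes to a multiple of b modulo A^2, and
    the ratio of ba to ab is preserved. *)
Lemma iso21_eq (de ep : F) : A4_21 de ≅ A4_21 ep -> de = ep.
Proof.
move/(alg_iso_congr (listed21 de) (listed21 ep)).1/pair_iso.
case=> u [v [x [y [D []]]]]; rewrite /pc /pd => _ d3 c4 _.
have x0 : x = 0.
  by apply/eqP; rewrite -sqrf_eq0; apply/eqP; lincomb c4.
move: D d3; rewrite x0 => D d3; apply: (mulIf D).
by lincomb (eqM (-1) d3).
Qed.

(* In A_{4,23} and A_{4,25} the symmetric relation [b^2 + ga a^2 = 0] is unique up to a scalar,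
   so the matrix (u, v; x, y) of an isomorphism is a similitude of binary forms. *)
Lemma similitude_binary (ga ga' u v x y : F) :
  2%:R != 0 :> F -> ga != 0 -> ga' != 0 -> u * y - v * x != 0 ->
  x * y = - ga * (u * v) ->
  x ^+ 2 - ga' * y ^+ 2 = - ga * (u ^+ 2 - ga' * v ^+ 2) ->
  exists2 nu, nu != 0 & [/\ ga = nu ^+ 2 * ga', x = - nu * ga' * v & y = nu * u].
Proof.
move=> h2 ga0 ga'0 D e1 e2.
(* Eliminating x from the two equations leaves a product. The second factor vanishes only for a
   singular matrix, since 2 is invertible. *)
have : (ga * u ^+ 2 - ga' * y ^+ 2) * (y ^+ 2 + ga * v ^+ 2) = 0.
  by lincomb (eqD (eqM (y ^+ 2) e2) (eqM (- (x * y) + ga * (u * v)) e1)).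
move/eqP; rewrite mulf_eq0 => /orP[|] /eqP e3; last first.
  have e4 : x ^+ 2 + ga * u ^+ 2 = 0 by lincomb (eqD e2 (eqM ga' e3)).
  have e5 : u * y + v * x = 0.
    by apply: (mulfI D); rewrite mulr0; lincomb (eqD (eqM (u ^+ 2) e3) (eqM (- v ^+ 2) e4)).
  have : 2%:R * ga * (u * u * v) = 0.
    by lincomb (eqD (eqM (- x) e5) (eqD (eqM u e1) (eqM v e4))).
  move/eqP; rewrite !mulf_eq0 (negPf h2) (negPf ga0) /= orbb.
  case/orP=> /eqP z0; move: D e3 e4; rewrite z0 => D e3 e4.
    by case/eqP: D; move: e4; rewrite expr0n /= mulr0 addr0 =>/eqP; rewrite sqrf_eq0 => /eqP ->; ring.
  by case/eqP: D; move: e3; rewrite expr0n /= mulr0 addr0 =>/eqP; rewrite sqrf_eq0 => /eqP ->; ring.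
have [u0|u0] := eqVneq u 0.
  have y0 : y = 0.
    apply/eqP; rewrite -sqrf_eq0; apply/eqP; apply: (mulfI ga'0).
    by rewrite mulr0; lincomb (eqD (eqM (-1) e3) (eqM (ga * u) u0)).
  move: D e2; rewrite u0 y0 mul0r sub0r oppr_eq0 mulf_eq0 negb_or => /andP[v0 x0] e2.
  exists (- x / (ga' * v)); first by rewrite mulf_neq0 ?oppr_eq0 ?invr_neq0 ?mulf_neq0.
  split; [|by field; rewrite v0 ga'0|by ring].
  apply: (mulIf (mulf_neq0 ga'0 (expf_neq0 2 v0))).
  transitivity (x ^+ 2); last by field; rewrite v0 ga'0.
  by lincomb (eqM (-1) e2).
have y0 : y != 0.
  apply: contraNN u0 => /eqP y0; rewrite -sqrf_eq0; apply/eqP; apply: (mulfI ga0).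
  by rewrite mulr0; lincomb (eqD e3 (eqM (ga' * y) y0)).
exists (y / u); first by rewrite mulf_neq0 ?invr_neq0.
split; last by rewrite divfK.
  apply: (mulIf (expf_neq0 2 u0)).
  transitivity (ga' * y ^+ 2); last by field.
  by lincomb e3.
apply: (mulIf (mulf_neq0 u0 y0)).
transitivity (- (ga' * y ^+ 2) * v); last by field.
by lincomb (eqD (eqM u e1) (eqM (- v) e3)).
Qed.

Lemma iso23 (de ep : F) : 2%N \notin [pchar F] -> de != 0 -> ep != 0 ->
  (A4_23 de ≅ A4_23 ep <-> exists2 nu : F, nu != 0 & ep = nu ^+ 2 * de).
Proof.
move=> /pchar2_neq0 h2 de0 ep0.
apply: iff_trans (alg_iso_congr (listed23 de) (listed23 ep)) _.
apply: iff_trans (pair_iso _ _ _ _ _ _ _ _) _; split.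
  case=> u [v [x [y [D []]]]]; rewrite /pc /pd => _ _ c4 d4.
  have [nu nu0 [E _ _]] : exists2 nu, nu != 0 &
      [/\ de = nu ^+ 2 * ep, x = - nu * ep * v & y = nu * u].
    apply: similitude_binary => //; last by lincomb c4.
    by apply: (mulfI h2); lincomb d4.
  exists nu^-1; first by rewrite invr_neq0.
  by rewrite E exprVn mulKf // expf_neq0.
case=> nu nu0 ->; exists nu, 0, 0, 1; split; first by rewrite mulr1 mul0r subr0.
by rewrite /pc /pd; split; ring.
Qed.

(** Here s = 1 - alpha, si = sigma and rho = si / nu. With the matrix from [similitude_binary] the
    two equations for b^2 become identities. Put z = u + v w with w^2 = -ga', let M be the norm of
    z, and write (rho + w) z^2 = L + K w. The other two equations become (2 - s') s K = (2 - s) s' M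
    and L = si' K. *)
Lemma pair25_eqs (s s' ga' si' nu rho u v : F) :
  2%:R != 0 :> F -> s != 0 -> nu != 0 ->
  [/\ pc (- (si' * s')) (- ga') (- nu * ga' * v) (nu * u) u v =
        - (nu * rho * s) * pc (- (si' * s')) (- ga') u v u v +
        (1 - s) * pc (- (si' * s')) (- ga') u v (- nu * ga' * v) (nu * u),
      pd (1 - s') 0 (- nu * ga' * v) (nu * u) u v =
        - (nu * rho * s) * pd (1 - s') 0 u v u v +
        (1 - s) * pd (1 - s') 0 u v (- nu * ga' * v) (nu * u),
      pc (- (si' * s')) (- ga') (- nu * ga' * v) (nu * u) (- nu * ga' * v) (nu * u) =
        - (nu ^+ 2 * ga') * pc (- (si' * s')) (- ga') u v u v +
        0 * pc (- (si' * s')) (- ga') u v (- nu * ga' * v) (nu * u) &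
      pd (1 - s') 0 (- nu * ga' * v) (nu * u) (- nu * ga' * v) (nu * u) =
        - (nu ^+ 2 * ga') * pd (1 - s') 0 u v u v +
        0 * pd (1 - s') 0 u v (- nu * ga' * v) (nu * u)] <->
  (2%:R - s') * s * (u ^+ 2 - ga' * v ^+ 2 + 2%:R * rho * u * v) =
    (2%:R - s) * s' * (u ^+ 2 + ga' * v ^+ 2) /\
  rho * (u ^+ 2 - ga' * v ^+ 2) - 2%:R * ga' * u * v =
    si' * (u ^+ 2 - ga' * v ^+ 2 + 2%:R * rho * u * v).
Proof.
move=> h2 s0 nu0; rewrite /pc /pd; split.
  case=> c3 d3 _ _; split.
    by apply: (mulfI nu0); lincomb (eqM 2%:R d3).
  by apply: (mulfI (mulf_neq0 nu0 s0)); lincomb (eqD c3 (eqM (- si') d3)).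
case=> e1 e2.
have d3 : pd (1 - s') 0 (- nu * ga' * v) (nu * u) u v =
        - (nu * rho * s) * pd (1 - s') 0 u v u v +
        (1 - s) * pd (1 - s') 0 u v (- nu * ga' * v) (nu * u).
  by apply: (mulfI h2); rewrite /pd; lincomb (eqM nu e1).
move: d3; rewrite /pd => d3; split=> //; try ring.
by lincomb (eqD (eqM (nu * s) e2) (eqM si' d3)).
Qed.

(** Here s = 1 + alpha. Divided by s s' (u^2 + ga' v^2), the last equation says that 1/s and 1/s'
    differ by an element of the set H of the target. *)
Lemma pair26_eqs (s s' ga' si' nu rho u v : F) :
  2%:R = 0 :> F -> s != 0 -> nu != 0 -> u ^+ 2 + ga' * v ^+ 2 != 0 ->
  [/\ pc (si' * s') ga' (nu * ga' * v) (nu * u) u v =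
        nu * rho * s * pc (si' * s') ga' u v u v +
        (s - 1) * pc (si' * s') ga' u v (nu * ga' * v) (nu * u),
      pd (s' - 1) 0 (nu * ga' * v) (nu * u) u v =
        nu * rho * s * pd (s' - 1) 0 u v u v +
        (s - 1) * pd (s' - 1) 0 u v (nu * ga' * v) (nu * u),
      pc (si' * s') ga' (nu * ga' * v) (nu * u) (nu * ga' * v) (nu * u) =
        nu ^+ 2 * ga' * pc (si' * s') ga' u v u v +
        0 * pc (si' * s') ga' u v (nu * ga' * v) (nu * u) &
      pd (s' - 1) 0 (nu * ga' * v) (nu * u) (nu * ga' * v) (nu * u) =
        nu ^+ 2 * ga' * pd (s' - 1) 0 u v u v +
        0 * pd (s' - 1) 0 u v (nu * ga' * v) (nu * u)] <->
  rho = si' /\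
  (s + s') * (u ^+ 2 + ga' * v ^+ 2) + s * s' * ga' * v ^+ 2 = si' * s * s' * u * v.
Proof.
move=> h2 s0 nu0 M0; rewrite /pc /pd; split.
  case=> c3 d3 _ _.
  have d : (s + s') * (u ^+ 2 + ga' * v ^+ 2) + s * s' * ga' * v ^+ 2 = rho * s * s' * u * v.
    apply: (mulfI nu0).
    by lincomb (eqD d3 (eqM (ga' * nu * s * s' * v ^+ 2 + nu * s * u ^+ 2) h2)).
  have c : si' * s' * (u ^+ 2 + ga' * v ^+ 2 + s * ga' * v ^+ 2) =
      rho * s * (u ^+ 2 + ga' * v ^+ 2 + si' * s' * u * v).
    apply: (mulfI nu0); lincomb (eqD c3 (eqM (ga' * nu * s * s' * si' * v ^+ 2 +
      ga' * nu * s * u * v - 2%:R * ga' * nu * u * v) h2)).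
  have E : rho = si'.
    apply: (mulfI (mulf_neq0 s0 M0)); lincomb (eqD (eqM (-1) c) (eqD (eqM (- si') d)
      (eqM (ga' * s * s' * si' * v ^+ 2 + ga' * s' * si' * v ^+ 2 -
        rho * s * s' * si' * u * v + s' * si' * u ^+ 2) h2))).
  by split=> //; rewrite -E in d *.
case=> -> d; split; try ring.
  lincomb (eqD (eqM (- (nu * si')) d) (eqM (nu * (ga' * s' * si' * v ^+ 2 -
    si' * s * s' * si' * u * v + s' * si' * u ^+ 2) - ga' * nu * s * u * v +
    2%:R * ga' * nu * u * v) h2)).
by lincomb (eqD (eqM nu d) (eqM (- ga' * nu * s * s' * v ^+ 2 - nu * s * u ^+ 2) h2)).
Qed.

End PairCriteria.

(** * The three-parameter families 25 and 26 *)

Section TwoTypes.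
Variable F : fieldType.

(** The criterion for [A4_25] without lambda and omega: for t = (1 + alpha) / (1 - alpha) the last
    condition is t' = psi t. Both a change of omega and the passage from lambda to its inverse
    change the sign of t', which the sign of phi absorbs. *)
Lemma pair25_iso (s s' si si' ga ga' : F) :
  2%:R != 0 :> F -> s != 0 -> s' != 0 -> 2%:R - s != 0 -> 2%:R - s' != 0 ->
  ga != 0 -> ga' != 0 -> si ^+ 2 + ga != 0 -> si' ^+ 2 + ga' != 0 ->
  (pair_alg (1 - s) (- (si * s)) (- ga) 0 ≅ pair_alg (1 - s') (- (si' * s')) (- ga') 0 <->
   exists phi nu : F, [/\ phi != 0, nu != 0, si' ^+ 2 + ga' = phi ^+ 2 * (si ^+ 2 + ga),
     ga = nu ^+ 2 * ga' & (2%:R - s') * s = nu * phi * ((2%:R - s) * s')]).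
Proof.
move=> h2 s0 s'0 t0 t'0 ga0 ga'0 n0 n'0.
split.
  case/pair_iso=> u [v [x [y [D [c3 d3 c4 d4]]]]].
  have [nu nu0 [gaE xE yE]] : exists2 nu, nu != 0 &
      [/\ ga = nu ^+ 2 * ga', x = - nu * ga' * v & y = nu * u].
    move: c4 d4; rewrite /pc /pd => c4 d4.
    have e1 : x * y = - ga * (u * v) by apply: (mulfI t'0); lincomb d4.
    apply: similitude_binary => //.
    by lincomb (eqD c4 (eqM (si' * s') e1)).
  pose rho := si / nu; have siE : si = nu * rho by rewrite /rho mulrC divfK.
  move: c3 d3 c4 d4 D n0; rewrite gaE xE yE siE => c3 d3 c4 d4 D n0.
  have [e1 e2] := (@pair25_eqs _ s s' ga' si' nu rho u v h2 s0 nu0).1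
    (And4 c3 d3 c4 d4).
  set M := u ^+ 2 + ga' * v ^+ 2 in e1; set K := _ - _ + _ in e1 e2.
  have M0 : M != 0.
    apply: contraNN D => /eqP M0; apply/eqP; rewrite -[RHS](mulr0 nu) -M0 /M; ring.
  have K0 : K != 0.
    apply/negP => /eqP K0; case/negP: (mulf_neq0 (mulf_neq0 t0 s'0) M0).
    by rewrite -e1 K0 mulr0.
  (* Thus psi = M / K, and the norms of the two sides of (rho + w) z^2 = K (si' + w) give the
     equation between sigma and sigma'. *)
  exists (M / (nu * K)), nu; split=> //.
  - by rewrite mulf_neq0 ?invr_neq0 ?mulf_neq0.
  - apply: (mulfI (expf_neq0 2 K0)).
    transitivity ((si' * K) ^+ 2 + ga' * K ^+ 2); first by ring.
    rewrite -e2; transitivity (M ^+ 2 * (rho ^+ 2 + ga')); first by rewrite /K /M; ring.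
    by field; rewrite nu0 K0.
  - apply: (mulIf K0); rewrite e1; field; rewrite K0 nu0; done.
case=> phi [nu [phi0 nu0 nE gaE tE]].
pose rho := si / nu; have siE : si = nu * rho by rewrite /rho mulrC divfK.
pose psi := nu * phi.
move: nE n0 tE; rewrite gaE siE -/psi => nE n0 tE.
have {}nE : si' ^+ 2 + ga' = psi ^+ 2 * (rho ^+ 2 + ga') by rewrite nE /psi; ring.
have psi0 : psi != 0 by rewrite mulf_neq0.
have fin u v : u ^+ 2 + ga' * v ^+ 2 != 0 ->
    psi * (u ^+ 2 - ga' * v ^+ 2 + 2%:R * rho * u * v) = u ^+ 2 + ga' * v ^+ 2 ->
    psi * (rho * (u ^+ 2 - ga' * v ^+ 2) - 2%:R * ga' * u * v) =
      si' * (u ^+ 2 + ga' * v ^+ 2) ->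
    pair_alg (1 - s) (- (nu * rho * s)) (- (nu ^+ 2 * ga')) 0 ≅
      pair_alg (1 - s') (- (si' * s')) (- ga') 0.
  move=> M0 e1 e2; apply/pair_iso; exists u, v, (- nu * ga' * v), (nu * u); split.
    rewrite (_ : _ - _ = nu * (u ^+ 2 + ga' * v ^+ 2)); last by ring.
    by rewrite mulf_neq0.
  apply: (@pair25_eqs _ s s' ga' si' nu rho u v h2 s0 nu0).2; split.
    by rewrite -e1 tE; ring.
  by apply: (mulfI psi0); rewrite e2 -e1; ring.
(* Hilbert 90 for F[w], w^2 = - ga': r = si' + w and p = psi (rho + w) have equal norms, and
   z = u + v w must satisfy z / conj z = r / p. Both conj p + r and w (r - conj p) do, and
   one of them is invertible. *)
have [M0|M0] := eqVneq ((psi * rho + si') ^+ 2 + ga' * (1 - psi) ^+ 2) 0; last first.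
  apply: (fin _ _ M0).
    by lincomb (eqM (psi - 1) nE).
  by lincomb (eqM (- (si' + psi * rho)) nE).
have M'0 : (- ga' * (1 + psi)) ^+ 2 + ga' * (si' - psi * rho) ^+ 2 != 0.
  apply: contraNN n'0 => /eqP M'0.
  apply/eqP; apply: (mulfI (mulf_neq0 ga'0 (mulf_neq0 h2 h2))); rewrite mulr0.
  by lincomb (eqD (eqD (eqM ga' M0) M'0) (eqM (2%:R * ga') nE)).
apply: (fin _ _ M'0).
  by lincomb (eqM (- ga' * (1 + psi)) nE).
by lincomb (eqM (ga' * (psi * rho - si')) nE).
Qed.

Lemma iso25 (al be ga al' be' ga' : F) :
  admissible (A4_25 al be ga) -> admissible (A4_25 al' be' ga') ->
  let sigma := be / (1 - al) in
  let sigma' := be' / (1 - al') in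
  (A4_25 al be ga ≅ A4_25 al' be' ga' <->
   exists phi nu : F,
     [/\ phi != 0, nu != 0, sigma' ^+ 2 + ga' = phi ^+ 2 * (sigma ^+ 2 + ga),
         ga = nu ^+ 2 * ga' &
         let psi := nu * phi in
         exists omega : F,
           [/\ omega = 1 \/ omega = -1,
               - omega != (1 + al) / (1 - al) * psi &
               let lambda :=
                 (psi * (1 + al) - omega * (1 - al)) /
                 (psi * (1 + al) + omega * (1 - al)) in
               let mu := sigma' * (1 - lambda) in
               (al' = lambda /\ be' = mu) \/
               [/\ lambda != 0, al' = lambda^-1 & be' = - (mu * lambda^-1)]]]).
Proof.
case=> ch al1 alm1 ga0 adm [_ al'1 al'm1 ga'0 adm'].
have h2 := pchar2_neq0 ch.
have [s sE] : exists s, s = 1 - al by exists (1 - al).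
have [s' s'E] : exists s', s' = 1 - al' by exists (1 - al').
have alE : al = 1 - s by rewrite sE; ring.
have al'E : al' = 1 - s' by rewrite s'E; ring.
have s0 : s != 0 by rewrite sE subr_eq0 eq_sym.
have s'0 : s' != 0 by rewrite s'E subr_eq0 eq_sym.
have tE : 1 + al = 2%:R - s by rewrite sE; ring.
have t0 : 2%:R - s != 0 by rewrite -tE addrC addr_eq0.
have t'0 : 2%:R - s' != 0.
  by rewrite (_ : _ - _ = al' + 1); [rewrite addr_eq0|rewrite s'E; ring].
have n0 : (be / s) ^+ 2 + ga != 0 by rewrite addr_eq0 sE.
have n'0 : (be' / s') ^+ 2 + ga' != 0 by rewrite addr_eq0 s'E.
rewrite /= -sE -s'E tE.
have [si siE] : exists si, si = be / s by exists (be / s).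
have [si' si'E] : exists si', si' = be' / s' by exists (be' / s').
have beE : be = si * s by rewrite siE divfK.
have be'E : be' = si' * s' by rewrite si'E divfK.
rewrite -siE -si'E in n0 n'0 *.
apply: iff_trans (alg_iso_congr (listed25 al be ga) (listed25 al' be' ga')) _.
rewrite alE al'E beE be'E.
apply: iff_trans (@pair25_iso s s' si si' ga ga' h2 s0 s'0 t0 t'0 ga0 ga'0 n0 n'0) _.
split=> -[phi [nu [phi0 nu0 nE gaE]]].
  (* The sign is already contained in phi, so omega = 1 serves. If the denominator of lambda were 0,
     [E] would give 2 s = 0. *)
  move=> E; exists phi, nu; split=> //; exists 1.
  have d0 : nu * phi * (2%:R - s) + s != 0.
    apply/negP => /eqP d0; case/negP: (mulf_neq0 h2 s0); apply/eqP.
    by lincomb (eqD E (eqM s' d0)).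
  split; first by left.
    apply: contraNN d0 => /eqP d0; apply/eqP.
    transitivity (((2%:R - s) / s * (nu * phi) + 1) * s); first by field.
    by rewrite -d0; ring.
  left; have l : 1 - s' = (nu * phi * (2%:R - s) - 1 * s) / (nu * phi * (2%:R - s) + 1 * s).
    apply: (mulIf d0); rewrite mul1r divfK //.
    by lincomb E.
  by split=> //; rewrite -l; ring.
case=> om [om1 d0 H].
have om2 : om * om = 1 by case: om1 => ->; ring.
have {}d0 : nu * phi * (2%:R - s) + om * s != 0.
  apply: contraNN d0 => /eqP d0; apply/eqP; apply: (mulIf s0).
  by transitivity (nu * phi * (2%:R - s)); [lincomb (eqM (-1) d0)|field].
case: H => [[l _]|[l0 l _]].
  exists (om * phi), nu; split=> //.
  - by rewrite mulf_neq0 //; case: om1 => ->; rewrite ?oppr_eq0 oner_neq0.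
  - by rewrite nE; lincomb (eqM (phi ^+ 2 * (si ^+ 2 + ga)) (esym om2)).
  have {}l : (1 - s') * (nu * phi * (2%:R - s) + om * s) = nu * phi * (2%:R - s) - om * s.
    by rewrite l divfK.
  lincomb (eqD (eqM om l) (eqM (- (2%:R - s') * s) om2)).
exists (- om * phi), nu; split=> //.
- by rewrite mulf_neq0 // oppr_eq0; case: om1 => ->; rewrite ?oppr_eq0 oner_neq0.
- by rewrite nE; lincomb (eqM (phi ^+ 2 * (si ^+ 2 + ga)) (esym om2)).
have {}l : (1 - s') * (nu * phi * (2%:R - s) - om * s) = nu * phi * (2%:R - s) + om * s.
  rewrite l invf_div divfK //; apply: contraNN l0 => /eqP ->.
  by rewrite mul0r.
lincomb (eqD (eqM (- om) l) (eqM (- (2%:R - s') * s) om2)).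
Qed.

(** Let w^2 = ga. The quotient defining H is a homomorphism from the elements u + v w of non-zero
    norm, under multiplication, to the additive group of F, so a sum is realized by a product. In
    characteristic 2 opposites are free. *)
Lemma additive_H26 (al be ga : F) : admissible (A4_26 al be ga) ->
  additive_subgroup (H26 al be ga).
Proof.
case=> /pchar2_eq0 h2 al1 ga0; split.
- exists 1, 0; rewrite expr0n /= mulr0 addr0 expr1n; split; first exact: oner_neq0.
  by rewrite !mulr0 addr0 mul0r.
- move=> h h' [u [v [M0 ->]]] [u' [v' [M'0 ->]]].
  set si := be / (1 + al).
  exists (u * u' + ga * v * v'), (u * v' + u' * v).
  have E : (u * u' + ga * v * v') ^+ 2 + ga * (u * v' + u' * v) ^+ 2 =
      (u ^+ 2 + ga * v ^+ 2) * (u' ^+ 2 + ga * v' ^+ 2).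
    by lincomb (eqM (2%:R * ga * u * u' * v * v') h2).
  rewrite E mulf_neq0 //; split=> //.
  apply: (mulIf (mulf_neq0 M0 M'0)); rewrite divfK ?mulf_neq0 //.
  transitivity ((si * u * v + ga * v ^+ 2) * (u' ^+ 2 + ga * v' ^+ 2) +
    (si * u' * v' + ga * v' ^+ 2) * (u ^+ 2 + ga * v ^+ 2)).
    by field; rewrite M0 M'0.
  by rewrite -/si; lincomb (eqM (ga ^+ 2 * v ^+ 2 * v' ^+ 2 - ga * u * u' * v * v') h2).
- move=> h [u [v [M0 ->]]]; exists u, v; split=> //.
  set w := _ / _; by lincomb (eqM (- w) h2).
Qed.

(** Counterpart of [similitude_binary] in characteristic 2. The second factor left by eliminating x
    would give x^2 = ga u^2 and y^2 = ga v^2, hence (uy)^2 = (vx)^2 and determinant 0. *)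
Lemma similitude_binary2 (ga ga' u v x y : F) :
  2%:R = 0 :> F -> ga != 0 -> ga' != 0 -> u * y - v * x != 0 ->
  x * y = ga * (u * v) ->
  x ^+ 2 + ga' * y ^+ 2 = ga * (u ^+ 2 + ga' * v ^+ 2) ->
  exists2 nu, nu != 0 & [/\ ga = nu ^+ 2 * ga', x = nu * ga' * v & y = nu * u].
Proof.
move=> h2 ga0 ga'0 D e1 e2.
have : (ga * u ^+ 2 - ga' * y ^+ 2) * (y ^+ 2 - ga * v ^+ 2) = 0.
  by lincomb (eqD (eqM (- y ^+ 2) e2) (eqM (x * y + ga * (u * v)) e1)).
move/eqP; rewrite mulf_eq0 => /orP[|] /eqP e3; last first.
  have e4 : x ^+ 2 - ga * u ^+ 2 = 0 by lincomb (eqD e2 (eqM (- ga') e3)).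
  case/eqP: D; apply/eqP; rewrite -sqrf_eq0; apply/eqP.
  lincomb (eqD (eqM (u ^+ 2) e3) (eqD (eqM (v ^+ 2) e4) (eqM (- (u * y * v * x) +
    ga * u ^+ 2 * v ^+ 2) h2))).
have [u0|u0] := eqVneq u 0.
  have y0 : y = 0.
    apply/eqP; rewrite -sqrf_eq0; apply/eqP; apply: (mulfI ga'0).
    by rewrite mulr0; lincomb (eqD (eqM (-1) e3) (eqM (ga * u) u0)).
  move: D e2; rewrite u0 y0 mul0r sub0r oppr_eq0 mulf_eq0 negb_or => /andP[v0 x0] e2.
  exists (x / (ga' * v)); first by rewrite mulf_neq0 ?invr_neq0 ?mulf_neq0.
  split; [|by field; rewrite v0 ga'0|by ring].
  apply: (mulIf (mulf_neq0 ga'0 (expf_neq0 2 v0))).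
  transitivity (x ^+ 2); last by field; rewrite v0 ga'0.
  by lincomb (eqM (-1) e2).
have y0 : y != 0.
  apply: contraNN u0 => /eqP y0; rewrite -sqrf_eq0; apply/eqP; apply: (mulfI ga0).
  by rewrite mulr0; lincomb (eqD e3 (eqM (ga' * y) y0)).
exists (y / u); first by rewrite mulf_neq0 ?invr_neq0.
split; last by rewrite divfK.
  apply: (mulIf (expf_neq0 2 u0)).
  transitivity (ga' * y ^+ 2); last by field.
  by lincomb e3.
apply: (mulIf (mulf_neq0 u0 y0)).
transitivity ((ga' * y ^+ 2) * v); last by field.
by lincomb (eqD (eqM u e1) (eqM v e3)).
Qed.

Lemma pair26_iso (s s' si si' ga ga' : F) :
  2%:R = 0 :> F -> s != 0 -> s' != 0 -> ga != 0 -> ga' != 0 ->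
  (pair_alg (s - 1) (si * s) ga 0 ≅ pair_alg (s' - 1) (si' * s') ga' 0 <->
   (exists2 nu : F, nu != 0 & ga = nu ^+ 2 * ga' /\ si = nu * si') /\
   (exists2 h, exists u v : F, u ^+ 2 + ga * v ^+ 2 != 0 /\
      h = (si * u * v + ga * v ^+ 2) / (u ^+ 2 + ga * v ^+ 2) &
      1 / s' = 1 / s + h)).
Proof.
move=> h2 s0 s'0 ga0 ga'0.
apply: iff_trans (pair_iso _ _ _ _ _ _ _ _) _; split.
  case=> u [v [x [y [D [c3 d3 c4 d4]]]]].
  have [nu nu0 [gaE xE yE]] : exists2 nu, nu != 0 &
      [/\ ga = nu ^+ 2 * ga', x = nu * ga' * v & y = nu * u].
    move: c4 d4 c3 d3; rewrite /pc /pd => c4 d4 _ _.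
    apply: (@similitude_binary2 ga ga' u v x y) => //.
      by apply: (mulfI s'0); lincomb d4.
    have e1 : x * y = ga * (u * v) by apply: (mulfI s'0); lincomb d4.
    by lincomb (eqD c4 (eqM (- (si' * s')) e1)).
  pose rho := si / nu; have siE : si = nu * rho by rewrite /rho mulrC divfK.
  move: c3 d3 c4 d4 D; rewrite gaE xE yE siE => c3 d3 c4 d4 D.
  have M0 : u ^+ 2 + ga' * v ^+ 2 != 0.
    apply: contraNN D => /eqP M0; apply/eqP.
    by lincomb (eqD (eqM nu M0) (eqM (- nu * ga' * v ^+ 2) h2)).
  have [-> d] := (@pair26_eqs _ s s' ga' si' nu rho u v h2 s0 nu0 M0).1 (And4 c3 d3 c4 d4).
  split; first by exists nu.
  (* As sigma = nu sigma' and gamma = nu^2 gamma', replacing u by nu u identifies the sets H of the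
     two algebras. *)
  exists ((nu * si' * (nu * u) * v + nu ^+ 2 * ga' * v ^+ 2) /
    ((nu * u) ^+ 2 + nu ^+ 2 * ga' * v ^+ 2)).
    exists (nu * u), v; split=> //.
    by rewrite (_ : _ + _ = nu ^+ 2 * (u ^+ 2 + ga' * v ^+ 2)) ?mulf_neq0 ?expf_neq0 //; ring.
  rewrite [X in _ = _ + X](_ : _ =
      (si' * u * v + ga' * v ^+ 2) / (u ^+ 2 + ga' * v ^+ 2)); last first.
    field; rewrite M0 (_ : _ + _ = nu ^+ 2 * (u ^+ 2 + ga' * v ^+ 2)) ?mulf_neq0 ?expf_neq0 //.
    by ring.
  apply: (mulIf (mulf_neq0 (mulf_neq0 s0 s'0) M0)).
  transitivity (s * (u ^+ 2 + ga' * v ^+ 2)); first by field; rewrite s'0.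
  transitivity (s' * (u ^+ 2 + ga' * v ^+ 2) + (si' * u * v + ga' * v ^+ 2) * s * s').
    by lincomb (eqD d (eqM (- s' * (u ^+ 2 + ga' * v ^+ 2) - ga' * v ^+ 2 * s * s') h2)).
  by field; rewrite M0 s0.
case=> [[nu nu0 [gaE siE]] [h [u [v [M0 hE]]] E]].
move: M0 hE; rewrite gaE siE => M0 hE.
pose u' := u / nu; have uE : u = nu * u' by rewrite /u' mulrC divfK.
have {}M0 : u' ^+ 2 + ga' * v ^+ 2 != 0.
  by apply: contraNN M0 => /eqP M0; apply/eqP; rewrite uE; lincomb (eqM (nu ^+ 2) M0).
have {}hE : h * (u' ^+ 2 + ga' * v ^+ 2) = si' * u' * v + ga' * v ^+ 2.
  have M1 : (nu * u') ^+ 2 + nu ^+ 2 * ga' * v ^+ 2 != 0.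
    by rewrite (_ : _ + _ = nu ^+ 2 * (u' ^+ 2 + ga' * v ^+ 2)) ?mulf_neq0 ?expf_neq0 //; ring.
  by rewrite hE uE; field.
exists u', v, (nu * ga' * v), (nu * u'); split.
  apply: contraNN M0 => /eqP D; apply/eqP; apply: (mulfI nu0).
  by lincomb (eqD D (eqM (nu * ga' * v ^+ 2) h2)).
apply: (@pair26_eqs _ s s' ga' si' nu si' u' v h2 s0 nu0 M0).2; split=> //.
have {}E : s = s' + h * s * s'.
  transitivity (1 / s' * (s * s')); first by field; rewrite s'0.
  by rewrite E; field; rewrite s0.
by lincomb (eqD (eqM (u' ^+ 2 + ga' * v ^+ 2) E) (eqD (eqM (s * s') hE)
  (eqM (s' * (u' ^+ 2 + ga' * v ^+ 2) + s * s' * ga' * v ^+ 2) h2))).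
Qed.

Lemma iso26 (al be ga al' be' ga' : F) :
  admissible (A4_26 al be ga) -> admissible (A4_26 al' be' ga') ->
  let sigma := be / (1 + al) in
  let sigma' := be' / (1 + al') in
  (A4_26 al be ga ≅ A4_26 al' be' ga' <->
   (exists2 nu : F, nu != 0 & ga = nu ^+ 2 * ga' /\ sigma = nu * sigma') /\
   (exists2 h : F, H26 al be ga h & 1 / (1 + al') = 1 / (1 + al) + h)).
Proof.
case=> /pchar2_eq0 h2 al1 ga0 [_ al'1 ga'0] /=.
have np (x : F) : x != 1 -> 1 + x != 0.
  by apply: contraNN => /eqP E; apply/eqP; lincomb (eqD E (eqM (-1) h2)).
rewrite /H26; set s := 1 + al; set s' := 1 + al'.
have s0 : s != 0 := np _ al1; have s'0 : s' != 0 := np _ al'1.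
apply: iff_trans (alg_iso_congr (listed26 al be ga) (listed26 al' be' ga')) _.
have := @pair26_iso s s' (be / s) (be' / s') ga ga' h2 s0 s'0 ga0 ga'0.
by rewrite !divfK // /s /s' ![1 + _]addrC !addrK.
Qed.

End TwoTypes.

(** * Isomorphisms within the families 3 to 10 *)

Section FormCriteria.
Variable F : fieldType.
Implicit Types M N P : 'M[F]_3.

Lemma mx3_neq0 M i j : M i j != 0 -> M != 0.
Proof. by apply: contraNN => /eqP ->; rewrite mxE. Qed.

Lemma similar_gram M N P (c : F) :
  c != 0 -> \det M != 0 -> P *m N *m P^T = c *: M -> similar_forms M N.
Proof.
move=> c0 dM E; exists P; last by exists c.
have : \det (P *m N *m P^T) != 0.
  by rewrite E detZ mulf_neq0 ?expf_neq0.
rewrite !det_mulmx det_tr mulf_eq0 negb_or => /andP[+ _].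
by rewrite mulf_eq0 negb_or unitmxE unitfE => /andP[].
Qed.

(** The third coordinate spans the radical, so the 2 x 2 blocks decide; their determinants give c^2
    de = ep D^2 with D the minor of [P]. *)
Lemma iso3 (de ep : F) : de != 0 -> ep != 0 ->
  (A4_3 de ≅ A4_3 ep <-> exists2 nu : F, nu != 0 & de = nu ^+ 2 * ep).
Proof.
move=> de0 ep0; apply: iff_trans (alg_iso_congr (listed3 de) (listed3 ep)) _; split.
  case/similar_of_iso; first by apply: (@mx3_neq0 _ j0 j0); rewrite mx3E oner_neq0.
  move=> P [c c0]; rewrite [P]mx3P.
  move: (P j0 j0) (P j0 j1) (P j0 j2) (P j1 j0) (P j1 j1) (P j1 j2)
    (P j2 j0) (P j2 j1) (P j2 j2) => p00 p01 p02 p10 p11 p12 p20 p21 p22.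
  rewrite tr_mx3 !mul_mx3 scale_mx3 => /mx3_inj[[e00 e01 _] [[e10 e11 _] _]].
  have E : c ^+ 2 * de = ep * (p00 * p11 - p01 * p10) ^+ 2.
    lincomb (eqD (eqM (- c) e11) (eqD (eqM (- (p10 ^+ 2 + ep * p11 ^+ 2)) e00)
      (eqM (p00 * p10 + ep * p01 * p11) e01))).
  have D0 : p00 * p11 - p01 * p10 != 0.
    apply/negP => /eqP D0; case/negP: (mulf_neq0 (expf_neq0 2 c0) de0).
    by rewrite E D0 expr0n mulr0.
  exists ((p00 * p11 - p01 * p10) / c); first by rewrite mulf_neq0 ?invr_neq0.
  by apply: (mulfI (expf_neq0 2 c0)); rewrite E; field.
case=> nu nu0 ->; apply: iso_similar.
exists (mx3 1 0 0 0 nu 0 0 0 1); last first.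
  exists 1; first exact: oner_neq0.
  by rewrite tr_mx3 !mul_mx3 scale_mx3; congr mx3; ring.
rewrite unitmxE unitfE det_mx3.
by rewrite (_ : _ + _ = nu) //; ring.
Qed.

(** The alternating part of the form is multiplied by the 2 x 2 minor of [P], which therefore equals
    [c]; the determinants of the blocks then give c^2 de = ep c^2. *)
Lemma iso4_eq (de ep : F) : A4_4 de ≅ A4_4 ep -> de = ep.
Proof.
move/(alg_iso_congr (listed4 de) (listed4 ep)).1.
case/similar_of_iso; first by apply: (@mx3_neq0 _ j0 j0); rewrite mx3E oner_neq0.
move=> P [c c0]; rewrite [P]mx3P.
move: (P j0 j0) (P j0 j1) (P j0 j2) (P j1 j0) (P j1 j1) (P j1 j2)
  (P j2 j0) (P j2 j1) (P j2 j2) => p00 p01 p02 p10 p11 p12 p20 p21 p22.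
rewrite tr_mx3 !mul_mx3 scale_mx3 => /mx3_inj[[e00 e01 _] [[e10 e11 _] _]].
have D : p00 * p11 - p01 * p10 = c by lincomb (eqD e01 (eqM (-1) e10)).
have E : c ^+ 2 * de = ep * c ^+ 2.
  rewrite -{2}D.
  lincomb (eqD (eqM (- c) e11) (eqD (eqM (- (p10 ^+ 2 + p10 * p11 + ep * p11 ^+ 2)) e00)
    (eqM (p00 * p10 + p00 * p11 + ep * p01 * p11) e10))).
by apply: (mulfI (expf_neq0 2 c0)); rewrite E mulrC.
Qed.

(* The alternating part of either form lives on the last two coordinates. *)
Lemma iso9 (al be ga de : F) : al != 0 -> ga != 0 ->
  (A4_9 al be ≅ A4_9 ga de <->
   be = de /\ exists s t : F, t ^+ 2 - s * t + de * s ^+ 2 = al / ga).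
Proof.
move=> al0 ga0; apply: iff_trans (alg_iso_congr (listed9 al be) (listed9 ga de)) _; split.
  case/similar_of_iso; first by apply: (@mx3_neq0 _ j0 j0); rewrite mx3E.
  move=> P [c c0]; rewrite [P]mx3P.
  move: (P j0 j0) (P j0 j1) (P j0 j2) (P j1 j0) (P j1 j1) (P j1 j2)
    (P j2 j0) (P j2 j1) (P j2 j2) => p00 p01 p02 p10 p11 p12 p20 p21 p22.
  rewrite tr_mx3 !mul_mx3 scale_mx3.
  move=> /mx3_inj[[e00 e01 e02] [[e10 e11 e12] [e20 e21 e22]]].
  have k01 : p01 * p12 - p02 * p11 = 0 by lincomb (eqD e01 (eqM (-1) e10)).
  have k02 : p01 * p22 - p02 * p21 = 0 by lincomb (eqD e02 (eqM (-1) e20)).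
  have k12 : p11 * p22 - p12 * p21 = c by lincomb (eqD e12 (eqM (-1) e21)).
  have z1 : p01 = 0.
    by apply: (mulfI c0); lincomb (eqD (eqM (- p01) k12) (eqD (eqM p11 k02) (eqM (- p21) k01))).
  have z2 : p02 = 0.
    by apply: (mulfI c0); lincomb (eqD (eqM (- p02) k12) (eqD (eqM p12 k02) (eqM (- p22) k01))).
  move: e00 e01 e02; rewrite z1 z2 => e00 e01 e02.
  have p0 : p00 != 0.
    apply/negP => /eqP p0; case/negP: (mulf_neq0 c0 al0); apply/eqP.
    by lincomb (eqD (eqM (-1) e00) (eqM (p00 * ga) p0)).
  have z10 : p10 = 0 by apply: (mulfI (mulf_neq0 p0 ga0)); lincomb e01.
  have z20 : p20 = 0 by apply: (mulfI (mulf_neq0 p0 ga0)); lincomb e02.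
  move: e11 e12 e21 e22; rewrite z10 z20 => e11 e12 e21 e22.
  split.
    apply: (mulfI (expf_neq0 2 c0)).
    transitivity (de * (p11 * p22 - p12 * p21) ^+ 2); last by rewrite k12; ring.
    lincomb (eqD (eqM (- c) e22) (eqD (eqM (- (p21 ^+ 2 + p21 * p22 + de * p22 ^+ 2)) e11)
      (eqM (p11 * p21 + p11 * p22 + de * p12 * p22) e21))).
  (* By [e00] and [e11], al / ga is p00^2 / c and c is the value p11^2 + p11 p12 + de p12^2;
     rescaling this value by (p00 / c)^2 gives al / ga. *)
  exists (- (p00 * p12) / c), (p00 * p11 / c).
  apply: (mulIf (mulf_neq0 ga0 (expf_neq0 2 c0))).
  transitivity (ga * p00 ^+ 2 * (p11 ^+ 2 + p11 * p12 + de * p12 ^+ 2)); first by field.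
  transitivity (al * c ^+ 2); last by field.
  lincomb (eqD (eqM c e00) (eqM (ga * p00 ^+ 2) e11)).
case=> -> [s [t N]]; have {}N : ga * (t ^+ 2 - s * t + de * s ^+ 2) = al.
  by rewrite N mulrC divfK.
set n := t ^+ 2 - s * t + de * s ^+ 2 in N.
have n0 : n != 0 by apply: contraNN al0 => /eqP n0; rewrite -N n0 mulr0.
(* The lower block is a similitude of the non-symmetric plane with factor n, and n in the corner
   gives n^2 ga = n al. *)
apply: iso_similar; exists (mx3 n 0 0 0 t (- s) 0 (de * s) (t - s)).
  rewrite unitmxE unitfE det_mx3 (_ : _ + _ = n * n) ?mulf_neq0 //.
  by rewrite {3}/n; ring.
exists n => //; rewrite -N tr_mx3 !mul_mx3 scale_mx3; congr mx3; rewrite ?/n; ring.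
Qed.

Lemma iso10_zero (al : F) : 2%N \notin [pchar F] -> A4_10 al ≅ A4_10 (0 : F).
Proof.
move=> /pchar2_neq0 h2; apply/(alg_iso_congr (listed10 al) (listed10 0)).
apply: iso_similar; exists (mx3 1 0 0 0 1 (al / 2%:R) 0 0 1).
  by rewrite unitmxE unitfE det_mx3 (_ : _ + _ = 1) ?oner_neq0 //; ring.
exists 1; first exact: oner_neq0.
by rewrite tr_mx3 !mul_mx3 scale_mx3; congr mx3; try ring; field.
Qed.

(** The third generator c spans the kernel of the alternating part, and its orthogonal space is
    spanned by a and c. An isomorphism preserves both, which makes the matrix triangular with p00 =
    p11. The component of the image of b along a then produces T. *)
Lemma iso10 (al be : F) : 2%N \in [pchar F] ->
  (A4_10 al ≅ A4_10 be <-> exists T : F, T ^+ 2 + T + al + be = 0).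
Proof.
move=> /pchar2_eq0 h2; apply: iff_trans (alg_iso_congr (listed10 al) (listed10 be)) _; split.
  case/similar_of_iso; first by apply: (@mx3_neq0 _ j0 j0); rewrite mx3E oner_neq0.
  move=> P [c c0]; rewrite [P]mx3P.
  move: (P j0 j0) (P j0 j1) (P j0 j2) (P j1 j0) (P j1 j1) (P j1 j2)
    (P j2 j0) (P j2 j1) (P j2 j2) => p00 p01 p02 p10 p11 p12 p20 p21 p22.
  rewrite tr_mx3 !mul_mx3 scale_mx3.
  move=> /mx3_inj[[e00 e01 e02] [[e10 e11 e12] [e20 e21 e22]]].
  have k01 : p00 * p11 - p01 * p10 = c by lincomb (eqD e01 (eqM (-1) e10)).
  have k02 : p00 * p21 - p01 * p20 = 0 by lincomb (eqD e02 (eqM (-1) e20)).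
  have k12 : p10 * p21 - p11 * p20 = 0 by lincomb (eqD e12 (eqM (-1) e21)).
  have z0 : p20 = 0.
    by apply: (mulfI c0); lincomb (eqD (eqM (- p20) k01) (eqD (eqM p10 k02) (eqM (- p00) k12))).
  have z1 : p21 = 0.
    by apply: (mulfI c0); lincomb (eqD (eqM (- p21) k01) (eqD (eqM p11 k02) (eqM (- p01) k12))).
  move: e02 e12; rewrite z0 z1 => e02 e12.
  have p220 : p22 != 0.
    apply/negP => /eqP z; case/negP: c0; apply/eqP.
    by lincomb (eqD (eqM (-1) e12) (eqM p11 z)).
  have z01 : p01 = 0 by apply: (mulfI p220); lincomb e02.
  move: e00 e01 e10 k01; rewrite z01 => e00 e01 e10 k01.
  have cE : c = p00 ^+ 2 by lincomb (eqM (-1) e00).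
  have p0 : p00 != 0.
    by apply/negP => /eqP z; move: c0; rewrite cE z expr0n eqxx.
  have p11E : p11 = p00 by apply: (mulfI p0); lincomb (eqD k01 cE).
  exists (p10 / p00); apply: (mulfI (expf_neq0 2 p0)); rewrite mulr0.
  transitivity (p10 ^+ 2 + p10 * p00 + (al + be) * p00 ^+ 2); first by field.
  move: e11; rewrite p11E cE => e11.
  lincomb (eqD e11 (eqM (al * p00 ^+ 2 - p12 * p00) h2)).
case=> T hT; apply: iso_similar; exists (mx3 1 0 (- T) T 1 0 0 0 1).
  by rewrite unitmxE unitfE det_mx3 (_ : _ + _ = 1) ?oner_neq0 //; ring.
exists 1; first exact: oner_neq0.
rewrite tr_mx3 !mul_mx3 scale_mx3; congr mx3; try ring.
by lincomb (eqD hT (eqM (- al) h2)).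
Qed.

End FormCriteria.

(** * Family 8 and ternary quadratic forms *)

Section TernaryForms.
Variable F : fieldType.
Implicit Types M N P : 'M[F]_3.

Definition diag3 (a b c : F) := mx3 a 0 0 0 b 0 0 0 c.

Definition qf (al be x y z : F) := al * x ^+ 2 + be * y ^+ 2 + al * be * z ^+ 2.

Definition row3 (x y z : F) : 'rV[F]_3 := \row_(i < 3) nth 0 [:: x; y; z] i.

Lemma row3E x y z : ((row3 x y z 0 j0 = x) * (row3 x y z 0 j1 = y) * (row3 x y z 0 j2 = z))%type.
Proof. by rewrite !mxE. Qed.

Lemma diag_qfE a b c (v : 'rV[F]_3) : diag_qf a b c v = (v *m diag3 a b c *m v^T) 0 0.
Proof.
by rewrite /diag_qf !(mxE, sum_ord3) /=; ring.
Qed.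

Lemma diag_qf_vE al be (x y z : F) P :
  diag_qf al be (al * be) (row3 x y z *m P) =
  qf al be (x * P j0 j0 + y * P j1 j0 + z * P j2 j0)
           (x * P j0 j1 + y * P j1 j1 + z * P j2 j1)
           (x * P j0 j2 + y * P j1 j2 + z * P j2 j2).
Proof. by rewrite /diag_qf /qf /= ![(_ *m _) _ _]mxE !sum_ord3 !row3E. Qed.

Lemma diag_qf_row3 al be (x y z : F) : diag_qf al be (al * be) (row3 x y z) = qf al be x y z.
Proof. by rewrite /diag_qf /qf /= !row3E. Qed.

Lemma det_diag3 a b c : \det (diag3 a b c) = a * b * c.
Proof. by rewrite det_mx3; ring. Qed.

(** Multiplying <1, al, be> by its determinant al be gives <al, be, al be> up to squares and order.
    The point is that the new determinant is a square. *)
Lemma similar_diag8 (al be : F) : al != 0 -> be != 0 ->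
  similar_forms (diag3 al be (al * be)) (diag3 1 al be).
Proof.
move=> al0 be0; exists (mx3 0 0 be^-1 0 al^-1 0 1 0 0).
  rewrite unitmxE unitfE det_mx3 (_ : _ + _ = - (al * be)^-1); last by field; rewrite al0 be0.
  by rewrite oppr_eq0 invr_eq0 mulf_neq0.
exists (al * be)^-1; first by rewrite invr_neq0 // mulf_neq0.
by rewrite tr_mx3 !mul_mx3 scale_mx3; congr mx3; field; rewrite ?al0 ?be0.
Qed.

(** Both determinants are squares and the dimension is odd: c^3, hence c, is a square k^2, and P / k
    is an isometry. *)
Lemma qf_equiv_of_similar (al be ga de : F) :
  al != 0 -> be != 0 -> ga != 0 -> de != 0 ->
  similar_forms (diag3 ga de (ga * de)) (diag3 al be (al * be)) ->
  qf_equiv (diag_qf al be (al * be)) (diag_qf ga de (ga * de)).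
Proof.
move=> al0 be0 ga0 de0 [P uP [c c0 E]].
have := congr1 determinant E.
rewrite !det_mulmx det_tr detZ !det_diag3 => dE.
pose k := \det P * al * be / (ga * de * c).
have kE : c = k ^+ 2.
  apply: (mulfI (mulf_neq0 (expf_neq0 2 (mulf_neq0 ga0 de0)) (expf_neq0 2 c0))).
  transitivity (\det P * (al * be * (al * be)) * \det P).
    by rewrite dE; ring.
  by rewrite /k; field; rewrite ga0 de0 c0.
have k0 : k != 0 by apply: contraNN c0 => /eqP k0; rewrite kE k0 expr0n.
exists (k^-1 *: P).
  by rewrite unitmxE detZ unitrM -unitmxE uP andbT unitfE expf_neq0 ?invr_neq0.
have qE v : diag_qf ga de (ga * de) v = (v *m ((k^-1 *: P) *m diag3 al be (al * be) *m
    (k^-1 *: P)^T) *m v^T) 0 0.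
  rewrite diag_qfE linearZ /= -scalemxAr -!scalemxAl E !scalerA.
  by rewrite (_ : _ * c = 1) ?scale1r // kE; field.
by move=> v; rewrite qE diag_qfE trmx_mul !mulmxA.
Qed.

Definition bf3 (al be x y z x' y' z' : F) := al * x * x' + be * y * y' + al * be * z * z'.

Lemma similar_of_gram (al be ga de : F) P :
  ga != 0 -> de != 0 ->
  qf al be (P j0 j0) (P j0 j1) (P j0 j2) = ga ->
  qf al be (P j1 j0) (P j1 j1) (P j1 j2) = de ->
  qf al be (P j2 j0) (P j2 j1) (P j2 j2) = ga * de ->
  bf3 al be (P j0 j0) (P j0 j1) (P j0 j2) (P j1 j0) (P j1 j1) (P j1 j2) = 0 ->
  bf3 al be (P j0 j0) (P j0 j1) (P j0 j2) (P j2 j0) (P j2 j1) (P j2 j2) = 0 ->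
  bf3 al be (P j1 j0) (P j1 j1) (P j1 j2) (P j2 j0) (P j2 j1) (P j2 j2) = 0 ->
  similar_forms (diag3 ga de (ga * de)) (diag3 al be (al * be)).
Proof.
rewrite /qf /bf3 => ga0 de0 e0 e1 e2 e01 e02 e12.
apply: (@similar_gram _ _ _ P 1); first exact: oner_neq0.
  by rewrite det_diag3 !mulf_neq0.
rewrite [P]mx3P tr_mx3 !mul_mx3 scale_mx3; congr mx3; rewrite ?mul1r.
all: rewrite ?(mulr0, mul0r, addr0, add0r).
- by rewrite -e0; ring.
- by rewrite -[RHS]e01; ring.
- by rewrite -[RHS]e02; ring.
- by rewrite -[RHS]e01; ring.
- by rewrite -e1; ring.
- by rewrite -[RHS]e12; ring.
- by rewrite -[RHS]e02; ring.
- by rewrite -[RHS]e12; ring.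
- by rewrite -e2; ring.
Qed.

Section CharTwo.
Hypothesis h2 : 2%:R = 0 :> F.
Variables al be : F.
Hypotheses (al0 : al != 0) (be0 : be != 0).

Let q := qf al be.
Let B := bf3 al be.

(* The twisted cross product of the pure quaternion algebra: multiplicativity of the
   Pfister form [x^2 + q(y)] on pure vectors. *)
Lemma qfM x y z x' y' z' : q x y z * q x' y' z' = B x y z x' y' z' ^+ 2 +
  q (be * (y * z' + z * y')) (al * (x * z' + z * x')) (x * y' + y * x').
Proof.
rewrite /q /B /qf /bf3.
lincomb (eqM (- (2%:R * al * be * x * x' * y * y' + 2%:R * al ^+ 2 * be * x * x' * z * z' +
  2%:R * al * be ^+ 2 * y * y' * z * z')) h2).
Qed.

Lemma qfD x y z x' y' z' : q (x + x') (y + y') (z + z') = q x y z + q x' y' z'.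
Proof.
rewrite /q /qf; lincomb (eqM (al * x * x' + be * y * y' + al * be * z * z') h2).
Qed.

Lemma qfZ k x y z : q (k * x) (k * y) (k * z) = k ^+ 2 * q x y z.
Proof. by rewrite /q /qf; ring. Qed.

(** Suppose b = B(..) is not 0. By [qfM] and additivity b^2 is a value of q, so q(t) = 1 for some t.
    Then [qfM] shows that y + B(t, y) t + t x y, with the twisted cross product, has q-value 2 q(y)
    = 0 for all y. Anisotropy makes this vector vanish; the first two basis vectors give al t0^2 =
    be t1^2 = 1 up to sign, so q(t0, t1, 0) = 0, a contradiction. *)
Lemma anisotropic_orthogonal x y z x' y' z' u v w :
  (forall a b c, q a b c = 0 -> [/\ a = 0, b = 0 & c = 0]) ->
  q x y z * q x' y' z' = q u v w -> B x y z x' y' z' = 0.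
Proof.
move=> aniso; rewrite qfM => E; apply: contrapT => /eqP B0.
set b := B _ _ _ _ _ _ in E B0.
have [t0 [t1 [t2 tE]]] : exists t0 t1 t2, q t0 t1 t2 = 1.
  move: E; set a1 := be * _; set a2 := al * _; set a3 := x * _ + _ => E.
  exists (b^-1 * (u + a1)), (b^-1 * (v + a2)), (b^-1 * (w + a3)).
  rewrite qfZ qfD -E; apply: (mulfI (expf_neq0 2 B0)).
  transitivity (b ^+ 2 + 2%:R * q a1 a2 a3); first by field.
  by rewrite h2; ring.
have K y0 y1 y2 : q (y0 + (B t0 t1 t2 y0 y1 y2 * t0 + be * (t1 * y2 + t2 * y1)))
    (y1 + (B t0 t1 t2 y0 y1 y2 * t1 + al * (t0 * y2 + t2 * y0)))
    (y2 + (B t0 t1 t2 y0 y1 y2 * t2 + (t0 * y1 + t1 * y0))) = 0.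
  have := qfM t0 t1 t2 y0 y1 y2; rewrite tE mul1r => K.
  by rewrite 2!qfD qfZ tE mulr1 -K; lincomb (eqM (q y0 y1 y2) h2).
have [h0 _ _] := aniso _ _ _ (K 1 0 0); have [_ h1 _] := aniso _ _ _ (K 0 1 0).
have [z0 _ _] : [/\ t0 = 0, t1 = 0 & 0 = 0 :> F].
  apply: aniso; move: h0 h1; rewrite /q /qf /B /bf3 => h0 h1.
  by lincomb (eqD h0 (eqD h1 (eqM (-1) h2))).
by move/eqP: h0; rewrite z0 /B /bf3 !(mul0r, mulr0, addr0) oner_eq0.
Qed.

Definition metabolic (b : F) := mx3 1 0 0 0 b 1 0 1 0.

(** The basis is h, f, e: the isotropic vector e = (x, y, z), some f with B(f, e) = 1, and their
    twisted cross product h. It is orthogonal to both, and q(h) = 1 by [qfM] since q(e) = 0. The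
    matrix is returned as well, because the values of the quadratic form are needed without a
    scalar. *)
Lemma isotropic_metabolic x y z : q x y z = 0 -> [|| x != 0, y != 0 | z != 0] ->
  exists b, similar_forms (metabolic b) (diag3 al be (al * be)) /\
    exists2 P, P \in unitmx & P *m diag3 al be (al * be) *m P^T = metabolic b.
Proof.
move=> q0 n0.
have [f0 [f1 [f2 Bf]]] : exists f0 f1 f2, B f0 f1 f2 x y z = 1.
  rewrite /B /bf3; case/or3P: n0 => n0.
  - by exists (al * x)^-1, 0, 0; field; rewrite al0 n0.
  - by exists 0, (be * y)^-1, 0; field; rewrite be0 n0.
  - by exists 0, 0, (al * be * z)^-1; field; rewrite al0 be0 n0.
have qh := qfM f0 f1 f2 x y z.
rewrite q0 mulr0 Bf in qh.
set h0 := be * (f1 * z + f2 * y) in qh.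
set h1 := al * (f0 * z + f2 * x) in qh.
set h3 := f0 * y + f1 * x in qh.
have {}qh : q h0 h1 h3 = 1 by lincomb (eqD (eqM (-1) qh) (eqM (-1) h2)).
pose P := mx3 h0 h1 h3 f0 f1 f2 x y z.
have E : P *m diag3 al be (al * be) *m P^T = metabolic (q f0 f1 f2).
  rewrite /P /diag3 tr_mx3 !mul_mx3; congr mx3.
  - by rewrite -qh /q /qf; ring.
  - rewrite /h0 /h1 /h3; lincomb (eqM (al * be * (f0 * f1 * z + f0 * f2 * y + f1 * f2 * x)) h2).
  - rewrite /h0 /h1 /h3; lincomb (eqM (al * be * (x * z * f1 + x * y * f2 + y * z * f0)) h2).
  - rewrite /h0 /h1 /h3; lincomb (eqM (al * be * (f0 * f1 * z + f0 * f2 * y + f1 * f2 * x)) h2).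
  - by rewrite /q /qf; ring.
  - by rewrite -Bf /B /bf3; ring.
  - rewrite /h0 /h1 /h3; lincomb (eqM (al * be * (x * z * f1 + x * y * f2 + y * z * f0)) h2).
  - by rewrite -Bf /B /bf3; ring.
  - by rewrite -[RHS]q0 /q /qf; ring.
have dM b : \det (metabolic b) = - 1 by rewrite det_mx3; ring.
have dM0 b : \det (metabolic b) != 0 by rewrite dM oppr_eq0 oner_neq0.
have E' : P *m diag3 al be (al * be) *m P^T = 1 *: metabolic (q f0 f1 f2) by rewrite scale1r.
exists (q f0 f1 f2); split; first exact: similar_gram (oner_neq0 F) (dM0 _) E'.
have := dM0 (q f0 f1 f2); rewrite -E !det_mulmx mulf_eq0 negb_or => /andP[+ _].
by rewrite mulf_eq0 negb_or => /andP[dP _]; exists P => //; rewrite unitmxE unitfE.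
Qed.

End CharTwo.

(** If h, f, e is the basis of [metabolic b], the new one is h - (x / y) e, x h + y f, e / y. *)
Lemma similar_metabolic (b x y : F) : y != 0 ->
  similar_forms (metabolic (x ^+ 2 + b * y ^+ 2)) (metabolic b).
Proof.
move=> y0; exists (mx3 1 0 (- x / y) x y 0 0 0 y^-1).
  by rewrite unitmxE unitfE det_mx3 (_ : _ + _ = 1) ?oner_neq0 //; field.
exists 1; first exact: oner_neq0.
by rewrite /metabolic tr_mx3 !mul_mx3 scale_mx3; congr mx3; field.
Qed.

Lemma qf_metabolic al be b (P : 'M[F]_3) :
  P *m diag3 al be (al * be) *m P^T = metabolic b ->
  forall v : 'rV[F]_3, diag_qf al be (al * be) (v *m P) =
    v 0 j0 ^+ 2 + b * v 0 j1 ^+ 2 + 2%:R * v 0 j1 * v 0 j2.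
Proof.
move=> E v; rewrite diag_qfE trmx_mul.
have -> : v *m P *m diag3 al be (al * be) *m (P^T *m v^T) = v *m metabolic b *m v^T.
  by rewrite -E !mulmxA.
by rewrite /metabolic !(mxE, sum_ord3) /=; ring.
Qed.

(* In characteristic 2 the quadratic forms have no polar form. If they are anisotropic,
   multiplicativity shows that their isometries preserve the bilinear forms; otherwise the
   bilinear form is metabolic b, and b mod F^2 up to squares can be read off from the values
   of the quadratic form. *)
Lemma similar_of_qf_equiv (al be ga de : F) :
  al != 0 -> be != 0 -> ga != 0 -> de != 0 ->
  qf_equiv (diag_qf al be (al * be)) (diag_qf ga de (ga * de)) ->
  similar_forms (diag3 ga de (ga * de)) (diag3 al be (al * be)).
Proof.
move=> al0 be0 ga0 de0 [P uP H].
have K x y z : qf ga de x y z = qf al be (x * P j0 j0 + y * P j1 j0 + z * P j2 j0)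
    (x * P j0 j1 + y * P j1 j1 + z * P j2 j1) (x * P j0 j2 + y * P j1 j2 + z * P j2 j2).
  by rewrite -diag_qf_row3 H diag_qf_vE.
have K0 : qf al be (P j0 j0) (P j0 j1) (P j0 j2) = ga.
  by transitivity (qf ga de 1 0 0); [rewrite K; congr qf; ring|rewrite /qf; ring].
have K1 : qf al be (P j1 j0) (P j1 j1) (P j1 j2) = de.
  by transitivity (qf ga de 0 1 0); [rewrite K; congr qf; ring|rewrite /qf; ring].
have K2 : qf al be (P j2 j0) (P j2 j1) (P j2 j2) = ga * de.
  by transitivity (qf ga de 0 0 1); [rewrite K; congr qf; ring|rewrite /qf; ring].
have [h2|h2] := eqVneq (2%:R : F) 0; last first.
  apply: (similar_of_gram ga0 de0 K0 K1 K2).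
  - apply: (mulfI h2); rewrite mulr0; move: (K 1 1 0) K0 K1 K2; rewrite /qf /bf3 => k k0 k1 k2.
    by lincomb (eqD (eqM (-1) k) (eqD (eqM (-1) k0) (eqM (-1) k1))).
  - apply: (mulfI h2); rewrite mulr0; move: (K 1 0 1) K0 K1 K2; rewrite /qf /bf3 => k k0 k1 k2.
    by lincomb (eqD (eqM (-1) k) (eqD (eqM (-1) k0) (eqM (-1) k2))).
  - apply: (mulfI h2); rewrite mulr0; move: (K 0 1 1) K0 K1 K2; rewrite /qf /bf3 => k k0 k1 k2.
    by lincomb (eqD (eqM (-1) k) (eqD (eqM (-1) k1) (eqM (-1) k2))).
have [aniso|iso] := pselect (forall a b c, qf al be a b c = 0 -> [/\ a = 0, b = 0 & c = 0]).
  apply: (similar_of_gram ga0 de0 K0 K1 K2).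
  - apply: (anisotropic_orthogonal h2 (u := P j2 j0) (v := P j2 j1) (w := P j2 j2) aniso).
    by rewrite K0 K1 K2.
  - apply: (anisotropic_orthogonal h2 (u := ga * P j1 j0) (v := ga * P j1 j1)
      (w := ga * P j1 j2) aniso).
    by rewrite qfZ K0 K1 K2; ring.
  - apply: (anisotropic_orthogonal h2 (u := de * P j0 j0) (v := de * P j0 j1)
      (w := de * P j0 j2) aniso).
    by rewrite qfZ K0 K1 K2; ring.
have [x [y [z [q0 n0]]]] : exists x y z, qf al be x y z = 0 /\ [|| x != 0, y != 0 | z != 0].
  apply: contrapT => C; apply: iso => x y z q0.
  have : ~~ [|| x != 0, y != 0 | z != 0] by apply/negP => n0; apply: C; exists x, y, z.
  by rewrite !negb_or !negbK => /and3P[/eqP -> /eqP -> /eqP ->].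
have [b [sb [R uR E]]] := isotropic_metabolic h2 al0 be0 q0 n0.
have [x' [y' [z' [q0' n0']]]] :
    exists x y z, qf ga de x y z = 0 /\ [|| x != 0, y != 0 | z != 0].
  pose w := row3 x y z *m invmx P.
  exists (w 0 j0), (w 0 j1), (w 0 j2); split.
    rewrite -diag_qf_row3 (_ : row3 _ _ _ = w); last first.
      by apply/rowP; apply: ord3P; rewrite row3E.
    by rewrite H mulmxKV // diag_qf_row3.
  apply: contraLR n0; rewrite !negb_or !negbK => /and3P[/eqP w0 /eqP w1 /eqP w2].
  have w_0 : w = 0 by apply/rowP; apply: ord3P; rewrite [RHS]mxE.
  have : row3 x y z = 0 by rewrite -[row3 x y z](mulmxKV uP) -/w w_0 mul0mx.
  move/rowP => r0; have := r0 j0; have := r0 j1; have := r0 j2.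
  by rewrite !row3E !mxE => -> -> ->; rewrite !eqxx.
have [b' [sb' [R' uR' E']]] := isotropic_metabolic h2 ga0 de0 q0' n0'.
(* The middle vector of the second metabolic basis has value b'; carried over by [P] and written in
   the first metabolic basis, the same value is x^2 + b y^2, the cross term being even. *)
have V1 : exists x y, b' = x ^+ 2 + b * y ^+ 2.
  pose w := row3 0 1 0 *m R' *m P *m invmx R.
  exists (w 0 j0), (w 0 j1).
  have := qf_metabolic E w; rewrite h2 !mul0r addr0 => <-.
  by rewrite /w mulmxKV // -H (qf_metabolic E') !row3E; ring.
have V2 : exists x y, b = x ^+ 2 + b' * y ^+ 2.
  pose w := row3 0 1 0 *m R *m invmx P *m invmx R'.
  exists (w 0 j0), (w 0 j1).
  have := qf_metabolic E' w; rewrite h2 !mul0r addr0 => <-.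
  by rewrite /w mulmxKV // H mulmxKV // (qf_metabolic E) !row3E; ring.
have bb' : similar_forms (metabolic b') (metabolic b).
  case: V1 => x1 [y1 V1]; have [y10|y10] := eqVneq y1 0; last first.
    by rewrite V1; exact: similar_metabolic.
  case: V2 => x2 [y2 V2].
  (* If y1 = 0, both b' = x1^2 and b = (x2 + x1 y2)^2 are squares, so in characteristic 2 they
     differ by a square. *)
  have -> : b' = (x1 + (x2 + x1 * y2)) ^+ 2 + b * 1 ^+ 2.
    move: V1 V2; rewrite y10 => V1 V2.
    lincomb (eqD V1 (eqD (eqM (-1) V2) (eqD (eqM (- y2 ^+ 2) V1)
      (eqM (- (x1 * x2 + x1 ^+ 2 * y2 + x1 * x2 * y2 + x1 ^+ 2 * y2 ^+ 2 + x2 ^+ 2)) h2)))).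
  exact: similar_metabolic (oner_neq0 F).
exact: similar_forms_trans (similar_forms_sym sb') (similar_forms_trans bb' sb).
Qed.

Lemma iso8 (al be ga de : F) :
  al != 0 -> be != 0 -> ga != 0 -> de != 0 ->
  (A4_8 al be ≅ A4_8 ga de <->
   qf_equiv (diag_qf al be (al * be)) (diag_qf ga de (ga * de))).
Proof.
move=> al0 be0 ga0 de0.
apply: iff_trans (alg_iso_congr (listed8 al be) (listed8 ga de)) _.
have S1 := similar_diag8 al0 be0; have S2 := similar_diag8 ga0 de0; split.
  case/similar_of_iso; first by apply: (@mx3_neq0 _ _ j0 j0); rewrite mx3E oner_neq0.
  move=> P [c c0 E].
  have S : similar_forms (diag3 1 al be) (diag3 1 ga de).
    by apply: similar_gram c0 _ E; rewrite det_diag3 mul1r mulf_neq0.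
  apply: qf_equiv_of_similar => //.
  exact: similar_forms_trans S2 (similar_forms_trans (similar_forms_sym S) (similar_forms_sym S1)).
move/(similar_of_qf_equiv al0 be0 ga0 de0) => S.
apply: iso_similar.
exact: similar_forms_trans (similar_forms_sym S1)
  (similar_forms_trans (similar_forms_sym S) S2).
Qed.

End TernaryForms.

(** * Isomorphism invariants separating the families *)

Section Invariants.
Variable F : fieldType.
Implicit Types A B : algebra F.

Section Defs.
Variable A : algebra F.
Local Notation "x ** y" := (amul A x y) (at level 40, left associativity).

Definition ann (w : A) := forall y, w ** y = 0 /\ y ** w = 0.
Definition zero_mul := forall x y, x ** y = 0.
Definition line_mul := exists z, forall x y, exists k : F, x ** y = k *: z.
(** The rank, here and in [rank_le2], is the dimension of A modulo its annihilator. *)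
Definition rank_le1 := exists a, forall x, exists k : F, ann (x - k *: a).
Definition rank_le2 := exists a b, forall x, exists k l : F, ann (x - k *: a - l *: b).
Definition alternating := forall x, x ** x = 0.
Definition commutative_mul := forall x y, x ** y = y ** x.
(** For a non-symmetric form of rank 3 such an [r] spans, modulo the annihilator, the kernel of the
    alternating part. *)
Definition central_nonisotropic := exists r, (forall x, x ** r = r ** x) /\ r ** r <> 0.
(** The form is alternating on the space orthogonal to a vector in the kernel of its alternating
    part. *)
Definition central_alternating := exists r,
  [/\ forall x, x ** r = r ** x, ~ ann r & forall x, x ** r = 0 -> x ** x = 0].
Definition cube_neq0 := exists x y z, x ** y ** z <> 0.
Definition quart_neq0 := exists x y z t, x ** y ** z ** t <> 0.
Definition cube0_sq_neq0 := exists x, (forall y z, x ** y ** z = 0) /\ x ** x <> 0.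
Definition squares_line := exists z, forall x, exists k : F, x ** x = k *: z.
Definition square_zero := exists x, ~ ann x /\ x ** x = 0.
Definition square_zero_normal := exists x,
  [/\ ~ ann x, x ** x = 0 & forall y, exists k : F, x ** y = k *: (y ** x)].
Definition right_killed := exists x, ~ ann x /\ forall y, y ** x = 0.
(** In the branch of [number] where it is consulted, this detects sigma^2 = -gamma, the case
    excluded from [A4_25]. *)
Definition commutator_degenerate := exists x,
  ~ ann x /\ exists p q, forall y, exists k : F, x ** y = k *: (p ** q - q ** p).
(** Consulted only over the field with three elements, where [A4_25] has alpha = 0. The equations
    are those satisfied by the generators of [A4_22]. *)
Definition special22 := exists x y,
  [/\ x ** y <> y ** x, x ** x = y ** y & x ** y - y ** x = - (x ** x)].

(* A decision tree of isomorphism invariants that recovers the position in the list. *)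
Definition number : nat :=
  if `[< zero_mul >] then 1 else
  if `[< line_mul >] then
    if `[< rank_le1 >] then 2 else
    if `[< rank_le2 >] then
      if `[< alternating >] then 5 else if `[< commutative_mul >] then 3 else 4
    else if `[< commutative_mul >] then 8 else
    if `[< central_nonisotropic >] then (if `[< central_alternating >] then 7 else 9)
    else (if `[< central_alternating >] then 11 else 10)
  else if `[< cube_neq0 >] then
    if `[< quart_neq0 >] then 15 else if `[< rank_le2 >] then 6 else
    if `[< commutative_mul >] then 13 else if `[< cube0_sq_neq0 >] then 12 else 14
  else if `[< squares_line >] then
    if (2%N \in [pchar F]) && ~~ `[< commutative_mul >] then 19 else 18
  else if `[< square_zero >] then
    if `[< square_zero_normal >] then 21 else if `[< right_killed >] then 16 else 20
  else if 2%N \in [pchar F] then (if `[< commutative_mul >] then 17 else 26)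
  else if `[< commutative_mul >] then 23 else
  if `[< commutator_degenerate >] then 24 else
  if `[< forall x : F, [\/ x = 0, x = 1 | x = -1] >] && `[< special22 >] then 22 else 25.

End Defs.

Section Transport.
Variables (A B : algebra F) (f : {linear A -> B}) (g : B -> A).
Hypotheses (fK : cancel f g) (gK : cancel g f).
Hypothesis fM : {morph f : x y / amul A x y >-> amul B x y}.

Lemma f_eq0 x : f x = 0 -> x = 0.
Proof. by move=> h; apply: (can_inj fK); rewrite h linear0. Qed.

Lemma fZ (k : F) x : f (k *: x) = k *: f x.
Proof. exact: linearZ. Qed.

Lemma ann_f x : ann (f x) <-> ann x.
Proof.
split=> h y; last by rewrite -[y]gK -!fM; case: (h (g y)) => -> ->; rewrite linear0.
by case: (h (f y)); rewrite -!fM => /f_eq0 -> /f_eq0 ->.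
Qed.

Lemma zero_mul_f : zero_mul A -> zero_mul B.
Proof using fK gK fM. by move=> h x y; rewrite -[x]gK -[y]gK -fM h linear0. Qed.
Lemma line_mul_f : line_mul A -> line_mul B.
Proof using fK gK fM.
case=> z h; exists (f z) => x y; case: (h (g x) (g y)) => k e; exists k.
by rewrite -[x]gK -[y]gK -fM e fZ.
Qed.
Lemma rank_le1_f : rank_le1 A -> rank_le1 B.
Proof using fK gK fM.
case=> a h; exists (f a) => x; case: (h (g x)) => k /ann_f; rewrite linearB fZ gK.
by exists k.
Qed.
Lemma rank_le2_f : rank_le2 A -> rank_le2 B.
Proof using fK gK fM.
case=> a [b h]; exists (f a), (f b) => x; case: (h (g x)) => k [l /ann_f].
by rewrite !linearB !fZ gK => h'; exists k, l.
Qed.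
Lemma alternating_f : alternating A -> alternating B.
Proof using fK gK fM. by move=> h x; rewrite -[x]gK -fM h linear0. Qed.
Lemma commutative_mul_f : commutative_mul A -> commutative_mul B.
Proof using fK gK fM. by move=> h x y; rewrite -[x]gK -[y]gK -!fM h. Qed.
Lemma central_nonisotropic_f : central_nonisotropic A -> central_nonisotropic B.
Proof using fK gK fM.
case=> r [h r0]; exists (f r); split=> [x|]; first by rewrite -[x]gK -!fM h.
by rewrite -fM => /f_eq0.
Qed.
Lemma central_alternating_f : central_alternating A -> central_alternating B.
Proof using fK gK fM.
case=> r [h r0 ri]; exists (f r); split=> [x||x].
- by rewrite -[x]gK -!fM h.
- by move/ann_f.
- by rewrite -[x]gK -!fM => /f_eq0/ri ->; rewrite linear0.
Qed.
Lemma cube_neq0_f : cube_neq0 A -> cube_neq0 B.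
Proof using fK gK fM.
by case=> x [y [z h]]; exists (f x), (f y), (f z); rewrite -!fM => /f_eq0.
Qed.
Lemma quart_neq0_f : quart_neq0 A -> quart_neq0 B.
Proof using fK gK fM.
by case=> x [y [z [t h]]]; exists (f x), (f y), (f z), (f t); rewrite -!fM => /f_eq0.
Qed.
Lemma cube0_sq_neq0_f : cube0_sq_neq0 A -> cube0_sq_neq0 B.
Proof using fK gK fM.
case=> x [h x0]; exists (f x); split=> [y z|]; last by rewrite -fM => /f_eq0.
by rewrite -[y]gK -[z]gK -!fM h linear0.
Qed.
Lemma squares_line_f : squares_line A -> squares_line B.
Proof using fK gK fM.
case=> z h; exists (f z) => x; case: (h (g x)) => k e; exists k.
by rewrite -[x]gK -fM e fZ.
Qed.
Lemma square_zero_f : square_zero A -> square_zero B.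
Proof using fK gK fM.
case=> x [n h]; exists (f x); split; first by move/ann_f.
by rewrite -fM h linear0.
Qed.
Lemma square_zero_normal_f : square_zero_normal A -> square_zero_normal B.
Proof using fK gK fM.
case=> x [n h e]; exists (f x); split; first by move/ann_f.
  by rewrite -fM h linear0.
by move=> y; case: (e (g y)) => k e'; exists k; rewrite -[y]gK -!fM e' fZ.
Qed.
Lemma right_killed_f : right_killed A -> right_killed B.
Proof using fK gK fM.
case=> x [n h]; exists (f x); split; first by move/ann_f.
by move=> y; rewrite -[y]gK -fM h linear0.
Qed.
Lemma commutator_degenerate_f : commutator_degenerate A -> commutator_degenerate B.
Proof using fK gK fM.
case=> x [n [p [q h]]]; exists (f x); split; first by move/ann_f.
exists (f p), (f q) => y; case: (h (g y)) => k e; exists k.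
by rewrite -[y]gK -!fM e fZ linearB.
Qed.
Lemma special22_f : special22 A -> special22 B.
Proof using fK gK fM.
case=> x [y [n e e']]; exists (f x), (f y); split.
- by rewrite -!fM => /(can_inj fK).
- by rewrite -!fM e.
- by rewrite -!fM -linearB e' linearN.
Qed.

End Transport.

Lemma iso_invariant (P : algebra F -> Prop) :
  (forall A B (f : {linear A -> B}) g, cancel f g -> cancel g f ->
     {morph f : x y / amul A x y >-> amul B x y} -> P A -> P B) ->
  forall A B, A ≅ B -> `[< P A >] = `[< P B >].
Proof.
move=> H; have H' A B : A ≅ B -> P A -> P B.
  by case=> f [g fK gK] fM; exact: H fK gK fM.
move=> A B h; apply: asbool_equiv_eq; split; apply: H' => //.
exact: alg_iso_sym.
Qed.

Lemma number_iso A B : A ≅ B -> number A = number B.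
Proof.
move=> h; rewrite /number.
rewrite (iso_invariant zero_mul_f h) (iso_invariant line_mul_f h).
rewrite (iso_invariant rank_le1_f h) (iso_invariant rank_le2_f h).
rewrite (iso_invariant alternating_f h) (iso_invariant commutative_mul_f h).
rewrite (iso_invariant central_nonisotropic_f h) (iso_invariant central_alternating_f h).
rewrite (iso_invariant cube_neq0_f h) (iso_invariant quart_neq0_f h).
rewrite (iso_invariant cube0_sq_neq0_f h) (iso_invariant squares_line_f h).
rewrite (iso_invariant square_zero_f h) (iso_invariant square_zero_normal_f h).
rewrite (iso_invariant right_killed_f h) (iso_invariant commutator_degenerate_f h).
by rewrite (iso_invariant special22_f h).
Qed.

Lemma rank_le1_le2 A : rank_le1 A -> rank_le2 A.
Proof.
by case=> a h; exists a, 0 => x; case: (h x) => k e; exists k, 0; rewrite scale0r subr0.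
Qed.

Lemma annD A (x y : A) : ann x -> ann y -> ann (x + y).
Proof.
move=> hx hy z; case: (hx z) (hy z) => [e1 e2] [e3 e4].
by rewrite linearDl linearDr /= e1 e2 e3 e4 addr0.
Qed.

Lemma annZ A k (x : A) : ann x -> ann (k *: x).
Proof.
by move=> hx z; case: (hx z) => e1 e2; rewrite linearZl_LR linearZr_LR /= e1 e2 scaler0.
Qed.

Lemma rank_le1_dep A (p q : A) : rank_le1 A ->
  exists k l : F, (k != 0) || (l != 0) /\ ann (k *: p + l *: q).
Proof.
case=> a h; case: (h p) (h q) => [k hk] [l hl].
have [l0|l0] := eqVneq l 0.
  exists 0, 1; rewrite oner_neq0 orbT scale0r scale1r add0r; split=> //.
  by move: hl; rewrite l0 scale0r subr0.
exists l, (- k); rewrite l0; split=> //.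
have -> : l *: p + - k *: q = l *: (p - k *: a) + (- k) *: (q - l *: a).
  rewrite !scalerBr !scalerA addrACA -opprD -scalerDl.
  by rewrite mulNr [k * l]mulrC subrr scale0r subr0.
by apply: annD; apply: annZ.
Qed.

Lemma rank_le2_dep A (p q r : A) : rank_le2 A ->
  exists k l m : F, [|| k != 0, l != 0 | m != 0] /\ ann (k *: p + l *: q + m *: r).
Proof.
case=> a [b h]; case: (h p) (h q) (h r) => [k1 [l1 h1]] [k2 [l2 h2]] [k3 [l3 h3]].
have H k l m : k * k1 + l * k2 + m * k3 = 0 -> k * l1 + l * l2 + m * l3 = 0 ->
    ann (k *: p + l *: q + m *: r).
  have G (p1 w1 p2 w2 p3 w3 : A) : k *: (p1 + w1) + l *: (p2 + w2) + m *: (p3 + w3) =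
      (k *: p1 + l *: p2 + m *: p3) + (k *: w1 + l *: w2 + m *: w3).
    by rewrite !scalerDr [X in X + _]addrACA [LHS]addrACA.
  have W : k *: (k1 *: a + l1 *: b) + l *: (k2 *: a + l2 *: b) + m *: (k3 *: a + l3 *: b) =
      (k * k1 + l * k2 + m * k3) *: a + (k * l1 + l * l2 + m * l3) *: b.
    by rewrite G !scalerA -!scalerDl.
  move=> e1 e2; rewrite -(subrK (k1 *: a + l1 *: b) p) -(subrK (k2 *: a + l2 *: b) q).
  rewrite -(subrK (k3 *: a + l3 *: b) r) G W e1 e2 !scale0r !addr0 !opprD !addrA.
  by do !apply: annD; apply: annZ.
(* The coefficients are the 2 x 2 minors of the coordinates; if the last minor vanishes, p and q
   alone are dependent modulo the annihilator. *)
have [D|D] := eqVneq (k1 * l2 - k2 * l1) 0; last first.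
  exists (k2 * l3 - k3 * l2), (k3 * l1 - k1 * l3), (k1 * l2 - k2 * l1).
  by split; [rewrite D !orbT|apply: H; ring].
have [k [l [kl e1 e2]]] : exists k l : F,
    [/\ (k != 0) || (l != 0), k * k1 + l * k2 = 0 & k * l1 + l * l2 = 0].
  have [z1|z1] := eqVneq k2 0; last first.
    exists k2, (- k1); rewrite z1; split=> //; first by ring.
    by lincomb (eqM (-1) D).
  have [z2|z2] := eqVneq l2 0; last first.
    exists l2, (- l1); rewrite z2; split=> //; last by ring.
    by lincomb D.
  by exists 0, 1; rewrite oner_eq0 orbT z1 z2; split=> //; ring.
exists k, l, 0; rewrite eqxx orbF; split=> //.
by apply: H; rewrite mul0r addr0.
Qed.

End Invariants.

(** * The decision tree on the algebras of bilinear forms *)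

Section Evaluation.
Variable F : fieldType.

Lemma vec3_eq0 (x : F) : vec 0 0 0 x = 0 -> x = 0.
Proof. by rewrite vec0 => /vec_inj[]. Qed.

Section BilinearForm.
Variables a b c d e f g h i : F.
Let A := bf (mx3 a b c d e f g h i).

Lemma bf3E x0 x1 x2 x3 y0 y1 y2 y3 :
  amul A (vec x0 x1 x2 x3) (vec y0 y1 y2 y3) = vec 0 0 0
  (a * x0 * y0 + b * x0 * y1 + c * x0 * y2 + d * x1 * y0 + e * x1 * y1 + f * x1 * y2 +
   g * x2 * y0 + h * x2 * y1 + i * x2 * y2).
Proof. by rewrite bfE !mx3E !vec_coord. Qed.

Lemma bf3_ann x0 x1 x2 x3 : ann (vec x0 x1 x2 x3 : A) <->
  [/\ a * x0 + d * x1 + g * x2 = 0, b * x0 + e * x1 + h * x2 = 0 &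
      c * x0 + f * x1 + i * x2 = 0] /\
  [/\ a * x0 + b * x1 + c * x2 = 0, d * x0 + e * x1 + f * x2 = 0 &
      g * x0 + h * x1 + i * x2 = 0].
Proof.
split=> [H|[[l0 l1 l2] [r0 r1 r2]] y]; last first.
  rewrite [y]vecE !bf3E vec0; split; apply: vecP => //.
    lincomb (eqD (eqM (y 0 i0) l0) (eqD (eqM (y 0 i1) l1) (eqM (y 0 i2) l2))).
  lincomb (eqD (eqM (y 0 i0) r0) (eqD (eqM (y 0 i1) r1) (eqM (y 0 i2) r2))).
have := H (vec 1 0 0 0); have := H (vec 0 1 0 0); have := H (vec 0 0 1 0).
rewrite !bf3E => -[/vec3_eq0 p0 /vec3_eq0 p1] [/vec3_eq0 p2 /vec3_eq0 p3]
  [/vec3_eq0 p4 /vec3_eq0 p5].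
by split; split; [lincomb p4|lincomb p2|lincomb p0|lincomb p5|lincomb p3|lincomb p1].
Qed.

Lemma bf3_nonzero : mx3 a b c d e f g h i != 0 -> ~ zero_mul A.
Proof.
move=> M0 H; case/eqP: M0.
have z j k : mx3 a b c d e f g h i j k = 0.
  have := H (vec (j == j0)%:R (j == j1)%:R (j == j2)%:R 0)
            (vec (k == j0)%:R (k == j1)%:R (k == j2)%:R 0).
  rewrite bf3E => /vec3_eq0 E; rewrite -[RHS]E.
  by move: j k {E}; apply: ord3P; apply: ord3P; rewrite mx3E /=; ring.
by apply/matrixP => j k; rewrite z mxE.
Qed.

Lemma bf3_line : line_mul A.
Proof.
exists (vec 0 0 0 1) => x y; rewrite [x]vecE [y]vecE bf3E; eexists.
by rewrite scale_vec; apply: vecP; rewrite ?mulr0 // mulr1.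
Qed.

Lemma bf3_commutative : commutative_mul A <-> [/\ b = d, c = g & f = h].
Proof.
split=> [H|[bd cg fh] x y]; last first.
  by rewrite [x]vecE [y]vecE !bf3E; apply: vecP => //; rewrite bd cg fh; ring.
have := H (vec 1 0 0 0) (vec 0 1 0 0); have := H (vec 1 0 0 0) (vec 0 0 1 0).
have := H (vec 0 1 0 0) (vec 0 0 1 0); rewrite !bf3E.
by move=> /vec_inj[_ _ _ p] /vec_inj[_ _ _ q] /vec_inj[_ _ _ r];
  split; [lincomb r|lincomb q|lincomb p].
Qed.

Lemma bf3_alternating : alternating A -> [/\ a = 0, e = 0 & i = 0].
Proof.
move=> H; have := H (vec 1 0 0 0); have := H (vec 0 1 0 0); have := H (vec 0 0 1 0).
rewrite !bf3E => /vec3_eq0 p /vec3_eq0 q /vec3_eq0 r.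
by split; [lincomb r|lincomb q|lincomb p].
Qed.

Lemma bf3_rank_le1 : rank_le1 A ->
  exists k l, (k != 0) || (l != 0) /\ ann (vec k l 0 0 : A).
Proof.
move/(@rank_le1_dep _ A (vec 1 0 0 0) (vec 0 1 0 0)) => [k [l [kl H]]].
exists k, l; split=> //; move: H; rewrite !scale_vec add_vec.
by rewrite !(mulr0, mulr1, addr0, add0r).
Qed.

Lemma bf3_rank_le2 : rank_le2 A ->
  exists k l m, [|| k != 0, l != 0 | m != 0] /\ ann (vec k l m 0 : A).
Proof.
move/(@rank_le2_dep _ A (vec 1 0 0 0) (vec 0 1 0 0) (vec 0 0 1 0)) => [k [l [m [kl H]]]].
exists k, l, m; split=> //; move: H; rewrite !scale_vec !add_vec.
by rewrite !(mulr0, mulr1, addr0, add0r).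
Qed.

End BilinearForm.

Lemma rank_le2_bf (a b d e : F) : rank_le2 (bf (mx3 a b 0 d e 0 0 0 0)).
Proof.
exists (vec 1 0 0 0), (vec 0 1 0 0) => x; exists (x 0 i0), (x 0 i1).
rewrite [x]vecE !scale_vec !opp_vec !add_vec; apply/bf3_ann; rewrite !vec_coord.
by split; split; ring.
Qed.

Lemma all_eq0 (k l m : F) : k = 0 -> l = 0 -> m = 0 -> ~ [|| k != 0, l != 0 | m != 0].
Proof. by move=> -> -> ->; rewrite eqxx. Qed.

Lemma nonzero00 (a b c d e f g h i : F) : a != 0 -> mx3 a b c d e f g h i != 0.
Proof. by move=> a0; apply: (@mx3_neq0 _ _ j0 j0); rewrite mx3E. Qed.

Lemma number1 : number (bf (0 : 'M[F]_3)) = 1%N.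
Proof.
rewrite /number asboolT // => x y; rewrite bfE vec0.
by apply: vecP => //; rewrite !mxE; ring.
Qed.

Let o0 : (1 : F) != 0 := oner_neq0 F.

Lemma number2 : number (bf (mx3 (1 : F) 0 0 0 0 0 0 0 0)) = 2%N.
Proof.
rewrite /number (asboolF (bf3_nonzero (nonzero00 _ _ _ _ _ _ _ _ o0))).
rewrite (asboolT (bf3_line _ _ _ _ _ _ _ _ _)) asboolT //.
exists (vec 1 0 0 0) => x; exists (x 0 i0); rewrite [x]vecE !scale_vec opp_vec add_vec.
by apply/bf3_ann; rewrite !vec_coord; split; split; ring.
Qed.

Lemma number3 (de : F) : de != 0 -> number (bf (mx3 1 0 0 0 de 0 0 0 0)) = 3%N.
Proof.
move=> d0; rewrite /number (asboolF (bf3_nonzero (nonzero00 _ _ _ _ _ _ _ _ o0))).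
rewrite (asboolT (bf3_line _ _ _ _ _ _ _ _ _)) asboolF; last first.
  case/bf3_rank_le1 => k [l [kl /bf3_ann[[p0 p1 _] _]]].
  apply: (@all_eq0 k l 0) => //; first by lincomb p0.
    by apply: (mulfI d0); lincomb p1.
  by case/orP: kl => ->; rewrite ?orbT.
rewrite (asboolT (rank_le2_bf _ _ _ _)) asboolF; last first.
  by case/bf3_alternating => /eqP; rewrite oner_eq0.
by rewrite asboolT //; apply/bf3_commutative.
Qed.

Lemma number4 (de : F) : number (bf (mx3 1 1 0 0 de 0 0 0 0)) = 4%N.
Proof.
rewrite /number (asboolF (bf3_nonzero (nonzero00 _ _ _ _ _ _ _ _ o0))).
rewrite (asboolT (bf3_line _ _ _ _ _ _ _ _ _)) asboolF; last first.
  case/bf3_rank_le1 => k [l [kl /bf3_ann[[p0 p1 _] [q0 _ _]]]].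
  have k0 : k = 0 by lincomb p0.
  apply: (@all_eq0 k l 0) => //; first by lincomb (eqD q0 (eqM (-1) k0)).
  by case/orP: kl => ->; rewrite ?orbT.
rewrite (asboolT (rank_le2_bf _ _ _ _)) asboolF; last first.
  by case/bf3_alternating => /eqP; rewrite oner_eq0.
by rewrite asboolF //; case/bf3_commutative => /eqP; rewrite oner_eq0.
Qed.

Lemma number5 : number (bf (mx3 (0 : F) 1 0 (-1) 0 0 0 0 0)) = 5%N.
Proof.
rewrite /number asboolF; last first.
  by apply: bf3_nonzero; apply: (@mx3_neq0 _ _ j0 j1); rewrite mx3E.
rewrite (asboolT (bf3_line _ _ _ _ _ _ _ _ _)) asboolF; last first.
  case/bf3_rank_le1 => k [l [kl /bf3_ann[[p0 p1 _] _]]].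
  apply: (@all_eq0 k l 0) => //; first by lincomb p1.
    by lincomb (eqM (-1) p0).
  by case/orP: kl => ->; rewrite ?orbT.
rewrite (asboolT (rank_le2_bf _ _ _ _)) asboolT // => x.
by rewrite [x]vecE bf3E vec0; apply: vecP => //; ring.
Qed.

Lemma number8 (al be : F) : al != 0 -> be != 0 -> number (bf (mx3 1 0 0 0 al 0 0 0 be)) = 8%N.
Proof.
move=> al0 be0; rewrite /number (asboolF (bf3_nonzero (nonzero00 _ _ _ _ _ _ _ _ o0))).
rewrite (asboolT (bf3_line _ _ _ _ _ _ _ _ _)).
have r2 : ~ rank_le2 (bf (mx3 1 0 0 0 al 0 0 0 be)).
  case/bf3_rank_le2 => k [l [m [n0 /bf3_ann[[p0 p1 p2] _]]]]; apply: all_eq0 n0.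
  - by lincomb p0.
  - by apply: (mulfI al0); lincomb p1.
  - by apply: (mulfI be0); lincomb p2.
rewrite asboolF; last by move/rank_le1_le2.
by rewrite (asboolF r2) asboolT //; apply/bf3_commutative.
Qed.

Lemma number7 : 2%N \notin [pchar F] -> number (bf (mx3 (1 : F) 0 0 0 0 1 0 (-1) 0)) = 7%N.
Proof.
move=> /pchar2_neq0 h2; rewrite /number (asboolF (bf3_nonzero (nonzero00 _ _ _ _ _ _ _ _ o0))).
rewrite (asboolT (bf3_line _ _ _ _ _ _ _ _ _)).
have r2 : ~ rank_le2 (bf (mx3 (1 : F) 0 0 0 0 1 0 (-1) 0)).
  case/bf3_rank_le2 => k [l [m [n0 /bf3_ann[[p0 p1 p2] _]]]]; apply: all_eq0 n0.
  - by lincomb p0.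
  - by lincomb p2.
  - by lincomb (eqM (-1) p1).
rewrite asboolF; last by move/rank_le1_le2.
rewrite (asboolF r2) asboolF; last first.
  by case/bf3_commutative => _ _ H; case/eqP: h2; lincomb H.
have cen x : amul (bf (mx3 (1 : F) 0 0 0 0 1 0 (-1) 0)) x (vec 1 0 0 0) =
    amul (bf (mx3 (1 : F) 0 0 0 0 1 0 (-1) 0)) (vec 1 0 0 0) x.
  by rewrite [x]vecE !bf3E; apply: vecP => //; ring.
rewrite asboolT; last first.
  exists (vec 1 0 0 0); split=> //; rewrite bf3E => /vec3_eq0 H.
  by case/eqP: o0; lincomb H.
rewrite asboolT //; exists (vec 1 0 0 0); split=> // [|x].
  by case/bf3_ann => -[H _ _] _; case/eqP: o0; lincomb H.
rewrite [x]vecE !bf3E => /vec3_eq0 H; rewrite vec0; apply: vecP => //.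
by lincomb (eqM (x 0 i0) H).
Qed.

Lemma number9 (al be : F) : al != 0 -> number (bf (mx3 al 0 0 0 1 1 0 0 be)) = 9%N.
Proof.
move=> al0; rewrite /number (asboolF (bf3_nonzero (nonzero00 _ _ _ _ _ _ _ _ al0))).
rewrite (asboolT (bf3_line _ _ _ _ _ _ _ _ _)).
have r2 : ~ rank_le2 (bf (mx3 al 0 0 0 1 1 0 0 be)).
  case/bf3_rank_le2 => k [l [m [n0 /bf3_ann[[p0 p1 p2] [q0 q1 q2]]]]].
  have l0 : l = 0 by lincomb p1.
  apply: all_eq0 n0 => //.
  - by apply: (mulfI al0); lincomb p0.
  - by lincomb (eqD q1 (eqM (-1) l0)).
rewrite asboolF; last by move/rank_le1_le2.
rewrite (asboolF r2) asboolF; last first.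
  by case/bf3_commutative => _ _ H; case/eqP: o0; lincomb H.
rewrite asboolT; last first.
  exists (vec 1 0 0 0); split=> [x|]; first by rewrite [x]vecE !bf3E; apply: vecP => //; ring.
  by rewrite bf3E => /vec3_eq0 H; case/eqP: al0; lincomb H.
rewrite asboolF //; case=> r [cen _ H]; move: cen H; rewrite [r]vecE.
move: (r 0 i0) (r 0 i1) (r 0 i2) (r 0 i3) => x y z t cen H.
have := cen (vec 0 1 0 0); have := cen (vec 0 0 1 0); rewrite !bf3E.
move=> /vec_inj[_ _ _ p] /vec_inj[_ _ _ q].
(* A central vector is a multiple of a modulo the annihilator, hence orthogonal to b, although b^2
   is not 0. *)
have : amul (bf (mx3 al 0 0 0 1 1 0 0 be)) (vec 0 1 0 0) (vec x y z t) = 0.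
  by rewrite bf3E vec0; apply: vecP => //; lincomb (eqD (eqM (-1) p) q).
by move/H; rewrite bf3E => /vec3_eq0 E; case/eqP: o0; lincomb E.
Qed.

Lemma number10 (al : F) : number (bf (mx3 1 1 0 0 al 1 0 1 0)) = 10%N.
Proof.
rewrite /number (asboolF (bf3_nonzero (nonzero00 _ _ _ _ _ _ _ _ o0))).
rewrite (asboolT (bf3_line _ _ _ _ _ _ _ _ _)).
have r2 : ~ rank_le2 (bf (mx3 1 1 0 0 al 1 0 1 0)).
  case/bf3_rank_le2 => k [l [m [n0 /bf3_ann[[p0 p1 p2] [q0 q1 q2]]]]].
  have k0 : k = 0 by lincomb p0.
  have l0 : l = 0 by lincomb p2.
  apply: all_eq0 n0 => //.
  by lincomb (eqD p1 (eqD (eqM (-1) k0) (eqM (- al) l0))).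
rewrite asboolF; last by move/rank_le1_le2.
rewrite (asboolF r2) asboolF; last first.
  by case/bf3_commutative => H; case/eqP: o0; lincomb H.
have cen r : (forall x, amul (bf (mx3 1 1 0 0 al 1 0 1 0)) x r =
     amul (bf (mx3 1 1 0 0 al 1 0 1 0)) r x) -> exists z t, r = vec 0 0 z t.
  rewrite [r]vecE; move: (r 0 i0) (r 0 i1) (r 0 i2) (r 0 i3) => x y z t cen.
  have := cen (vec 1 0 0 0); have := cen (vec 0 1 0 0); rewrite !bf3E.
  move=> /vec_inj[_ _ _ p] /vec_inj[_ _ _ q]; exists z, t.
  by apply: vecP => //; [lincomb (eqM (-1) p)|lincomb q].
rewrite asboolF; last first.
  case=> r [/cen[z [t ->]]]; apply; rewrite bf3E vec0.
  by apply: vecP => //; ring.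
rewrite asboolF //; case=> r [/cen[z [t ->]] _] H.
have : amul (bf (mx3 1 1 0 0 al 1 0 1 0)) (vec 1 0 0 0) (vec 0 0 z t) = 0.
  by rewrite bf3E vec0; apply: vecP => //; ring.
by move/H; rewrite bf3E => /vec3_eq0 E; case/eqP: o0; lincomb E.
Qed.

Lemma number11 : number (bf (mx3 (1 : F) 1 0 0 0 0 0 1 (-1))) = 11%N.
Proof.
rewrite /number (asboolF (bf3_nonzero (nonzero00 _ _ _ _ _ _ _ _ o0))).
rewrite (asboolT (bf3_line _ _ _ _ _ _ _ _ _)).
have r2 : ~ rank_le2 (bf (mx3 (1 : F) 1 0 0 0 0 0 1 (-1))).
  case/bf3_rank_le2 => k [l [m [n0 /bf3_ann[[p0 p1 p2] [q0 q1 q2]]]]].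
  have k0 : k = 0 by lincomb p0.
  apply: all_eq0 n0 => //.
    by lincomb (eqD q0 (eqM (-1) k0)).
  by lincomb (eqM (-1) p2).
rewrite asboolF; last by move/rank_le1_le2.
rewrite (asboolF r2) asboolF; last first.
  by case/bf3_commutative => H; case/eqP: o0; lincomb H.
have cen r : (forall x, amul (bf (mx3 (1 : F) 1 0 0 0 0 0 1 (-1))) x r =
     amul (bf (mx3 (1 : F) 1 0 0 0 0 0 1 (-1))) r x) -> exists z t, r = vec z 0 (- z) t.
  rewrite [r]vecE; move: (r 0 i0) (r 0 i1) (r 0 i2) (r 0 i3) => x y z t cen.
  have := cen (vec 1 0 0 0); have := cen (vec 0 1 0 0); rewrite !bf3E.
  move=> /vec_inj[_ _ _ p] /vec_inj[_ _ _ q]; exists x, t.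
  by apply: vecP => //; [lincomb q|lincomb (eqM (-1) p)].
rewrite asboolF; last first.
  case=> r [/cen[z [t ->]]]; apply; rewrite bf3E vec0.
  by apply: vecP => //; ring.
rewrite asboolT //; exists (vec 1 0 (-1) 0); split=> [x||x].
- by rewrite [x]vecE !bf3E; apply: vecP => //; ring.
- by case/bf3_ann => -[H _ _] _; case/eqP: o0; lincomb H.
- rewrite [x]vecE !bf3E => /vec3_eq0 H; rewrite vec0; apply: vecP => //.
  (* The quadratic form is (x0 + x2)(x0 + x1 - x2), divisible by the linear form x0 + x2 given by
     multiplication with a - c. *)
  by lincomb (eqM (x 0 i0 + x 0 i1 - x 0 i2) H).
Qed.

End Evaluation.

Lemma vec0_inj (F : fieldType) (a b c d : F) :
  vec a b c d = 0 -> [/\ a = 0, b = 0, c = 0 & d = 0].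
Proof. by rewrite vec0 => /vec_inj. Qed.

Lemma vecP0 (F : fieldType) (a b c d : F) :
  a = 0 -> b = 0 -> c = 0 -> d = 0 -> vec a b c d = 0.
Proof. by move=> -> -> -> ->; rewrite -vec0. Qed.

(** * Invariants of the algebras on a, a^2, c, a^3 *)

Section ChainEvaluation.
Variables (F : fieldType) (s t : F).
Let A := chain_alg s t.

Lemma chain_vecE x0 x1 x2 x3 y0 y1 y2 y3 :
  amul A (vec x0 x1 x2 x3) (vec y0 y1 y2 y3) =
  vec 0 (x0 * y0) 0 (x0 * y1 + x1 * y0 + s * (x0 * y2) + t * (x2 * y2)).
Proof. by rewrite chainE !vec_coord. Qed.

Lemma chain_not_line : ~ line_mul A.
Proof.
case=> z H; case: (H (vec 1 0 0 0) (vec 1 0 0 0)) => k.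
case: (H (vec 1 0 0 0) (vec 0 1 0 0)) => l; rewrite (vecE (z : 'rV_4)) !chain_vecE !scale_vec.
move: (z 0 i1) (z 0 i3) => z1 z3 /vec_inj[_ _ _ e3] /vec_inj[_ e4 _ e5].
suff : (1 : F) = 0 by move/eqP; rewrite oner_eq0.
by lincomb (eqD (eqM (l * z3) e4) (eqD e3 (eqM (- l * z1) e5))).
Qed.

Lemma chain_not_zero : ~ zero_mul A.
Proof. by move=> H; apply: chain_not_line; exists 0 => x y; exists 0; rewrite H scaler0. Qed.

Lemma chain_cube : cube_neq0 A.
Proof.
exists (vec 1 0 0 0), (vec 1 0 0 0), (vec 1 0 0 0); rewrite !chain_vecE => H.
suff : (1 : F) = 0 by move/eqP; rewrite oner_eq0.
by move: H; rewrite vec0 => /vec_inj[_ _ _ H]; lincomb H.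
Qed.

Lemma chain_quart : ~ quart_neq0 A.
Proof.
case=> x [y [z [w]]]; apply.
rewrite (vecE (x : 'rV_4)) (vecE (y : 'rV_4)) (vecE (z : 'rV_4)) (vecE (w : 'rV_4)).
by rewrite !chain_vecE; apply: vecP0; ring.
Qed.

Lemma chain_commutative : commutative_mul A <-> s = 0.
Proof.
split=> [H|s0 x y].
  have := H (vec 1 0 0 0) (vec 0 0 1 0); rewrite !chain_vecE => /vec_inj[_ _ _ E].
  by lincomb E.
rewrite (vecE (x : 'rV_4)) (vecE (y : 'rV_4)) !chain_vecE s0.
by apply: vecP; ring.
Qed.

Lemma chain_rank_le2 : rank_le2 A <-> s = 0 /\ t = 0.
Proof.
split=> [|[s0 t0]]; last first.
  exists (vec 1 0 0 0), (vec 0 1 0 0) => x; exists (x 0 i0), (x 0 i1) => y.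
  rewrite (vecE (x : 'rV_4)) (vecE (y : 'rV_4)) !vec_coord !scale_vec !opp_vec !add_vec.
  by rewrite !chain_vecE s0 t0; split; apply: vecP0; ring.
move/(@rank_le2_dep _ A (vec 1 0 0 0) (vec 0 1 0 0) (vec 0 0 1 0)) => [k [l [m [n0]]]].
rewrite !scale_vec !add_vec !(mulr0, mulr1, addr0, add0r) => H.
have := H (vec 1 0 0 0); have := H (vec 0 0 1 0).
rewrite !chain_vecE => -[_ /vec0_inj[_ _ _ e1]] [/vec0_inj[_ e2 _ e3] /vec0_inj[_ _ _ e4]].
have k0 : k = 0 by lincomb e2.
have l0 : l = 0 by lincomb e3.
have m0 : m != 0 by move: n0; rewrite k0 l0 eqxx.
split; apply: (mulIf m0).
  by lincomb (eqD e4 (eqM (-1) l0)).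
by lincomb e1.
Qed.

End ChainEvaluation.

(** * The decision tree on the algebras 6 and 12 to 16 *)

Section Numbers.
Variable F : fieldType.
Let o0 : (1 : F) != 0 := oner_neq0 F.
Let o0' : (1 : F) <> 0. Proof. exact/eqP. Qed.

Lemma number6 : number (chain_alg (0 : F) 0) = 6%N.
Proof.
rewrite /number (asboolF (@chain_not_zero _ _ _)) (asboolF (@chain_not_line _ _ _)).
rewrite (asboolT (chain_cube _ _)) (asboolF (@chain_quart _ _ _)) asboolT //.
exact/chain_rank_le2.
Qed.

Lemma number13 : number (chain_alg (0 : F) 1) = 13%N.
Proof.
rewrite /number (asboolF (@chain_not_zero _ _ _)) (asboolF (@chain_not_line _ _ _)).
rewrite (asboolT (chain_cube _ _)) (asboolF (@chain_quart _ _ _)) asboolF; last first.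
  by case/chain_rank_le2.
by rewrite asboolT //; apply/chain_commutative.
Qed.

Lemma number12 : number (chain_alg (1 : F) 1) = 12%N.
Proof.
rewrite /number (asboolF (@chain_not_zero _ _ _)) (asboolF (@chain_not_line _ _ _)).
rewrite (asboolT (chain_cube _ _)) (asboolF (@chain_quart _ _ _)) asboolF; last first.
  by case/chain_rank_le2.
rewrite asboolF; last by move/chain_commutative.
rewrite asboolT //; exists (vec 0 0 1 0); split=> [y z|].
  rewrite (vecE (y : 'rV_4)) (vecE (z : 'rV_4)) !chain_vecE.
  by apply: vecP0; ring.
rewrite chain_vecE => /vec0_inj[_ _ _ E]; apply: o0'; lincomb E.
Qed.

Lemma number14 : number (chain_alg (1 : F) 0) = 14%N.
Proof.
rewrite /number (asboolF (@chain_not_zero _ _ _)) (asboolF (@chain_not_line _ _ _)).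
rewrite (asboolT (chain_cube _ _)) (asboolF (@chain_quart _ _ _)) asboolF; last first.
  by case/chain_rank_le2.
rewrite asboolF; last by move/chain_commutative.
rewrite asboolF //; case=> x [H]; apply; have := H (vec 1 0 0 0) (vec 1 0 0 0).
rewrite (vecE (x : 'rV_4)) !chain_vecE => /vec0_inj[_ _ _ E].
have x0 : x 0 i0 = 0 by lincomb E.
by apply: vecP0 => //; rewrite x0; ring.
Qed.

Lemma mul15E (x0 x1 x2 x3 y0 y1 y2 y3 : F) :
  amul (A4_15 : listed F) (vec x0 x1 x2 x3) (vec y0 y1 y2 y3) =
  vec 0 (x0 * y0) (x0 * y1 + x1 * y0) (x1 * y1 + x0 * y2 + x2 * y0).
Proof.
apply/rowP; apply: ord4P; rewrite /= !(table_mulE, big_cons, big_nil) /= !vec_coord;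
  by rewrite !mxE /=; ring.
Qed.

Lemma number15 : number (A4_15 : listed F) = 15%N.
Proof.
have nl : ~ line_mul (A4_15 : listed F).
  case=> z H; case: (H (vec 1 0 0 0) (vec 1 0 0 0)) => k.
  case: (H (vec 1 0 0 0) (vec 0 1 0 0)) => l; rewrite (vecE (z : 'rV_4)) !mul15E !scale_vec.
  move: (z 0 i1) (z 0 i2) => z1 z2 /vec_inj[_ e1 e2 _] /vec_inj[_ e3 e4 _].
  by apply: o0'; lincomb (eqD (eqM (l * z2) e3) (eqD e2 (eqM (- l * z1) e4))).
rewrite /number asboolF; last first.
  by move=> H; apply: nl; exists 0 => x y; exists 0; rewrite H scaler0.
rewrite (asboolF nl) asboolT; last first.
  exists (vec 1 0 0 0), (vec 1 0 0 0), (vec 1 0 0 0); rewrite !mul15E.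
  by move=> /vec0_inj[_ _ E _]; apply: o0'; lincomb E.
rewrite asboolT //; exists (vec 1 0 0 0), (vec 1 0 0 0), (vec 1 0 0 0), (vec 1 0 0 0).
by rewrite !mul15E => /vec0_inj[_ _ _ E]; apply: o0'; lincomb E.
Qed.

Lemma mul16E (x0 x1 x2 x3 y0 y1 y2 y3 : F) :
  amul (A4_16 : listed F) (vec x0 x1 x2 x3) (vec y0 y1 y2 y3) =
  vec 0 0 (x0 * y0) (x1 * y0).
Proof.
apply/rowP; apply: ord4P; rewrite /= !(table_mulE, big_cons, big_nil) /= !vec_coord;
  by rewrite !mxE /=; ring.
Qed.

Lemma number16 : number (A4_16 : listed F) = 16%N.
Proof.
have nsq : ~ squares_line (A4_16 : listed F).
  case=> z H; case: (H (vec 1 0 0 0)) => k; case: (H (vec 1 1 0 0)) => l.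
  rewrite (vecE (z : 'rV_4)) !mul16E !scale_vec.
  move: (z 0 i2) (z 0 i3) => z2 z3 /vec_inj[_ _ e1 e2] /vec_inj[_ _ e3 e4].
  by apply: o0'; lincomb (eqD (eqM (l * z3) e3) (eqD e2 (eqM (- l * z2) e4))).
have nl : ~ line_mul (A4_16 : listed F).
  by case=> z H; apply: nsq; exists z => x; exact: H.
have na : ~ ann (vec 0 1 0 0 : (A4_16 : listed F)).
  move/(_ (vec 1 0 0 0)) => [+ _]; rewrite mul16E => /vec0_inj[_ _ _ E].
  by apply: o0'; lincomb E.
rewrite /number asboolF; last first.
  by move=> H; apply: nl; exists 0 => x y; exists 0; rewrite H scaler0.
rewrite (asboolF nl) asboolF; last first.
  case=> x [y [z]]; apply; rewrite (vecE (x : 'rV_4)) (vecE (y : 'rV_4)) (vecE (z : 'rV_4)).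
  by rewrite !mul16E; apply: vecP0; ring.
rewrite (asboolF nsq) asboolT; last first.
  by exists (vec 0 1 0 0); split=> //; rewrite mul16E; apply: vecP0; ring.
rewrite asboolF; last first.
  case=> x [nx x0 H]; apply: nx => y; case: (H (vec 1 0 0 0)) => k.
  move: x0; rewrite (vecE (x : 'rV_4)) (vecE (y : 'rV_4)) !mul16E scale_vec.
  move=> /vec0_inj[_ _ /eqP e0 _] /vec_inj[_ _ _ e1].
  move: e0; rewrite mulf_eq0 orbb => /eqP e0.
  have {}e1 : x 0 i1 = 0 by lincomb e1.
  by rewrite e0 e1; split; apply: vecP0; ring.
rewrite asboolT //; exists (vec 0 1 0 0); split=> // y.
by rewrite (vecE (y : 'rV_4)) !mul16E; apply: vecP0; ring.
Qed.

End Numbers.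

(** * The decision tree on the two-generator algebras *)

Section PairEvaluation.
Variables (F : fieldType) (al be ga ep : F).
Let A := pair_alg al be ga ep.
Let o0 : (1 : F) <> 0. Proof. exact/eqP/oner_neq0. Qed.

Lemma pair_ann (u v w z : F) : ann (vec u v w z : A) <-> u = 0 /\ v = 0.
Proof.
split=> [H|[u0 v0] y]; last first.
  rewrite (vecE (y : 'rV_4)) !pair_vecE /pc /pd u0 v0.
  by split; apply: vecP0; ring.
have := H (vec 1 0 0 0); rewrite !pair_vecE => -[_ /vec0_inj[_ _]].
by rewrite /pc /pd => e1 e2; split; [lincomb e1|lincomb e2].
Qed.

Lemma pair_not_line : ~ line_mul A.
Proof.
case=> z H; case: (H (vec 1 0 0 0) (vec 1 0 0 0)) => k.
case: (H (vec 1 0 0 0) (vec 0 1 0 0)) => l; rewrite (vecE (z : 'rV_4)) !pair_vecE !scale_vec.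
rewrite /pc /pd; move: (z 0 i2) (z 0 i3) => z2 z3 /vec_inj[_ _ e1 e2] /vec_inj[_ _ e3 e4].
by apply: o0; lincomb (eqD (eqM (l * z3) e3) (eqD e2 (eqM (- l * z2) e4))).
Qed.

Lemma pair_not_zero : ~ zero_mul A.
Proof. by move=> H; apply: pair_not_line; exists 0 => x y; exists 0; rewrite H scaler0. Qed.

Lemma pair_not_cube : ~ cube_neq0 A.
Proof.
case=> x [y [z]]; apply; rewrite (vecE (x : 'rV_4)) (vecE (y : 'rV_4)) (vecE (z : 'rV_4)).
by rewrite !pair_vecE; apply: vecP0; rewrite /pc /pd; ring.
Qed.

Lemma pair_commutative : commutative_mul A <-> al = 1 /\ be = 0.
Proof.
split=> [H|[al1 be0] x y].
  have := H (vec 0 1 0 0) (vec 1 0 0 0); rewrite !pair_vecE /pc /pd.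
  by move=> /vec_inj[_ _ e1 e2]; split; [lincomb e2|lincomb e1].
rewrite (vecE (x : 'rV_4)) (vecE (y : 'rV_4)) !pair_vecE /pc /pd al1 be0.
by apply: vecP; ring.
Qed.

Lemma pair_squares_line : squares_line A <-> al = -1 /\ ep = 0.
Proof.
split=> [[z H]|[alE epE]]; last first.
  exists (vec 0 0 1 0) => x; rewrite (vecE (x : 'rV_4)) pair_vecE; eexists.
  by rewrite scale_vec /pc /pd alE epE; apply: vecP; rewrite ?mulr1 //; ring.
case: (H (vec 1 0 0 0)) => k; case: (H (vec 0 1 0 0)) => l; case: (H (vec 1 1 0 0)) => m.
rewrite (vecE (z : 'rV_4)) !pair_vecE !scale_vec /pc /pd.
move: (z 0 i2) (z 0 i3) => z2 z3.
move=> /vec_inj[_ _ _ e1] /vec_inj[_ _ _ e2] /vec_inj[_ _ e3 e4].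
have z3E : z3 = 0 by lincomb (eqD (eqM z3 e3) (eqM (- z2) e4)).
have epE : ep = 0 by lincomb (eqD e2 (eqM l z3E)).
by split=> //; lincomb (eqD e1 (eqD (eqM m z3E) (eqM (-1) epE))).
Qed.

Lemma pair_square_zero_witness : ga = 0 -> ep = 0 -> square_zero A.
Proof.
move=> ga0 ep0; exists (vec 0 1 0 0); split; first by case/pair_ann.
by rewrite pair_vecE /pc /pd ga0 ep0; apply: vecP0; ring.
Qed.

Lemma pair_no_square_zero : 1 + al != 0 -> ga != 0 -> ep = 0 -> ~ square_zero A.
Proof.
move=> al1 ga0 ep0 [x [nx]]; move: nx; rewrite (vecE (x : 'rV_4)) pair_vecE.
move: (x 0 i0) (x 0 i1) (x 0 i2) (x 0 i3) => u v w z nx /vec0_inj[_ _].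
rewrite /pc /pd ep0 => e1 e2; apply: nx; apply/pair_ann.
have /eqP : u * v = 0 by apply: (mulfI al1); lincomb e2.
rewrite mulf_eq0 => /orP[] /eqP z0; split=> //; apply/eqP; rewrite -sqrf_eq0; apply/eqP.
  by apply: (mulfI ga0); lincomb (eqD e1 (eqM (- u - be * v) z0)).
by lincomb (eqD e1 (eqM (- be * u - ga * v) z0)).
Qed.

Lemma pair_not_right_killed : ~ right_killed A.
Proof.
case=> x [nx H]; apply: nx; have := H (vec 1 0 0 0); rewrite (vecE (x : 'rV_4)).
rewrite pair_vecE => /vec0_inj[_ _]; rewrite /pc /pd => e1 e2.
by apply/pair_ann; split; [lincomb e1|lincomb e2].
Qed.

(** Every commutator is a multiple of -be a^2 + (1 - al) ab. On this line (1 - al) C + be D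
    vanishes, where C and D are the coordinates along a^2 and ab; applied to xa and xb this gives
    the two equations. *)
Lemma pair_commutator_degenerate : commutator_degenerate A ->
  exists u v, [/\ (u != 0) || (v != 0), u * (1 - al) + be * v = 0 &
     ga * v * (1 - al) + be * (u + ep * v) = 0].
Proof.
case=> x [nx [p [q H]]]; case: (H (vec 1 0 0 0)) => k; case: (H (vec 0 1 0 0)) => l.
move: nx; rewrite (vecE (x : 'rV_4)) (vecE (p : 'rV_4)) (vecE (q : 'rV_4)) !pair_vecE.
rewrite opp_vec !add_vec !scale_vec /pc /pd => nx /vec_inj[_ _ e1 e2] /vec_inj[_ _ e3 e4].
move: nx e1 e2 e3 e4; move: (x 0 i0) (x 0 i1) (x 0 i2) (x 0 i3) => u v w z nx.
move: (p 0 i0) (p 0 i1) (q 0 i0) (q 0 i1) => p0 p1 q0 q1 e1 e2 e3 e4.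
exists u, v; split.
- apply/negP => /negP; rewrite negb_or !negbK => /andP[/eqP u0 /eqP v0].
  by apply: nx; apply/pair_ann.
- by lincomb (eqD (eqM (1 - al) e3) (eqM be e4)).
- by lincomb (eqD (eqM (1 - al) e1) (eqM be e2)).
Qed.

End PairEvaluation.

Section PairNumbers.
Variable F : fieldType.
Let o0 : (1 : F) <> 0. Proof. exact/eqP/oner_neq0. Qed.

Lemma number_pair (al be ga ep : F) : number (pair_alg al be ga ep) =
  if `[< squares_line (pair_alg al be ga ep) >] then
    if (2%N \in [pchar F]) && ~~ `[< commutative_mul (pair_alg al be ga ep) >] then 19%N
    else 18%N
  else if `[< square_zero (pair_alg al be ga ep) >] then
    if `[< square_zero_normal (pair_alg al be ga ep) >] then 21%N else 20%N
  else if 2%N \in [pchar F] then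
    (if `[< commutative_mul (pair_alg al be ga ep) >] then 17%N else 26%N)
  else if `[< commutative_mul (pair_alg al be ga ep) >] then 23%N else
  if `[< commutator_degenerate (pair_alg al be ga ep) >] then 24%N else
  if `[< forall x : F, [\/ x = 0, x = 1 | x = -1] >] && `[< special22 (pair_alg al be ga ep) >]
  then 22%N else 25%N.
Proof.
rewrite /number (asboolF (@pair_not_zero _ _ _ _ _)) (asboolF (@pair_not_line _ _ _ _ _)).
by rewrite (asboolF (@pair_not_cube _ _ _ _ _)) (asboolF (@pair_not_right_killed _ _ _ _ _)).
Qed.

Lemma pchar2_opp (x : F) : 2%N \in [pchar F] -> - x = x.
Proof. by move=> /pchar2_eq0 h2; lincomb (eqM (- x) h2). Qed.

Lemma number17 (de : F) : 2%N \in [pchar F] -> number (pair_alg 1 0 de 1) = 17%N.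
Proof.
move=> ch; rewrite number_pair ch asboolF; last by case/pair_squares_line.
rewrite asboolF; last first.
  case=> x [nx]; move: nx; rewrite (vecE (x : 'rV_4)) pair_vecE.
  move: (x 0 i0) (x 0 i1) (x 0 i2) (x 0 i3) => u v w z nx /vec0_inj[_ _].
  rewrite /pc /pd => e1 e2; apply: nx; apply/pair_ann.
  have v0 : v = 0.
    apply/eqP; rewrite -sqrf_eq0; apply/eqP.
    by lincomb (eqD e2 (eqM (- (u * v)) (pchar2_eq0 ch))).
  split=> //; apply/eqP; rewrite -sqrf_eq0; apply/eqP.
  by lincomb (eqD e1 (eqM (- de * v) v0)).
by rewrite asboolT //; apply/pair_commutative.
Qed.

Lemma number18 (de : F) : number (pair_alg (-1) 0 de 0) = 18%N.
Proof.
rewrite number_pair asboolT; last by apply/pair_squares_line.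
case: (boolP (2%N \in [pchar F])) => //= ch.
by rewrite asboolT //; apply/pair_commutative; rewrite pchar2_opp.
Qed.

Lemma number19 (de : F) : 2%N \in [pchar F] -> number (pair_alg 1 1 de 0) = 19%N.
Proof.
move=> ch; rewrite number_pair ch asboolT; last first.
  by apply/pair_squares_line; rewrite pchar2_opp.
by rewrite asboolF //; case/pair_commutative.
Qed.

Lemma number20 : number (pair_alg (0 : F) 1 0 0) = 20%N.
Proof.
rewrite number_pair asboolF; last first.
  by case/pair_squares_line => H _; apply: o0; lincomb H.
rewrite asboolT; last exact: pair_square_zero_witness.
rewrite asboolF //; case=> x [nx x0 H]; case: (H (vec 1 0 0 0)) => k.
move: nx x0; rewrite (vecE (x : 'rV_4)) !pair_vecE scale_vec /pc /pd.
move: (x 0 i0) (x 0 i1) (x 0 i2) (x 0 i3) => u v w z nx /vec0_inj[_ _ e1 e2].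
move=> /vec_inj[_ _ e3 e4]; apply: nx; apply/pair_ann.
have u0 : u = 0.
  by apply/eqP; rewrite -sqrf_eq0; apply/eqP; lincomb (eqD e1 (eqM (-1) e2)).
by split=> //; lincomb (eqD e3 (eqM (k - 1) u0)).
Qed.

Lemma number21 (de : F) : de != -1 -> number (pair_alg de 0 0 0) = 21%N.
Proof.
move=> d1; rewrite number_pair asboolF; last first.
  by case/pair_squares_line => H _; case/eqP: d1.
rewrite asboolT; last exact: pair_square_zero_witness.
rewrite asboolT //; exists (vec 0 1 0 0); split=> [||y].
- by case/pair_ann.
- by rewrite pair_vecE /pc /pd; apply: vecP0; ring.
- exists de; rewrite (vecE (y : 'rV_4)) !pair_vecE scale_vec /pc /pd.
  by apply: vecP; ring.
Qed.

Lemma pchar3_of_iso (f : {rmorphism 'F_3 -> F}) : bijective f ->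
  2%:R != 0 :> F /\ forall x : F, [\/ x = 0, x = 1 | x = -1].
Proof.
case=> g fK gK; split=> [|x].
  by rewrite -(rmorph_nat f) fmorph_eq0.
rewrite -[x]gK; move: (g x) => [[|[|[|//]]] Hx].
- by constructor 1; rewrite -(rmorph0 f); congr (f _); apply: val_inj.
- by constructor 2; rewrite -(rmorph1 f); congr (f _); apply: val_inj.
- by constructor 3; rewrite -(rmorphN1 f); congr (f _); apply: val_inj.
Qed.

Lemma number22 : 2%:R != 0 :> F -> (forall x : F, [\/ x = 0, x = 1 | x = -1]) ->
  number (pair_alg (1 : F) 1 1 0) = 22%N.
Proof.
move=> h2 F3; rewrite number_pair asboolF; last first.
  by case/pair_squares_line => H _; case/eqP: h2; lincomb H.
rewrite asboolF; last by apply: pair_no_square_zero => //; exact/eqP.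
have -> : (2%N \in [pchar F]) = false by rewrite inE; apply: negPf.
rewrite asboolF; last by case/pair_commutative.
rewrite asboolF; last first.
  case/pair_commutator_degenerate => u [v [n0 e1 e2]].
  have u0 : u = 0 by lincomb e2.
  have v0 : v = 0 by lincomb e1.
  by move: n0; rewrite u0 v0 eqxx.
rewrite (asboolT F3) asboolT //; exists (vec 1 0 0 0), (vec 0 1 0 0).
rewrite !pair_vecE /pc /pd; split.
- by move=> /vec_inj[_ _ H _]; apply: o0; lincomb (eqM (-1) H).
- by apply: vecP; ring.
- by rewrite !opp_vec add_vec; apply: vecP; ring.
Qed.

Lemma number23 (de : F) : 2%N \notin [pchar F] -> de != 0 ->
  number (pair_alg 1 0 (- de) 0) = 23%N.
Proof.
move=> ch d0; rewrite number_pair (negPf ch); have h2 := pchar2_neq0 ch.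
rewrite asboolF; last first.
  by case/pair_squares_line => H _; case/eqP: h2; lincomb H.
rewrite asboolF; last by apply: pair_no_square_zero; rewrite ?oppr_eq0.
by rewrite asboolT //; apply/pair_commutative.
Qed.

Lemma number24 : 2%N \notin [pchar F] -> number (pair_alg (0 : F) (-1) 1 0) = 24%N.
Proof.
move=> ch; rewrite number_pair (negPf ch); have h2 := pchar2_neq0 ch.
rewrite asboolF; last first.
  by case/pair_squares_line => H _; apply: o0; lincomb H.
rewrite asboolF; last first.
  by apply: pair_no_square_zero; rewrite ?addr0; [exact/eqP|exact/eqP|].
rewrite asboolF; last by case/pair_commutative => H _; apply: o0; rewrite H.
rewrite asboolT //; exists (vec 1 1 0 0); split; first by case/pair_ann.
exists (vec 1 0 0 0), (vec 0 1 0 0) => y; exists (y 0 i1).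
rewrite (vecE (y : 'rV_4)) !pair_vecE !opp_vec !add_vec !scale_vec /pc /pd !vec_coord.
by apply: vecP; ring.
Qed.

Lemma number25 (al be ga : F) : admissible (A4_25 al be ga) ->
  number (pair_alg al (- be) (- ga) 0) = 25%N.
Proof.
case=> ch al1 alm1 ga0 si; rewrite number_pair (negPf ch); have h2 := pchar2_neq0 ch.
have s0 : 1 - al != 0 by rewrite subr_eq0 eq_sym.
have n0 : be ^+ 2 + ga * (1 - al) ^+ 2 != 0.
  apply: contraNN si => /eqP E; rewrite exprMn exprVn; apply/eqP.
  by apply: (mulIf (expf_neq0 2 s0)); rewrite divfK ?expf_neq0 //; lincomb E.
rewrite asboolF; last first.
  by case/pair_squares_line => H _; case/eqP: alm1.
rewrite asboolF; last first.
  by apply: pair_no_square_zero; rewrite ?oppr_eq0 // addrC addr_eq0.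
rewrite asboolF; last by case/pair_commutative => H _; case/eqP: al1.
rewrite asboolF; last first.
  case/pair_commutator_degenerate => u [v [uv e1 e2]].
  have v0 : v = 0.
    by apply: (mulIf n0); lincomb (eqD (eqM (- (1 - al)) e2) (eqM (- be) e1)).
  have u0 : u = 0 by apply: (mulIf s0); lincomb (eqD e1 (eqM be v0)).
  by move: uv; rewrite u0 v0 eqxx.
case: (asboolP (forall x : F, [\/ x = 0, x = 1 | x = -1])) => //= F3.
have al0 : al = 0 by case: (F3 al) => // E; move: al1 alm1; rewrite E eqxx.
rewrite asboolF //; case=> x [y []].
rewrite (vecE (x : 'rV_4)) (vecE (y : 'rV_4)) !pair_vecE !opp_vec !add_vec /pc /pd al0.
move: (x 0 i0) (x 0 i1) (y 0 i0) (y 0 i1) => u v p q nE /vec_inj[_ _ _ e1].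
move=> /vec_inj[_ _ e2 e3].
(* Non-zero squares are 1 over three elements. As al = 0, equality of the two squares gives uv = pq,
   so v = u p q and the determinant u q - v p = u q (1 - p^2) vanishes, against the commutator being
   non-zero. *)
have sq (z : F) : z != 0 -> z * z = 1.
  by case: (F3 z) => ->; rewrite ?eqxx // => _; ring.
have D0 : u * q - v * p != 0.
  apply/negP => /eqP D; apply: nE; apply: vecP => //.
    by lincomb (eqM be D).
  by lincomb D.
have uv0 : u * v != 0.
  apply: contraNN D0 => /eqP E; apply/eqP; lincomb (eqD e3 (eqM (-1) E)).
have pq0 : p * q != 0.
  by apply: contraNN uv0 => /eqP E; apply/eqP; lincomb (eqD e1 E).
move: uv0 pq0; rewrite !mulf_eq0 !negb_or => /andP[/sq uu _] /andP[/sq pp _].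
case/eqP: D0; have vE : v = u * p * q by lincomb (eqD (eqM u e1) (eqM (- v) uu)).
by rewrite vE; lincomb (eqM (- (u * q)) pp).
Qed.

Lemma number26 (al be ga : F) : admissible (A4_26 al be ga) ->
  number (pair_alg al be ga 0) = 26%N.
Proof.
case=> ch al1 ga0; rewrite number_pair ch.
have al1' : 1 + al != 0 by rewrite addrC addr_eq0 pchar2_opp.
rewrite asboolF; last first.
  by case/pair_squares_line => H _; move: al1; rewrite H pchar2_opp ?eqxx.
rewrite asboolF; last exact: pair_no_square_zero.
by rewrite asboolF //; case/pair_commutative => H _; case/eqP: al1.
Qed.

Lemma number_listed (L : listed F) : admissible L -> number L = listed_number L.
Proof.
case: L => [||de|de|||| al be|al be|al|||||||de|de|de||de||de||al be ga|al be ga] /=.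
- by rewrite (number_iso (listed1 F)) number1.
- by rewrite (number_iso (listed2 F)) number2.
- by rewrite (number_iso (listed3 de)); exact: number3.
- by rewrite (number_iso (listed4 de)) number4.
- by rewrite (number_iso (listed5 F)) number5.
- by rewrite (number_iso (listed6 F)) number6.
- by rewrite (number_iso (listed7 F)); exact: number7.
- by case=> al0 be0; rewrite (number_iso (listed8 al be)) number8.
- by rewrite (number_iso (listed9 al be)); exact: number9.
- by rewrite (number_iso (listed10 al)) number10.
- by rewrite (number_iso (listed11 F)) number11.
- by rewrite (number_iso (listed12 F)) number12.
- by rewrite (number_iso (listed13 F)) number13.
- by rewrite (number_iso (listed14 F)) number14.
- by rewrite number15.
- by rewrite number16.
- by rewrite (number_iso (listed17 de)); exact: number17.
- by rewrite (number_iso (listed18 de)) number18.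
- by rewrite (number_iso (listed19 de)); exact: number19.
- by rewrite (number_iso (listed20 F)) number20.
- by rewrite (number_iso (listed21 de)); exact: number21.
- by case=> f /pchar3_of_iso[h2 F3]; rewrite (number_iso (listed22 F)) number22.
- by case=> d0 ch; rewrite (number_iso (listed23 de)) number23.
- by rewrite (number_iso (listed24 F)); exact: number24.
- by move=> adm; rewrite (number_iso (listed25 al be ga)); exact: number25.
- by move=> adm; rewrite (number_iso (listed26 al be ga)); exact: number26.
Qed.

Lemma listed_not_iso (L L' : listed F) : admissible L -> admissible L' ->
  listed_number L <> listed_number L' -> ~ (L ≅ L').
Proof.
by move=> hL hL' n h; apply: n; rewrite -!number_listed // (number_iso h).
Qed.

End PairNumbers.

(** * Every algebra is in the list *)

Definition in_list (F : fieldType) (A : algebra F) : Prop :=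
  exists2 L : listed F, admissible L & A ≅ L.

Lemma in_list_iso (F : fieldType) (A B : algebra F) : A ≅ B -> in_list B -> in_list A.
Proof. by move=> h [L hL hB]; exists L => //; apply: alg_iso_trans h hB. Qed.

Lemma in_list_sym (F : fieldType) (L : listed F) (A : algebra F) :
  admissible L -> L ≅ A -> in_list A.
Proof. by move=> hL h; exists L => //; apply: alg_iso_sym. Qed.

(** * Normal forms of ternary bilinear forms *)

Section FormsInList.
Variable F : fieldType.

Definition listed_form (M : 'M[F]_3) := in_list (bf M).

Lemma form_step (M N : 'M[F]_3) (a b c d e f g h i k : F) :
  k != 0 -> a * (e * i - f * h) - b * (d * i - f * g) + c * (d * h - e * g) != 0 ->
  mx3 a b c d e f g h i *m M *m (mx3 a b c d e f g h i)^T = k *: N ->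
  listed_form N -> listed_form M.
Proof.
move=> k0 D E; apply: in_list_iso; apply: alg_iso_sym; apply: iso_similar.
by exists (mx3 a b c d e f g h i); [rewrite unitmxE unitfE det_mx3|exists k].
Qed.

Ltac gram := rewrite tr_mx3 !mul_mx3 scale_mx3; congr mx3; try ring.

Lemma form_swap01 (a b c d e f g h i : F) :
  listed_form (mx3 e d f b a c h g i) -> listed_form (mx3 a b c d e f g h i).
Proof.
apply: (@form_step _ _ 0 1 0 1 0 0 0 0 1 1); rewrite ?oner_neq0 //; last by gram.
by rewrite (_ : _ + _ = -1) ?oppr_eq0 ?oner_neq0 //; ring.
Qed.

Lemma form_swap12 (a b c d e f g h i : F) :
  listed_form (mx3 a c b g i h d f e) -> listed_form (mx3 a b c d e f g h i).
Proof.
apply: (@form_step _ _ 1 0 0 0 0 1 0 1 0 1); rewrite ?oner_neq0 //; last by gram.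
by rewrite (_ : _ + _ = -1) ?oppr_eq0 ?oner_neq0 //; ring.
Qed.

Lemma form_scale (k a b c d e f g h i : F) : k != 0 ->
  listed_form (mx3 a b c d e f g h i) ->
  listed_form (mx3 (k * a) (k * b) (k * c) (k * d) (k * e) (k * f) (k * g) (k * h) (k * i)).
Proof.
move=> k0; apply: (@form_step _ _ 1 0 0 0 1 0 0 0 1 k); rewrite // ?oner_neq0 //; last by gram.
by rewrite (_ : _ + _ = 1) ?oner_neq0 //; ring.
Qed.

Lemma form_zero : listed_form 0.
Proof. exact: (in_list_sym (L := A4_1)) (listed1 F). Qed.

Lemma form_diag0 (r s t : F) : r != 0 -> listed_form (mx3 r 0 0 0 s 0 0 0 t).
Proof.
move=> r0.
have -> : mx3 r 0 0 0 s 0 0 0 t = mx3 (r * 1) (r * 0) (r * 0) (r * 0) (r * (s / r)) (r * 0)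
    (r * 0) (r * 0) (r * (t / r)) by congr mx3; field.
apply: form_scale => //; move: (s / r) (t / r) => {}s {}t.
have [s0|s0] := eqVneq s 0; have [t0|t0] := eqVneq t 0.
- by rewrite s0 t0; exact: (in_list_sym (L := A4_2)) (listed2 F).
- by rewrite s0; apply: form_swap12; apply: (in_list_sym (L := A4_3 t)) (listed3 t).
- by rewrite t0; apply: (in_list_sym (L := A4_3 s)) (listed3 s).
- exact: (in_list_sym (L := A4_8 s t)) (listed8 s t).
Qed.

Lemma form_diag (r s t : F) : listed_form (mx3 r 0 0 0 s 0 0 0 t).
Proof.
have [r0|r0] := eqVneq r 0; last exact: form_diag0.
have [s0|s0] := eqVneq s 0; last by apply: form_swap01; apply: form_diag0.
have [t0|t0] := eqVneq t 0; last first.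
  by apply: form_swap12; apply: form_swap01; apply: form_diag0.
rewrite r0 s0 t0 (_ : mx3 _ _ _ _ _ _ _ _ _ = 0); first exact: form_zero.
by apply/matrixP; apply: ord3P; apply: ord3P; rewrite mx3E mxE.
Qed.

Lemma form_alternating (q : F) : listed_form (mx3 0 0 0 0 0 q 0 (- q) 0).
Proof.
have [->|q0] := eqVneq q 0; first by rewrite oppr0; exact: form_diag.
have := in_list_sym (L := A4_5) I (listed5 F).
apply: (@form_step _ _ 0 1 0 0 0 1 1 0 0 q) => //; last by gram.
by rewrite (_ : _ + _ = 1) ?oner_neq0 //; ring.
Qed.

Lemma form_symmetric_block0 (r p q s : F) : p != 0 -> listed_form (mx3 r 0 0 0 p q 0 q s).
Proof.
move=> p0; have := form_diag r p (s - q ^+ 2 / p).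
apply: (@form_step _ _ 1 0 0 0 1 0 0 (- q / p) 1 1); rewrite ?oner_neq0 //.
  by rewrite (_ : _ + _ = 1) ?oner_neq0 //; ring.
by gram; field.
Qed.

Lemma form_symmetric_block (r p q s : F) : listed_form (mx3 r 0 0 0 p q 0 q s).
Proof.
have [p0|p0] := eqVneq p 0; last exact: form_symmetric_block0.
have [s0|s0] := eqVneq s 0; last by apply: form_swap12; apply: form_symmetric_block0.
have [q0|q0] := eqVneq q 0; first by rewrite p0 s0 q0; exact: form_diag.
rewrite p0 s0; have [h2|h2] := eqVneq (2%:R : F) 0; last first.
  have := form_diag r (2%:R * q) (- 2%:R * q).
  apply: (@form_step _ _ 1 0 0 0 1 1 0 1 (-1) 1); rewrite ?oner_neq0 //; last by gram.
  by rewrite (_ : _ + _ = - 2%:R) ?oppr_eq0 //; ring.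
have [->|r0] := eqVneq r 0.
  by rewrite -{2}[q](_ : - q = _); [exact: form_alternating|lincomb (eqM (- q) h2)].
(* In characteristic 2 the sum of <r> and an alternating plane is the diagonal form <r, r, r>,
   although the plane alone cannot be diagonalized. *)
have := form_diag r r r.
apply: (@form_step _ _ 1 1 0 1 0 (r / q) 1 1 (r / q) 1); rewrite ?oner_neq0 //.
  rewrite (_ : _ + _ = - (r / q)); last by ring.
  by rewrite oppr_eq0 mulf_neq0 ?invr_neq0.
gram; rewrite ?mul1r.
all: try by lincomb (eqM r h2).
all: try (transitivity (2%:R * r); [by field|by rewrite h2 mul0r]).
by transitivity (2%:R * r + r); [field|rewrite h2 mul0r add0r].
Qed.

Lemma form_nonsymmetric_block0 (r p q q' s : F) : q != q' -> p != 0 ->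
  listed_form (mx3 r 0 0 0 p q 0 q' s).
Proof.
move=> qq p0; have d0 : q - q' != 0 by rewrite subr_eq0.
(* The determinant p s - q q' of the block over the square of its alternating part: unchanged by
   congruence and scaling. *)
pose be := (s - q' * q / p) * p / (q - q') ^+ 2.
have [r0|r0] := eqVneq r 0.
  have := in_list_sym (L := A4_4 be) I (listed4 be).
  apply: (@form_step _ _ 0 1 0 0 (- q' / (q - q')) (p / (q - q')) 1 0 0 p) => //.
    rewrite (_ : _ + _ = p / (q - q')); last by ring.
    by rewrite mulf_neq0 ?invr_neq0.
  by rewrite r0 /be; gram; field; rewrite ?d0 ?p0.
have := in_list_sym (L := A4_9 (r / p) be) (mulf_neq0 r0 (invr_neq0 p0)) (listed9 (r / p) be).
apply: (@form_step _ _ 1 0 0 0 1 0 0 (- q' / (q - q')) (p / (q - q')) p) => //.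
  rewrite (_ : _ + _ = p / (q - q')); last by ring.
  by rewrite mulf_neq0 ?invr_neq0.
by rewrite /be; gram; field; rewrite ?d0 ?p0.
Qed.

Lemma form_block (r p q q' s : F) : listed_form (mx3 r 0 0 0 p q 0 q' s).
Proof.
have [->|qq] := eqVneq q q'; first exact: form_symmetric_block.
have [p0|p0] := eqVneq p 0; last exact: form_nonsymmetric_block0.
have [s0|s0] := eqVneq s 0; last first.
  by apply: form_swap12; apply: form_nonsymmetric_block0; rewrite // eq_sym.
rewrite p0 s0; have [qq'|qq'] := eqVneq (q + q') 0; last first.
  have n1 : q + 0 != q' + 0 by rewrite !addr0.
  have := @form_nonsymmetric_block0 r (q + q') q q' 0 qq qq'.
  apply: (@form_step _ _ 1 0 0 0 1 1 0 0 1 1); rewrite ?oner_neq0 //; last by gram.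
  by rewrite (_ : _ + _ = 1) ?oner_neq0 //; ring.
have q'E : q' = - q by lincomb qq'.
have q0 : q != 0 by apply: contraNN qq => /eqP q0; rewrite q'E q0 oppr0.
rewrite q'E; have [->|r0] := eqVneq r 0; first exact: form_alternating.
have ch : 2%N \notin [pchar F].
  apply: contraNN qq => /pchar2_eq0 h2; apply/eqP; rewrite q'E.
  by lincomb (eqM q h2).
have := in_list_sym (L := A4_7) ch (listed7 F).
apply: (@form_step _ _ 1 0 0 0 1 0 0 0 (r / q) r) => //.
  rewrite (_ : _ + _ = r / q); last by ring.
  by rewrite mulf_neq0 ?invr_neq0.
by gram; field.
Qed.

(* The first basis vector spans the kernel of the alternating part. *)
Lemma form_central (r s t p q q' w : F) : q != q' -> listed_form (mx3 r s t s p q t q' w).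
Proof.
move=> qq; have d0 : q - q' != 0 by rewrite subr_eq0.
have [r0|r0] := eqVneq r 0; last first.
  have := form_block r (p - s ^+ 2 / r) (q - s * t / r) (q' - s * t / r) (w - t ^+ 2 / r).
  apply: (@form_step _ _ 1 0 0 (- s / r) 1 0 (- t / r) 0 1 1); rewrite ?oner_neq0 //.
    by rewrite (_ : _ + _ = 1) ?oner_neq0 //; ring.
  by gram; field.
rewrite r0 {r r0}.
have main s0 t0 p0 a a' w0 : a != a' -> t0 != 0 -> listed_form (mx3 0 s0 t0 s0 p0 a t0 a' w0).
  move=> aa t0n; have {}d0 : a - a' != 0 by rewrite subr_eq0.
  have red : listed_form (mx3 (p0 - s0 / t0 * (a + a') + (s0 / t0) ^+ 2 * w0) (a - s0 / t0 * w0) 0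
      (a' - s0 / t0 * w0) w0 t0 0 t0 0) -> listed_form (mx3 0 s0 t0 s0 p0 a t0 a' w0).
    apply: (@form_step _ _ 0 1 (- s0 / t0) 0 0 1 1 0 0 1); rewrite ?oner_neq0 //.
      by rewrite (_ : _ + _ = 1) ?oner_neq0 //; ring.
    by gram; field.
  (* [tau] is the value of the form at a vector orthogonal to the kernel vector: non-zero it leads
     to [A4_10], zero to [A4_11]. *)
  apply: red; set tau := p0 - _ + _; set b := a - _; set b' := a' - _.
  have dE : a - a' = b - b' by rewrite /b /b'; ring.
  rewrite dE in d0; clear dE; move: tau b b' d0 => tau b b' d0.
  have [->|tau0] := eqVneq tau 0; last first.
    pose al := (w0 - b * b' / tau) * tau / (b - b') ^+ 2.
    have := in_list_sym (L := A4_10 al) I (listed10 al).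
    apply: (@form_step _ _ 1 0 0 (- b' / (b - b')) (tau / (b - b')) 0
      0 0 ((b - b') / t0) tau) => //.
      rewrite (_ : _ + _ = tau / t0); last by field; rewrite t0n d0.
      by rewrite mulf_neq0 ?invr_neq0.
    by rewrite /al; gram; field; rewrite ?t0n ?tau0 ?d0.
  have d0' : b' - b != 0 by rewrite subr_eq0 eq_sym -subr_eq0.
  have := in_list_sym (L := A4_11) I (listed11 F).
  (* An equivalent shape of [A4_11] whose only non-zero products are ba = bc = cb, which shows the
     vanishing entries directly. *)
  have g11 : listed_form (mx3 1 1 0 0 0 0 0 1 (-1)) -> listed_form (mx3 0 0 0 1 0 1 0 1 0).
    apply: (@form_step _ _ 1 1 0 1 0 0 1 1 (-1) 1); rewrite ?oner_neq0 //.
      by rewrite (_ : _ + _ = 1) ?oner_neq0 //; ring.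
    by gram.
  move/g11.
  apply: (@form_step _ _ (b' - b)^-1 0 (- b / t0 / (b' - b))
     (- w0 / (b' - b)) 1 (w0 * b / t0 / (b' - b)) 0 0 t0^-1 1); rewrite ?oner_neq0 //.
    rewrite (_ : _ + _ = (b' - b)^-1 / t0); last by field; rewrite t0n d0'.
    by rewrite mulf_neq0 ?invr_neq0.
  by gram; field; rewrite ?t0n ?d0'.
have [t0|t0] := eqVneq t 0; last exact: main.
have [s0|s0] := eqVneq s 0; first by rewrite s0 t0; exact: form_block.
by apply: form_swap12; apply: main => //; rewrite eq_sym.
Qed.

Lemma form_symmetric0 (a b c e f i : F) : a != 0 -> listed_form (mx3 a b c b e f c f i).
Proof.
move=> a0; have := form_block a (e - b ^+ 2 / a) (f - b * c / a) (f - b * c / a) (i - c ^+ 2 / a).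
apply: (@form_step _ _ 1 0 0 (- b / a) 1 0 (- c / a) 0 1 1); rewrite ?oner_neq0 //.
  by rewrite (_ : _ + _ = 1) ?oner_neq0 //; ring.
by gram; field.
Qed.

Lemma form_symmetric (a b c e f i : F) : listed_form (mx3 a b c b e f c f i).
Proof.
have [a0|a0] := eqVneq a 0; last exact: form_symmetric0.
have [e0|e0] := eqVneq e 0; last by apply: form_swap01; apply: form_symmetric0.
have [i0|i0] := eqVneq i 0; last first.
  by apply: form_swap12; apply: form_swap01; apply: form_symmetric0.
rewrite a0 e0 i0; have [h2|h2] := eqVneq (2%:R : F) 0; last first.
  have off b' c' f' : b' != 0 -> listed_form (mx3 0 b' c' b' 0 f' c' f' 0).
    move=> b0; have := @form_symmetric0 (2%:R * b') b' (c' + f') 0 f' 0 (mulf_neq0 h2 b0).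
    apply: (@form_step _ _ 1 1 0 0 1 0 0 0 1 1); rewrite ?oner_neq0 //; last by gram.
    by rewrite (_ : _ + _ = 1) ?oner_neq0 //; ring.
  have [b0|b0] := eqVneq b 0; last exact: off.
  have [c0|c0] := eqVneq c 0; last by apply: form_swap12; apply: off.
  have [f0|f0] := eqVneq f 0; last by apply: form_swap01; apply: form_swap12; apply: off.
  by rewrite b0 c0 f0; apply: form_diag.
(* In characteristic 2 an alternating matrix has the kernel vector (f, c, b). *)
have off b' c' f' : b' != 0 -> listed_form (mx3 0 b' c' b' 0 f' c' f' 0).
  move=> b0; have := form_block 0 0 b' b' 0.
  apply: (@form_step _ _ f' (- c') b' 1 0 0 0 1 0 1); rewrite ?oner_neq0 //.
    by rewrite (_ : _ + _ = b') //; ring.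
  gram.
  - by lincomb (eqM (- b' * c' * f') h2).
  - by lincomb (eqM (b' * f') h2).
  - by lincomb (eqM (b' * f') h2).
have [b0|b0] := eqVneq b 0; last exact: off.
have [c0|c0] := eqVneq c 0; last by apply: form_swap12; apply: off.
by rewrite b0 c0; exact: form_block.
Qed.

Lemma bf_in_list (M : 'M[F]_3) : in_list (bf M).
Proof.
rewrite [M]mx3P -/(listed_form _); move: (M j0 j0) (M j0 j1) (M j0 j2) (M j1 j0) (M j1 j1) (M j1 j2)
    (M j2 j0) (M j2 j1) (M j2 j2) => a b c d e f g h i.
have main a' b' c' d' e' f' g' h' i' : b' != d' -> listed_form (mx3 a' b' c' d' e' f' g' h' i').
  move=> bd; have z0 : b' - d' != 0 by rewrite subr_eq0.
  (* The vector (x, y, z) spans the kernel of the alternating part; taken as first basis vector it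
     makes the first row equal to the first column. *)
  pose x := f' - h'; pose y := g' - c'; pose z := b' - d'.
  have := @form_central (a' * x ^+ 2 + e' * y ^+ 2 + i' * z ^+ 2 + (b' + d') * x * y +
      (c' + g') * x * z + (f' + h') * y * z) (a' * x + d' * y + g' * z)
      (b' * x + e' * y + h' * z) a' b' d' e' bd.
  apply: (@form_step _ _ x y z 1 0 0 0 1 0 1); rewrite ?oner_neq0 //.
    by rewrite (_ : _ + _ = z) //; ring.
  by rewrite /x /y /z; gram.
have [bd|bd] := eqVneq b d; last exact: main.
have [cg|cg] := eqVneq c g; last by apply: form_swap12; apply: main.
have [fh|fh] := eqVneq f h; last first.
  by apply: form_swap01; apply: form_swap12; apply: main.
by rewrite bd cg fh; exact: form_symmetric.
Qed.

End FormsInList.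

(** * Normal forms of two-generator algebras *)

Section PairsInList.
Variable F : fieldType.
Implicit Types al be ga ep : F.

Lemma pair_in_list_scale al be ga ep k : k != 0 ->
  in_list (pair_alg al (be / k) (ga / k ^+ 2) (ep / k)) -> in_list (pair_alg al be ga ep).
Proof.
move=> k0; apply: in_list_iso; apply/pair_iso; exists 1, 0, 0, k.
rewrite mul1r mul0r subr0 /pc /pd; split=> //.
by split; try ring; field.
Qed.

Lemma F3_iso : 2%:R != 0 :> F -> (forall x : F, [\/ x = 0, x = 1 | x = -1]) ->
  exists f : {rmorphism 'F_3 -> F}, bijective f.
Proof.
move=> h2 F3; have h3 : 3%:R = 0 :> F.
  case: (F3 2%:R) => E; first by rewrite E eqxx in h2.
    by case/eqP: (oner_neq0 F); lincomb E.
  by lincomb E.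
pose f0 (x : 'F_3) : F := (nat_of_ord x)%:R.
have f0D : zmod_morphism f0.
  move=> [[|[|[|//]]] ?] [[|[|[|//]]] ?]; rewrite /f0;
    (match goal with |- _ *+ ?m = _ => let n := eval vm_compute in m in change m with n end);
    rewrite /=; first [ring|by lincomb (eqM 1 h3)].
have f0M : monoid_morphism f0.
  split=> [|[[|[|[|//]]] ?] [[|[|[|//]]] ?]]; rewrite /f0;
    (match goal with |- _ *+ ?m = _ => let n := eval vm_compute in m in change m with n end);
    rewrite /=; first [ring|by lincomb (eqM (-1) h3)].
pose f : {rmorphism 'F_3 -> F} := HB.pack f0 (GRing.isZmodMorphism.Build _ _ f0 f0D)
  (GRing.isMonoidMorphism.Build _ _ f0 f0M).
exists f; pose g (x : F) : 'F_3 := if x == 0 then 0 else if x == 1 then 1 else -1.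
have n11 : (-1 : F) == 1 = false.
  by apply/negP => /eqP E; case/eqP: h2; lincomb (eqM (-1) E).
have fE : (f 0 = 0) * (f 1 = 1) * (f (-1) = -1) by rewrite rmorph0 rmorph1 rmorphN1.
exists g => x; last first.
  by rewrite /g; case: (F3 x) => ->; rewrite ?eqxx ?oner_eq0 ?oppr_eq0 ?oner_eq0 ?n11 fE.
apply: (fmorph_inj f); move: (f x) => y.
by rewrite /g; case: (F3 y) => ->; rewrite ?eqxx ?oner_eq0 ?oppr_eq0 ?oner_eq0 ?n11 fE.
Qed.

Lemma pair_in_list_ga0 al be : al != -1 -> in_list (pair_alg al be 0 0).
Proof.
move=> al1; have s0 : 1 + al != 0 by rewrite addrC addr_eq0.
have [->|be0] := eqVneq be 0.
  exact: (in_list_sym (L := A4_21 al)) (listed21 al).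
apply: in_list_iso (in_list_sym (L := A4_20) I (listed20 F)); apply/pair_iso.
exists 1, (- al / (1 + al)), 0, (be / (1 + al)); split.
  by rewrite mul1r mulr0 subr0 mulf_neq0 ?invr_neq0.
by rewrite /pc /pd; split; try ring; field.
Qed.

(** In the notation of [A4_25], sigma^2 = -gamma is the degenerate case, in which all parameters
    collapse to the single algebra [A4_24]. *)
Lemma pair_in_list_generic al be ga : 2%:R != 0 :> F -> al != 1 -> al != -1 -> ga != 0 ->
  in_list (pair_alg al be ga 0).
Proof.
move=> h2 al1 alm1 ga0; have s0 : 1 - al != 0 by rewrite subr_eq0 eq_sym.
have ch : 2%N \notin [pchar F] by rewrite inE.
have [gaE|gaE] := eqVneq ((- be / (1 - al)) ^+ 2) ga; last first.
  have := @in_list_sym _ (A4_25 al (- be) (- ga)) _ _ (listed25 _ _ _).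
  by rewrite !opprK; apply; split=> //; rewrite ?oppr_eq0 ?opprK.
apply: in_list_iso (in_list_sym (L := A4_24) ch (listed24 F)); apply/pair_iso.
have si0 : - be / (1 - al) != 0 by apply: contraNN ga0 => /eqP E; rewrite -gaE E expr0n.
have be0 : be != 0 by apply: contraNN si0 => /eqP ->; rewrite oppr0 mul0r.
exists (1 - al)^-1, (al / (1 - al)), (- be / (1 - al) * (al / (1 - al))),
  (- be / (1 - al) / (1 - al)); split.
  rewrite (_ : _ - _ = - be * (1 + al) / (1 - al) ^+ 2); last by field.
  by rewrite !mulf_neq0 ?oppr_eq0 ?invr_neq0 ?expf_neq0 // addrC addr_eq0.
by rewrite -gaE /pc /pd; split; field.
Qed.

(* Over F_3 no admissible v exists when ga = 1: this is the algebra A_{4,22}. *)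
Lemma pair_in_list_one ga : 2%:R != 0 :> F -> ga != 0 -> in_list (pair_alg 1 1 ga 0).
Proof.
move=> h2 ga0.
(* The generators a + v b and ga v a + b satisfy the same relation b^2 = ga a^2 and exchange al = 1
   for a value different from 1 and -1. *)
have move_v v : v != 0 -> 1 - ga * v ^+ 2 != 0 -> 1 - ga * v ^+ 2 + v != 0 ->
    in_list (pair_alg 1 1 ga 0).
  move=> v0 n0 m0.
  pose al := (1 - ga * v ^+ 2 - v) / (1 - ga * v ^+ 2 + v).
  pose be := (1 + ga * v ^+ 2) / (1 - ga * v ^+ 2 + v).
  have : in_list (pair_alg al be ga 0).
    apply: pair_in_list_generic => //.
      apply/negP => /eqP E; case/negP: (mulf_neq0 h2 v0); apply/eqP.
      have : al * (1 - ga * v ^+ 2 + v) = 1 - ga * v ^+ 2 - v by rewrite divfK.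
      by rewrite E => E'; lincomb E'.
    apply/negP => /eqP E; case/negP: (mulf_neq0 h2 n0); apply/eqP.
    have : al * (1 - ga * v ^+ 2 + v) = 1 - ga * v ^+ 2 - v by rewrite divfK.
    by rewrite E => E'; lincomb (eqM (-1) E').
  apply: in_list_iso; apply: alg_iso_sym; apply/pair_iso.
  exists 1, v, (ga * v), 1; split; first by rewrite mulr1 mulrCA.
  by rewrite /pc /pd /al /be; split; try ring; field.
have [ga1|ga1] := eqVneq ga 1; last first.
  apply: (move_v (-1)); rewrite ?oppr_eq0 ?oner_neq0 // sqrrN expr1n mulr1.
    by rewrite subr_eq0 eq_sym.
  by rewrite addrAC subrr sub0r oppr_eq0.
have [h3|h3] := eqVneq (3%:R : F) 0; last first.
  apply: (move_v 2%:R) => //; rewrite ga1.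
    by rewrite (_ : _ - _ = - 3%:R) ?oppr_eq0 //; ring.
  by rewrite (_ : _ + _ = - 1) ?oppr_eq0 ?oner_neq0 //; ring.
have [F3|F3] := pselect (forall x : F, [\/ x = 0, x = 1 | x = -1]).
  by rewrite ga1; apply: (in_list_sym (L := A4_22) (F3_iso h2 F3)) (listed22 F).
have [v [v0 v1 vm1]] : exists v : F, [/\ v != 0, v != 1 & v != -1].
  apply: contrapT => H; apply: F3 => x; apply: contrapT => C; apply: H.
  exists x; split; apply/eqP => E; apply: C; rewrite E; [exact: Or31|exact: Or32|exact: Or33].
have sq w : w != 1 -> w != -1 -> 1 - ga * w ^+ 2 != 0.
  move=> w1 wm1; rewrite ga1 (_ : _ - _ = (1 - w) * (w + 1)); last by ring.
  by apply: mulf_neq0; [rewrite subr_eq0 eq_sym|rewrite addr_eq0].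
(* If v makes the last denominator vanish, -v does not, since the two expressions differ by 2 v. *)
have [E|E] := eqVneq (1 - ga * v ^+ 2 + v) 0; last exact: (move_v v v0 (sq v v1 vm1) E).
apply: (move_v (- v)); rewrite ?oppr_eq0 //; first by apply: sq; rewrite ?eqr_oppLR ?opprK.
apply: contraNN (mulf_neq0 h2 v0) => /eqP E'; apply/eqP.
by lincomb (eqD E (eqM (-1) E')).
Qed.

Lemma pair_in_list al be ga : in_list (pair_alg al be ga 0).
Proof.
have [h2|h2] := eqVneq (2%:R : F) 0.
  have ch : 2%N \in [pchar F] by rewrite inE h2 eqxx.
  have m1 : -1 = 1 :> F by exact: pchar2_opp.
  have [->|al1] := eqVneq al 1.
    have [->|be0] := eqVneq be 0.
      by rewrite -m1; apply: (in_list_sym (L := A4_18 ga)) (listed18 ga).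
    apply: (@pair_in_list_scale _ _ _ _ be) => //; rewrite divff // mul0r.
    exact: (in_list_sym (L := A4_19 (ga / be ^+ 2)) ch) (listed19 _).
  have [->|ga0] := eqVneq ga 0; first by apply: pair_in_list_ga0; rewrite m1.
  exact: (in_list_sym (L := A4_26 al be ga) (And3 ch al1 ga0)) (listed26 _ _ _).
have ch : 2%N \notin [pchar F] by rewrite inE.
have [->|alm1] := eqVneq al (-1).
  apply: in_list_iso (in_list_sym (L := A4_18 (ga - (be / 2%:R) ^+ 2)) I (listed18 _)).
  apply/pair_iso; exists 1, 0, (be / 2%:R), 1; split.
    by rewrite mulr1 mul0r subr0 oner_neq0.
  by rewrite /pc /pd; split; try ring; field.
have [->|ga0] := eqVneq ga 0; first exact: pair_in_list_ga0.
have [->|al1] := eqVneq al 1; last exact: pair_in_list_generic.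
have [->|be0] := eqVneq be 0.
  have := @in_list_sym _ (A4_23 (- ga)) _ _ (listed23 _).
  by rewrite opprK; apply; split; rewrite ?oppr_eq0.
apply: (@pair_in_list_scale _ _ _ _ be) => //; rewrite divff // mul0r.
by apply: pair_in_list_one; rewrite // mulf_neq0 ?invr_neq0 ?expf_neq0.
Qed.

Lemma pair_in_list_comm2 ga ep : 2%:R = 0 :> F -> in_list (pair_alg 1 0 ga ep).
Proof.
move=> h2; have ch : 2%N \in [pchar F] by rewrite inE h2 eqxx.
have [->|ep0] := eqVneq ep 0; first exact: pair_in_list.
apply: (@pair_in_list_scale _ _ _ _ ep) => //; rewrite divff // mul0r.
exact: (in_list_sym (L := A4_17 (ga / ep ^+ 2)) ch) (listed17 _).
Qed.

End PairsInList.

(** * Powers of a nilpotent algebra *)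

Section Structure.
Variables (F : fieldType) (A : algebra F).
Local Notation "x ** y" := (amul A x y) (at level 40, left associativity).
Implicit Types (U W : {vspace A}) (x y z : A).

(** The span of U A. Powers are formed by multiplying on the right, as [foldl] does in the
    definition of nilpotency; bases keep the generating list finite. *)
Definition mulv U : {vspace A} :=
  <<[seq x ** y | x <- vbasis U, y <- vbasis (fullv : {vspace A})]>>%VS.

Lemma mulv_mem U x y : x \in U -> x ** y \in mulv U.
Proof.
move=> xU; rewrite (coord_vbasis xU) (coord_vbasis (memvf y)).
rewrite linear_sumlz; apply: memv_suml => i _; rewrite linear_sumr.
apply: memv_suml => j _; rewrite linearZl_LR linearZr_LR /=.
by do 2 apply: memvZ; apply: memv_span; apply: allpairs_f; apply: mem_nth; rewrite size_tuple.
Qed.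

Lemma mulv_sub U W : (forall x y, x \in U -> x ** y \in W) -> (mulv U <= W)%VS.
Proof.
move=> H; apply/span_subvP => _ /allpairsP[[x y] /= [xU _ ->]].
by apply: H; apply: vbasis_mem.
Qed.

Lemma mulvS U W : (U <= W)%VS -> (mulv U <= mulv W)%VS.
Proof. by move=> UW; apply: mulv_sub => x y xU; apply: mulv_mem; apply: (subvP UW). Qed.

Lemma foldl_linear (s : seq A) : linear (fun x => foldl (amul A) x s).
Proof.
elim: s => [|y s IH] k u v //=.
by rewrite linearDl linearZl_LR /= IH.
Qed.

Hypothesis nilA : nilpotent A.

(** From U contained in U A follows U contained in U A^n, which is 0. *)
Lemma stable_eq0 U : (U <= mulv U)%VS -> U = 0%VS.
Proof.
move=> US; case: nilA => n Hn.
suff H m : forall u s, u \in U -> size s = m -> foldl (amul A) u s = 0.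
  apply/eqP; rewrite -subv0; apply/subvP => u uU.
  by have /= -> := H 0%N u [::] uU erefl; rewrite mem0v.
(* Descending induction on the word length: if words of length m + 1 kill U, words of length m kill
   U A, which contains U. Words longer than n vanish after their first n letters. *)
suff H k : (k <= n)%N -> forall u s, u \in U -> size s = (n - k)%N -> foldl (amul A) u s = 0.
  have [mn|nm] := leqP m n; first by move=> u s uU; rewrite -(subKn mn); apply: H; rewrite ?leq_subr.
  move=> u s _ sm; rewrite -(cat_take_drop n s) foldl_cat (Hn u (take n s)); last first.
    by rewrite size_takel // sm ltnW.
  by elim: (drop n s) => //= y t IH; rewrite linear0l.
elim: k => [_ u s _|k IH kn u s uU sz]; first by rewrite subn0; apply: Hn.
pose phi : {linear A -> A} := HB.pack (fun x => foldl (amul A) x s)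
  (GRing.isLinear.Build _ _ _ _ (fun x => foldl (amul A) x s) (foldl_linear s)).
have : (mulv U <= lker (linfun phi))%VS.
  apply: mulv_sub => x y xU; rewrite memv_ker lfunE /=; apply/eqP.
  by apply: (IH (ltnW kn) x (y :: s) xU); rewrite /= sz subnSK.
move/subvP/(_ u (subvP US _ uU)); rewrite memv_ker lfunE /=.
by move/eqP.
Qed.

Lemma mulv_dim_lt U : (mulv U <= U)%VS -> U != 0%VS -> (\dim (mulv U) < \dim U)%N.
Proof.
move=> sUU; apply: contraNltn => le; apply/eqP; apply: stable_eq0.
by rewrite -(geq_leqif (dimv_leqif_sup sUU)).
Qed.

Definition A2 := mulv fullv.
Definition A3 := mulv A2.
Definition A4 := mulv A3.

Lemma A2P x y : x ** y \in A2. Proof. exact/mulv_mem/memvf. Qed.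
Lemma A3P x y z : x ** y ** z \in A3. Proof. exact/mulv_mem/A2P. Qed.
Lemma A32 : (A3 <= A2)%VS. Proof. by apply: mulvS; exact: subvf. Qed.
Lemma A43 : (A4 <= A3)%VS. Proof. exact: mulvS A32. Qed.

Lemma A3_mulr x y : y \in A2 -> x ** y \in A3.
Proof.
move=> yA; have : (A2 <= (linfun (amul A x) @^-1: A3))%VS.
  by apply: mulv_sub => p q _; rewrite -memv_preim lfunE /= amulA; exact: A3P.
by move/subvP/(_ y yA); rewrite -memv_preim lfunE.
Qed.

Hypothesis dimA : \dim (fullv : {vspace A}) = 4%N.

Lemma span4_free (a b c d : A) : (fullv <= <<[:: a; b; c; d]>>)%VS ->
  forall v : 'rV[F]_4, \sum_i v 0 i *: row4 a b c d i = 0 -> v = 0.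
Proof.
move=> sp v; have : free [:: a; b; c; d].
  rewrite /free /= eqn_leq -{2}dimA dimvS // andbT.
  by apply: leq_trans (dim_span _) _.
rewrite -[[:: a; b; c; d]]/(val [tuple a; b; c; d]) => /freeP H E.
apply/rowP => i; rewrite mxE; apply: H.
by rewrite -[RHS]E; apply: eq_bigr => -[[|[|[|[|//]]]] ?] _.
Qed.

Lemma iso_span (r : table F) (rA : associative (table_mul r)) (a b c d : A) :
  (fullv <= <<[:: a; b; c; d]>>)%VS ->
  (forall i j, row4 a b c d i ** row4 a b c d j =
     \sum_k table_mul r (delta_mx 0 i) (delta_mx 0 j) 0 k *: row4 a b c d k) ->
  A ≅ table_alg rA.
Proof. by move=> sp; apply: iso_basis => //; exact: span4_free. Qed.

End Structure.

Lemma span2P (F : fieldType) (V : vectType F) (a b x : V) :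
  x \in <<[:: a; b]>>%VS -> exists k l : F, x = k *: a + l *: b.
Proof.
rewrite !span_cons span_nil addv0.
by move=> /memv_addP[_ /vlineP[k ->] [_ /vlineP[l ->] ->]]; exists k, l.
Qed.

Lemma dim2_relation (F : fieldType) (V : vectType F) (U : {vspace V}) (p q r : V) :
  (\dim U <= 2)%N -> p \in U -> q \in U -> r \in U ->
  exists k l m : F, [|| k != 0, l != 0 | m != 0] /\ k *: p + l *: q + m *: r = 0.
Proof.
move=> dU pU qU rU; apply: contrapT => H.
have fr : free [:: p; q; r].
  rewrite -[[:: p; q; r]]/(val [tuple p; q; r]); apply/freeP => k E i.
  apply: contrapT => /eqP ki; apply: H.
  exists (k j0), (k j1), (k j2); split; last by rewrite -[RHS]E sum_ord3.
  by move: i ki; apply: ord3P => ->; rewrite ?orbT.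
have : (<<[:: p; q; r]>> <= U)%VS.
  by apply/span_subvP => x; rewrite !inE => /or3P[] /eqP ->.
move/dimvS; rewrite (eqP fr) /= => le3.
by have := leq_trans le3 dU.
Qed.

(** * Two generators and A^3 = 0 *)

Section CaseCubeZero.
Variables (F : fieldType) (A : algebra F).
Local Notation "x ** y" := (amul A x y) (at level 40, left associativity).
Hypotheses (nilA : nilpotent A) (dimA : \dim (fullv : {vspace A}) = 4%N).
Hypothesis cube0 : forall x y z : A, x ** y ** z = 0.

Lemma cube0r x y z : x ** (y ** z) = 0. Proof. by rewrite amulA. Qed.

Lemma A2_ann s : s \in A2 A -> forall x, s ** x = 0 /\ x ** s = 0.
Proof.
move=> sA x; split.
  have lin : linear (fun s => s ** x) by move=> k u v; rewrite linearDl linearZl_LR.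
  pose f : {linear A -> A} := HB.pack (fun s => s ** x)
    (GRing.isLinear.Build _ _ _ _ (fun s => s ** x) lin).
  have : (A2 A <= lker (linfun f))%VS.
    by apply: mulv_sub => p q _; rewrite memv_ker lfunE /= cube0.
  by move/subvP/(_ s sA); rewrite memv_ker lfunE => /eqP.
have : (A2 A <= lker (linfun (amul A x)))%VS.
  by apply: mulv_sub => p q _; rewrite memv_ker lfunE /= cube0r.
by move/subvP/(_ s sA); rewrite memv_ker lfunE => /eqP.
Qed.

Definition gens a b := (fullv <= <<[:: a; b]>> + A2 A)%VS.

Lemma gens_sym a b : gens a b -> gens b a.
Proof. by rewrite /gens !span_cons !span_nil !addv0 addvC (addvC <[a]>%VS) addvC. Qed.

Lemma gensP a b x : gens a b -> exists k l s, s \in A2 A /\ x = k *: a + l *: b + s.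
Proof.
move/subvP/(_ x (memvf x)) => /memv_addP[y /span2P[k [l ->]] [s sA ->]].
by exists k, l, s.
Qed.

Lemma gens_lin a b u v x y : u * y - v * x != 0 -> gens a b ->
  gens (u *: a + v *: b) (x *: a + y *: b).
Proof.
move=> D /subv_trans; apply; rewrite subv_add addvSr andbT.
set p := u *: a + v *: b; set q := x *: a + y *: b.
apply/span_subvP => w; rewrite !inE.
have mem k l : k *: p + l *: q \in (<<[:: p; q]>> + A2 A)%VS.
  apply: (subvP (addvSl _ _)); apply: memvD; apply: memvZ; apply: memv_span;
    by rewrite !inE eqxx ?orbT.
case/orP => /eqP ->.
  have := mem (y / (u * y - v * x)) (- v / (u * y - v * x)).
  rewrite /p /q !scalerDr !scalerA addrACA -!scalerDl.
  have -> : y / (u * y - v * x) * u + - v / (u * y - v * x) * x = 1 by field.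
  have -> : y / (u * y - v * x) * v + - v / (u * y - v * x) * y = 0 by field.
  by rewrite scale1r scale0r addr0.
have := mem (- x / (u * y - v * x)) (u / (u * y - v * x)).
rewrite /p /q !scalerDr !scalerA addrACA -!scalerDl.
have -> : - x / (u * y - v * x) * u + u / (u * y - v * x) * x = 0 by field.
have -> : - x / (u * y - v * x) * v + u / (u * y - v * x) * y = 1 by field.
by rewrite scale1r scale0r add0r.
Qed.

Lemma mul_lin a b k l k' l' : (k *: a + l *: b) ** (k' *: a + l' *: b) =
  (k * k') *: (a ** a) + (k * l') *: (a ** b) + (l * k') *: (b ** a) + (l * l') *: (b ** b).
Proof.
rewrite linearDl !linearDr !linearZl_LR !linearZr_LR /= !scalerA.
by rewrite !addrA.
Qed.

Lemma A2_gens a b : gens a b -> (A2 A <= <<[:: a ** a; a ** b; b ** a; b ** b]>>)%VS.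
Proof.
move=> g; apply: mulv_sub => x y _.
have [k [l [s [sA ->]]]] := gensP x g; have [k' [l' [s' [s'A ->]]]] := gensP y g.
rewrite linearDl linearDr /= (A2_ann s'A _).2 (A2_ann sA _).1 !addr0 mul_lin.
do ![apply: memvD | apply: memvZ]; apply: memv_span; by rewrite !inE eqxx ?orbT.
Qed.

Lemma gens_span a b : gens a b -> (A2 A <= <<[:: a ** a; a ** b]>>)%VS ->
  (fullv <= <<[:: a; b; a ** a; a ** b]>>)%VS.
Proof.
move=> g /(addvS (subvv <<[:: a; b]>>%VS)) h; apply: subv_trans g (subv_trans h _).
by rewrite -span_cat.
Qed.

Lemma iso_pair a b al be ga ep : gens a b ->
  b ** a = be *: (a ** a) + al *: (a ** b) ->
  b ** b = ga *: (a ** a) + ep *: (a ** b) -> A ≅ pair_alg al be ga ep.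
Proof.
move=> g eba ebb; apply: (@iso_span _ _ dimA _ _ a b (a ** a) (a ** b)).
  apply: gens_span => //; apply: subv_trans (A2_gens g) _.
  apply/span_subvP => x; rewrite !inE => /or4P[] /eqP ->.
  - by apply: memv_span; rewrite !inE eqxx.
  - by apply: memv_span; rewrite !inE eqxx orbT.
  - by rewrite eba; apply: memvD; apply: memvZ; apply: memv_span; rewrite !inE eqxx ?orbT.
  - by rewrite ebb; apply: memvD; apply: memvZ; apply: memv_span; rewrite !inE eqxx ?orbT.
apply: ord4P; apply: ord4P; rewrite sum_ord4 !delta_vec pair_tableE !vec_coord /pc /pd /row4 /=.
all: rewrite ?cube0 ?cube0r ?eba ?ebb !(mulr0, mul0r, mulr1, addr0, add0r).
all: by rewrite ?(scale0r, scale1r, addr0, add0r).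
Qed.

(** The four vectors stand for a^2, ab, ba, b^2. An identity between combinations of them is checked
    on coefficients, modulo the two known relations with multipliers [t] and [t']. *)
Lemma combination_of_relations (p q r s : A) (r1 r2 r3 r4 r1' r2' r3' r4' : F) :
  r1 *: p + r2 *: q + r3 *: r + r4 *: s = 0 ->
  r1' *: p + r2' *: q + r3' *: r + r4' *: s = 0 ->
  forall (t t' g e k1 k2 k3 k4 l1 l2 l3 l4 m1 m2 m3 m4 : F),
  [/\ k1 = g * l1 + e * m1 + t * r1 + t' * r1', k2 = g * l2 + e * m2 + t * r2 + t' * r2',
      k3 = g * l3 + e * m3 + t * r3 + t' * r3' & k4 = g * l4 + e * m4 + t * r4 + t' * r4'] ->
  k1 *: p + k2 *: q + k3 *: r + k4 *: s =
  g *: (l1 *: p + l2 *: q + l3 *: r + l4 *: s) + e *: (m1 *: p + m2 *: q + m3 *: r + m4 *: s).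
Proof.
move=> R R' t t' g e k1 k2 k3 k4 l1 l2 l3 l4 m1 m2 m3 m4 [-> -> -> ->].
have addl a1 a2 a3 a4 b1 b2 b3 b4 : (a1 + b1) *: p + (a2 + b2) *: q + (a3 + b3) *: r +
    (a4 + b4) *: s = (a1 *: p + a2 *: q + a3 *: r + a4 *: s) +
    (b1 *: p + b2 *: q + b3 *: r + b4 *: s).
  by rewrite !scalerDl [X in X + _ + _ = _]addrACA [X in X + _ = _]addrACA [LHS]addrACA.
have mull a a1 a2 a3 a4 : (a * a1) *: p + (a * a2) *: q + (a * a3) *: r + (a * a4) *: s =
    a *: (a1 *: p + a2 *: q + a3 *: r + a4 *: s).
  by rewrite !scalerDr !scalerA.
by rewrite !addl !mull R R' !scaler0 !addr0.
Qed.

(** The new generators are ua + vb and xa + yb; each hypothesis on coefficients states one of the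
    two defining relations of [pair_alg] modulo the known relations, so that a normal form only
    takes a matrix and four multipliers. *)
Lemma iso_pair_relations a b (r1 r2 r3 r4 r1' r2' r3' r4' : F)
    (u v x y t t' s s' al be ga ep : F) : gens a b ->
  r1 *: (a ** a) + r2 *: (a ** b) + r3 *: (b ** a) + r4 *: (b ** b) = 0 ->
  r1' *: (a ** a) + r2' *: (a ** b) + r3' *: (b ** a) + r4' *: (b ** b) = 0 ->
  u * y - v * x != 0 ->
  [/\ x * u = be * (u * u) + al * (u * x) + t * r1 + t' * r1',
      x * v = be * (u * v) + al * (u * y) + t * r2 + t' * r2',
      y * u = be * (v * u) + al * (v * x) + t * r3 + t' * r3' &
      y * v = be * (v * v) + al * (v * y) + t * r4 + t' * r4'] ->
  [/\ x * x = ga * (u * u) + ep * (u * x) + s * r1 + s' * r1',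
      x * y = ga * (u * v) + ep * (u * y) + s * r2 + s' * r2',
      y * x = ga * (v * u) + ep * (v * x) + s * r3 + s' * r3' &
      y * y = ga * (v * v) + ep * (v * y) + s * r4 + s' * r4'] ->
  A ≅ pair_alg al be ga ep.
Proof.
move=> g R R' D E E'; apply: (iso_pair (gens_lin D g)); rewrite !mul_lin.
  exact: combination_of_relations R R' _ _ _ _ _ _ _ _ _ _ _ _ _ _ _ _ E.
exact: combination_of_relations R R' _ _ _ _ _ _ _ _ _ _ _ _ _ _ _ _ E'.
Qed.

Hypothesis dimA2 : (\dim (A2 A) <= 2)%N.

(** All products with a fixed left factor are proportional in this algebra, whereas a^2 and ab are
    independent in every [pair_alg]; hence the separate treatment. *)
Lemma iso16 a b : gens a b -> a ** b = 0 -> b ** b = 0 -> A ≅ A4_16.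
Proof.
move=> g eab ebb; apply: (@iso_span _ _ dimA _ (@products_assoc F A4_16) a b (a ** a) (b ** a)).
  have := addvS (subvv <<[:: a; b]>>%VS) (A2_gens g) => h.
  apply: subv_trans g (subv_trans h _); rewrite eab ebb -span_cat.
  by apply/span_subvP => x; rewrite !inE => /or4P[|||/or3P[]] /eqP ->;
    rewrite ?mem0v //; apply: memv_span; rewrite !inE eqxx ?orbT.
apply: ord4P; apply: ord4P; rewrite sum_ord4 !delta_vec.
all: rewrite -![table_mul _ _ _]/(amul (A4_16 : listed F) _ _) mul16E !vec_coord /row4 /=.
all: rewrite ?cube0 ?cube0r ?eab ?ebb !(mulr0, mul0r, mulr1, addr0, add0r).
all: by rewrite ?(scale0r, scale1r, addr0, add0r).
Qed.

Lemma in_list_diagonal a b ga : gens a b -> b ** b = ga *: (a ** a) -> in_list A.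
Proof.
move=> g ebb.
have R' : - ga *: (a ** a) + 0 *: (a ** b) + 0 *: (b ** a) + 1 *: (b ** b) = 0.
  by rewrite ebb !scale0r !addr0 scale1r scaleNr addNr.
have [k [l [m [n0 R]]]] := dim2_relation dimA2 (A2P a a) (A2P a b) (A2P b a).
have {}R : k *: (a ** a) + l *: (a ** b) + m *: (b ** a) + 0 *: (b ** b) = 0.
  by rewrite R scale0r addr0.
have [m0|m0] := eqVneq m 0; last first.
  apply: in_list_iso (pair_in_list (- l / m) (- k / m) ga).
  apply: (iso_pair_relations (u := 1) (v := 0) (x := 0) (y := 1) (t := m^-1) (t' := 0)
    (s := 0) (s' := 1) g R R'); first by rewrite mulr1 mulr0 subr0 oner_neq0.
    by split; try ring; field.
  by split; ring.
have [l0|l0] := eqVneq l 0.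
  have k0 : k != 0 by move: n0; rewrite m0 l0 eqxx !orbF.
  (* Here a^2 = b^2 = 0, and a + b takes the place of a. *)
  apply: in_list_iso (pair_in_list (-1) 1 0).
  apply: (iso_pair_relations (u := 1) (v := 1) (x := 0) (y := 1) (t := (ga - 1) / k) (t' := 1)
    (s := ga / k) (s' := 1) g R R'); first by rewrite mulr1 mulr0 subr0 oner_neq0.
    by rewrite m0 l0; split; try ring; field.
  by rewrite m0 l0; split; try ring; field.
have [ga0|ga0] := eqVneq ga 0; last first.
  (* Here ab is a multiple of a^2, hence of b^2, and the generators exchange roles. *)
  apply: in_list_iso (pair_in_list 0 (- k / (l * ga)) ga^-1).
  apply: (iso_pair_relations (u := 0) (v := 1) (x := 1) (y := 0) (t := l^-1)
    (t' := k / (l * ga)) (s := 0) (s' := - ga^-1) g R R').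
  - by rewrite mulr1 mul0r sub0r oppr_eq0 oner_neq0.
  - by rewrite m0; split; try ring; field; rewrite ?l0 ?ga0.
  - by split; try ring; field.
have [k0|k0] := eqVneq k 0; last first.
  (* With q = -(l / k) b one has aq = a^2 and q^2 = 0, so that p = q - a satisfies qp = p^2. *)
  apply: in_list_iso (pair_in_list 0 1 0).
  apply: (iso_pair_relations (u := -1) (v := - l / k) (x := 0) (y := - l / k) (t := - k^-1)
    (t' := 0) (s := 0) (s' := (l / k) ^+ 2) g R R').
  - by rewrite mulr0 subr0 !mulf_neq0 ?oppr_eq0 ?oner_neq0 ?invr_neq0.
  - by rewrite m0 ga0; split; try ring; field.
  - by rewrite ga0; split; try ring; field.
exists A4_16 => //; apply: (iso16 g); last by rewrite ebb ga0 scale0r.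
move: R; rewrite m0 k0 !scale0r !addr0 add0r => /eqP.
by rewrite scaler_eq0 (negPf l0) => /eqP.
Qed.

(** This is the case where the symmetric relation is ab + ba = 0 in characteristic 2, so that it
    cannot be diagonalized; a relation between a^2, ab and b^2 is used instead. *)
Lemma in_list_commutative2 a b : 2%:R = 0 :> F -> gens a b -> a ** b = b ** a -> in_list A.
Proof.
move=> h2 g com.
have R' : 0 *: (a ** a) + 1 *: (a ** b) + -1 *: (b ** a) + 0 *: (b ** b) = 0.
  by rewrite com !scale0r addr0 add0r scale1r scaleN1r subrr.
have [k [l [m [n0 R]]]] := dim2_relation dimA2 (A2P a a) (A2P a b) (A2P b b).
have {}R : k *: (a ** a) + l *: (a ** b) + 0 *: (b ** a) + m *: (b ** b) = 0.
  by rewrite scale0r addr0.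
have [m0|m0] := eqVneq m 0; last first.
  apply: in_list_iso (pair_in_list_comm2 (- k / m) (- l / m) h2).
  apply: (iso_pair_relations (u := 1) (v := 0) (x := 0) (y := 1) (t := 0) (t' := -1)
    (s := m^-1) (s' := 0) g R R'); first by rewrite mulr1 mulr0 subr0 oner_neq0.
    by split; ring.
  by split; try ring; field.
have [k0|k0] := eqVneq k 0; last first.
  apply: in_list_iso (pair_in_list_comm2 0 (- l / k) h2).
  apply: (iso_pair_relations (u := 0) (v := 1) (x := 1) (y := 0) (t := 0) (t' := 1)
    (s := k^-1) (s' := - l / k) g R R').
  - by rewrite mulr1 mul0r sub0r oppr_eq0 oner_neq0.
  - by split; ring.
  - by rewrite m0; split; try ring; field.
have l0 : l != 0 by move: n0; rewrite m0 k0 eqxx orbF.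
apply: in_list_iso (pair_in_list_comm2 0 1 h2).
apply: (iso_pair_relations (u := 1) (v := 1) (x := 0) (y := 1) (t := 0) (t' := -1)
  (s := - l^-1) (s' := 0) g R R'); first by rewrite mulr1 mulr0 subr0 oner_neq0.
  by split; ring.
by rewrite m0 k0; split; try ring; field.
Qed.

(** The three elements a^2, ab + ba and b^2 of the plane A^2 are dependent, which produces the
    symmetric relation. *)
Lemma in_list_gens a b : gens a b -> in_list A.
Proof.
move=> g.
have [x [y [z [n0 R]]]] := dim2_relation dimA2 (A2P a a)
  (memvD (A2P a b) (A2P b a)) (A2P b b).
have {}R : x *: (a ** a) + y *: (a ** b) + y *: (b ** a) + z *: (b ** b) = 0.
  by rewrite -R scalerDr !addrA.
(* Completing the square in the symmetric relation diagonalizes it. *)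
have main a' b' x' z' : gens a' b' -> z' != 0 ->
    x' *: (a' ** a') + y *: (a' ** b') + y *: (b' ** a') + z' *: (b' ** b') = 0 -> in_list A.
  move=> g' z0 R'.
  have D : 1 * 1 - 0 * (y / z') != 0 :> F by rewrite mulr1 mul0r subr0 oner_neq0.
  apply: (@in_list_diagonal _ _ ((y / z') ^+ 2 - x' / z') (gens_lin D g')).
  rewrite !mul_lin.
  have := combination_of_relations R' R' (t := z'^-1) (t' := 0)
    (g := (y / z') ^+ 2 - x' / z') (e := 0) (k1 := y / z' * (y / z')) (k2 := y / z' * 1)
    (k3 := 1 * (y / z')) (k4 := 1 * 1) (l1 := 1 * 1) (l2 := 1 * 0) (l3 := 0 * 1)
    (l4 := 0 * 0) (m1 := 0) (m2 := 0) (m3 := 0) (m4 := 0).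
  move=> ->; first by rewrite scale0r addr0.
  by split; try ring; field.
have [z0|z0] := eqVneq z 0; last exact: main g z0 R.
have [x0|x0] := eqVneq x 0; last first.
  apply: (main b a z x (gens_sym g) x0); rewrite -[RHS]R.
  by rewrite addrC (addrC (_ + _) (y *: (a ** b))) (addrC (z *: _)) !addrA.
have y0 : y != 0 by move: n0; rewrite x0 z0 eqxx orbF.
have [h2|h2] := eqVneq (2%:R : F) 0.
  apply: (in_list_commutative2 h2 g); apply/eqP; rewrite -subr_eq0.
  have m1 : -1 = 1 :> F by lincomb (eqM (-1) h2).
  rewrite -(scale1r (b ** a)) -scaleNr m1 scale1r; apply/eqP.
  by apply: (scalerI y0); rewrite scaler0 scalerDr -[RHS]R x0 z0 !scale0r add0r addr0.
(* Here ab + ba = 0, so a + b and a - b have equal squares. *)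
have D : 1 * -1 - 1 * 1 != 0 :> F by rewrite (_ : _ - _ = - 2%:R) ?oppr_eq0 //; ring.
apply: (@in_list_diagonal _ _ 1 (gens_lin D g)); rewrite !mul_lin.
have := combination_of_relations R R (t := - 2%:R / y) (t' := 0)
    (g := 1) (e := 0) (k1 := 1 * 1) (k2 := 1 * -1)
    (k3 := -1 * 1) (k4 := -1 * -1) (l1 := 1 * 1) (l2 := 1 * 1) (l3 := 1 * 1)
    (l4 := 1 * 1) (m1 := 0) (m2 := 0) (m3 := 0) (m4 := 0).
move=> ->; first by rewrite scale0r addr0.
by rewrite x0 z0; split; try ring; field.
Qed.

End CaseCubeZero.

Section SmallSpans.
Variables (F : fieldType) (V : vectType F).
Implicit Types U W : {vspace V}.

(** The default 0 of [nth] pads a basis to exactly n vectors, so a bound on the dimension suffices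
    to name generators. *)
Lemma sub_span_padded U n : (\dim U <= n)%N ->
  (U <= <<mkseq (nth 0%R (vbasis U)) n>>)%VS.
Proof.
move=> dU; rewrite -{1}(span_basis (vbasisP U)); apply/span_subvP => x xU.
apply: memv_span; apply/mapP; exists (index x (vbasis U)); last by rewrite nth_index.
rewrite mem_iota add0n; apply: leq_trans dU.
by rewrite -{2}(size_tuple (vbasis U)) index_mem.
Qed.

Lemma sub_line U : (\dim U <= 1)%N -> (U <= <[vpick U]>)%VS.
Proof.
move=> dU; have [->|U0] := eqVneq U 0%VS; first exact: sub0v.
have sub : (<[vpick U]> <= U)%VS by rewrite -memvE memv_pick.
by rewrite -(geq_leqif (dimv_leqif_sup sub)) dim_vline vpick0 U0.
Qed.

Lemma sub_complement U : (fullv <= U^C + U)%VS.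
Proof. by rewrite addvC addv_complf. Qed.

Lemma dim_complement U n : (\dim (fullv : {vspace V}) <= n + \dim U)%N -> (\dim U^C <= n)%N.
Proof. by rewrite dimv_compl leq_subLR addnC dimvf. Qed.

End SmallSpans.

(** * Normal forms of the algebras on a, a^2, c, a^3 *)

Section ChainScaling.
Variable F : fieldType.

Lemma chain_scale (s t x y : F) : x != 0 -> y != 0 ->
  chain_alg s t ≅ chain_alg (y * s / x ^+ 2) (y ^+ 2 * t / x ^+ 3).
Proof.
move=> x0 y0; apply: (@iso_basis _ _ _ (chain_alg s t) (@row4 (chain_alg s t)
  (vec x 0 0 0) (vec 0 (x ^+ 2) 0 0) (vec 0 0 y 0) (vec 0 0 0 (x ^+ 3)))).
- exact: dim_rV4.
- move=> v; rewrite sum_ord4 /row4 /= !scale_vec !add_vec => /vec0_inj.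
  rewrite !(mulr0, addr0, add0r) => -[e0 e1 e2 e3]; rewrite [v]vecE; apply: vecP0.
  + by apply: (mulIf x0); rewrite mul0r.
  + by apply: (mulIf (expf_neq0 2 x0)); rewrite mul0r.
  + by apply: (mulIf y0); rewrite mul0r.
  + by apply: (mulIf (expf_neq0 3 x0)); rewrite mul0r.
apply: ord4P; apply: ord4P; rewrite sum_ord4 !delta_vec /row4 /=.
all: rewrite !(chain_vecE, @chain_vecE _ (y * s / x ^+ 2)) !vec_coord !scale_vec !add_vec.
all: by apply: vecP; try ring; field.
Qed.

Lemma chain_in_list (s t : F) : in_list (chain_alg s t).
Proof.
have [->|s0] := eqVneq s 0; have [->|t0] := eqVneq t 0.
- exact: (in_list_sym (L := A4_6)) (listed6 F).
- apply: in_list_iso (chain_scale 0 t t0 t0) _.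
  rewrite mulr0 mul0r; have -> : t ^+ 2 * t / t ^+ 3 = 1 by field.
  exact: (in_list_sym (L := A4_13)) (listed13 F).
- apply: in_list_iso (chain_scale s 0 (oner_neq0 F) (invr_neq0 s0)) _.
  rewrite mulr0 mul0r; rewrite expr1n divr1 mulVf //.
  exact: (in_list_sym (L := A4_14)) (listed14 F).
(* x = s^2 / t and y = s^3 / t^2 solve y s = x^2 and y^2 t = x^3, which turns both parameters into
   1. *)
have x0 : s ^+ 2 / t != 0 by rewrite mulf_neq0 ?expf_neq0 ?invr_neq0.
have y0 : s ^+ 3 / t ^+ 2 != 0 by rewrite mulf_neq0 ?invr_neq0 ?expf_neq0.
apply: in_list_iso (chain_scale s t x0 y0) _.
have -> : s ^+ 3 / t ^+ 2 * s / (s ^+ 2 / t) ^+ 2 = 1 by field; rewrite s0 t0.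
have -> : (s ^+ 3 / t ^+ 2) ^+ 2 * t / (s ^+ 2 / t) ^+ 3 = 1 by field; rewrite s0 t0.
exact: (in_list_sym (L := A4_12)) (listed12 F).
Qed.

End ChainScaling.

(** * Reduction of an arbitrary algebra to the normal forms *)

Section Completeness.
Variables (F : fieldType) (A : algebra F).
Local Notation "x ** y" := (amul A x y) (at level 40, left associativity).
Hypotheses (nilA : nilpotent A) (dimA : \dim (fullv : {vspace A}) = 4%N).

Lemma in_list_bf : (forall x y z, x ** y ** z = 0) -> (\dim (A2 A) <= 1)%N -> in_list A.
Proof.
move=> cube0 d1.
(* [z] spans A^2, or is any non-zero vector when A^2 = 0; the form lives on a complement of its
   line. *)
have [z [z0 A2z zann]] : exists z, [/\ z != 0, (A2 A <= <[z]>)%VS &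
    forall x, z ** x = 0 /\ x ** z = 0].
  have [A20|A20] := eqVneq (A2 A) 0%VS.
    exists (vpick (fullv : {vspace A})); rewrite A20 sub0v vpick0 -dimv_eq0 dimA.
    by split=> // x; split; apply/eqP; rewrite -memv0 -A20; apply: A2P.
  exists (vpick (A2 A)); rewrite vpick0 A20 sub_line //; split=> // x.
  exact: (A2_ann cube0 (memv_pick _)).
have := sub_span_padded (@dim_complement _ _ <[z]>%VS 3 _).
rewrite dimA dim_vline z0 => /(_ isT); rewrite /mkseq /=; set p := nth _ _ _.
set q := nth _ _ 1%N; set r := nth _ _ 2%N => pqr.
have sp : (fullv <= <<[:: p; q; r; z]>>)%VS.
  apply: subv_trans (sub_complement <[z]>%VS) _.
  by rewrite -[[:: p; q; r; z]]/([:: p; q; r] ++ [:: z]) span_cat span_seq1 addvS.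
have k x y : exists k, x ** y = k *: z by apply/vlineP/(subvP A2z)/A2P.
have [a ea] := k p p; have [b eb] := k p q; have [c ec] := k p r.
have [d ed] := k q p; have [e ee] := k q q; have [f ef] := k q r.
have [g eg] := k r p; have [h eh] := k r q; have [i ei] := k r r.
apply: in_list_iso (bf_in_list (mx3 a b c d e f g h i)).
apply: (@iso_span _ _ dimA _ _ p q r z) => //.
apply: ord4P; apply: ord4P; rewrite sum_ord4 !delta_vec /row4 /=.
all: rewrite -![table_mul _ _ _]/(amul (bf _) _ _) bf3E !vec_coord.
all: rewrite ?ea ?eb ?ec ?ed ?ee ?ef ?eg ?eh ?ei ?(zann _).1 ?(zann _).2.
all: by rewrite !(mulr0, mulr1, addr0, add0r, scale0r).
Qed.

Lemma in_list_cube0 : (forall x y z, x ** y ** z = 0) -> in_list A.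
Proof.
move=> cube0; have [d1|d1] := leqP (\dim (A2 A)) 1; first exact: in_list_bf.
have [d2|d2] := leqP (\dim (A2 A)) 2.
  have := sub_span_padded (@dim_complement _ _ (A2 A) 2 _).
  rewrite dimA => /(_ d1); rewrite /mkseq /= => sp.
  apply: (in_list_gens dimA cube0 d2); rewrite /gens.
  exact: subv_trans (sub_complement (A2 A)) (addvS sp (subvv _)).
(* If dim A^2 is at least 3, a single generator a remains, and A^2 would be spanned by a^2. *)
have := sub_line (@dim_complement _ _ (A2 A) 1 _).
rewrite dimA => /(_ d2); set a := vpick _ => sp.
have g : gens a (0 : A).
  rewrite /gens !span_cons span_nil !addv0.
  exact: subv_trans (sub_complement (A2 A)) (addvS sp (subvv _)).
have := dimvS (A2_gens cube0 g); rewrite !linear0r !linear0l.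
rewrite !span_cons span_nil !addv0 dim_vline => le.
by have := leq_trans d1 (leq_trans le (leq_b1 _)).
Qed.

Lemma mulv_A2 (U : {vspace A}) s t : s \in U -> t \in A2 A -> s ** t \in mulv (mulv U).
Proof.
move=> sU tA; have : (A2 A <= (linfun (amul A s) @^-1: mulv (mulv U)))%VS.
  by apply: mulv_sub => p q _; rewrite -memv_preim lfunE /= amulA; do 2 apply: mulv_mem.
by move/subvP/(_ t tA); rewrite -memv_preim lfunE.
Qed.

(** Iterated from a itself, this shows that each power of A is spanned by the corresponding power of
    a modulo the next one. *)
Lemma mulv_step (U : {vspace A}) a w : (fullv <= <[a]> + A2 A)%VS -> (U <= <[w]> + mulv U)%VS ->
  w \in U -> (mulv U <= <[w ** a]> + mulv (mulv U))%VS.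
Proof.
move=> g sU wU; apply: mulv_sub => x y xU.
have /memv_addP[_ /vlineP[k ->] [u uU ->]] := subvP sU x xU.
have /memv_addP[_ /vlineP[l ->] [t tA ->]] := subvP g y (memvf y).
rewrite linearDl linearDr /= linearZl_LR linearZr_LR /= linearZl_LR -addrA.
apply: memv_add; first by do 2 apply: memvZ; apply: memv_line.
by apply: memvD; [apply: memvZ; exact: mulv_A2|exact: mulv_mem].
Qed.

Lemma iso15 : (3 <= \dim (A2 A))%N -> A ≅ A4_15.
Proof.
move=> d2; have := sub_line (@dim_complement _ _ (A2 A) 1 _).
rewrite dimA => /(_ d2); set a := vpick _ => sp.
have g : (fullv <= <[a]> + A2 A)%VS.
  exact: subv_trans (sub_complement (A2 A)) (addvS sp (subvv _)).
have S2 := mulv_step g g (memvf a); rewrite -/(A2 A) -/(A3 A) in S2.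
have S3 := mulv_step g S2 (A2P a a); rewrite -/(A3 A) -/(A4 A) in S3.
have S4 := mulv_step g S3 (A3P a a a); rewrite -/(A4 A) in S4.
(* The powers decrease strictly until they vanish, so dimension 4 leaves no room for a non-zero
   fifth power. *)
have A5 : mulv (A4 A) = 0%VS.
  apply/eqP; apply: contraT => A50.
  have lt (U : {vspace A}) : (mulv U <= U)%VS -> mulv U != 0%VS -> (\dim (mulv U) < \dim U)%N.
    move=> sU n0; apply: (mulv_dim_lt nilA sU); apply/negP => /eqP U0.
    by case/negP: n0; move: sU; rewrite {2}U0 subv0.
  have nz (U : {vspace A}) : mulv U != 0%VS -> U != 0%VS.
    move=> n0; apply/negP => /eqP U0; case/negP: n0; rewrite U0 -subv0.
    by apply: mulv_sub => x y; rewrite memv0 => /eqP ->; rewrite linear0l mem0v.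
  have A40 := nz _ A50; have A30 := nz _ A40; have A20 := nz _ A30.
  have s2 : (mulv (fullv : {vspace A}) <= fullv)%VS := subvf _.
  have s5 : (mulv (A4 A) <= A4 A)%VS := mulvS (A43 A).
  have l2 := lt _ s2 A20; have l3 := lt _ (A32 A) A30; have l4 := lt _ (A43 A) A40.
  have l5 := lt _ s5 A50.
  have : (0 < \dim (mulv (A4 A)))%N by rewrite lt0n dimv_eq0.
  move: l2 l3 l4 l5; rewrite dimA -/(A2 A) -/(A3 A) -/(A4 A) => l2 l3 l4 l5 l6.
  by have := leq_ltn_trans (leq_ltn_trans (leq_ltn_trans (leq_ltn_trans l6 l5) l4) l3) l2.
have sp4 : (fullv <= <<[:: a; a ** a; a ** a ** a; a ** a ** a ** a]>>)%VS.
  rewrite !span_cons span_nil; apply: subv_trans g (addvS (subvv _) _).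
  apply: subv_trans S2 (addvS (subvv _) _); apply: subv_trans S3 (addvS (subvv _) _).
  by move: S4; rewrite A5.
have z5 : a ** a ** a ** a ** a = 0.
  by apply/eqP; rewrite -memv0 -A5; do 2 apply: mulv_mem; exact: A3P.
apply: (@iso_span _ _ dimA _ (@products_assoc F A4_15) _ _ _ _ sp4).
apply: ord4P; apply: ord4P; rewrite sum_ord4 !delta_vec.
all: rewrite -![table_mul _ _ _]/(amul (A4_15 : listed F) _ _) mul15E !vec_coord /row4 /=.
all: rewrite ?amulA ?z5 ?linear0l !(mulr0, mul0r, mulr1, addr0, add0r).
all: by rewrite ?(scale0r, scale1r, addr0, add0r).
Qed.

Lemma A4_0 x : A4 A = 0%VS -> x \in A3 A -> forall y, x ** y = 0 /\ y ** x = 0.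
Proof.
move=> A40 xA y; split; first by apply/eqP; rewrite -memv0 -A40; apply: mulv_mem.
have : (A3 A <= lker (linfun (amul A y)))%VS.
  apply: mulv_sub => s z sA; rewrite memv_ker lfunE /= amulA -memv0 -A40.
  by apply: mulv_mem; apply: A3_mulr.
by move/subvP/(_ x xA); rewrite memv_ker lfunE => /eqP.
Qed.

Lemma iso_chain a c s t : A4 A = 0%VS ->
  (fullv <= <<[:: a; a ** a; c; a ** a ** a]>>)%VS ->
  a ** c = s *: (a ** a ** a) -> c ** a = 0 -> c ** c = t *: (a ** a ** a) ->
  a ** a ** c = 0 -> c ** (a ** a) = 0 -> A ≅ chain_alg s t.
Proof.
move=> A40 sp eac eca ecc e1 e2.
apply: (@iso_span _ _ dimA _ _ a (a ** a) c (a ** a ** a)) => //.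
have z x : a ** a ** a ** x = 0 /\ x ** (a ** a ** a) = 0 := A4_0 A40 (A3P a a a) x.
have z' : a ** a ** (a ** a) = 0 by rewrite amulA (z _).1.
apply: ord4P; apply: ord4P; rewrite sum_ord4 !delta_vec /row4 /=.
all: rewrite -![table_mul _ _ _]/(amul (chain_alg _ _) _ _) chain_vecE !vec_coord.
all: rewrite ?(z _).1 ?(z _).2 ?z' ?eac ?eca ?ecc ?e1 ?e2 ?amulA
  !(mulr0, mul0r, mulr1, addr0, add0r).
all: by rewrite ?(scale0r, scale1r, addr0, add0r).
Qed.

(* Modulo A^3 the product is a bilinear form m with values on the line spanned by w, and
   associativity reads m(x,y) l(z) = r(x) m(y,z); this forces m, l and r to be
   proportional to a square, to one linear form. *)
Lemma in_list_chain : \dim (A2 A) = 2%N -> A3 A <> 0%VS -> in_list A.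
Proof.
move=> d2 /eqP A30.
have A20 : A2 A != 0%VS by rewrite -dimv_eq0 d2.
have d3 : \dim (A3 A) = 1%N.
  apply/eqP; rewrite eqn_leq lt0n dimv_eq0 A30 andbT -ltnS -d2.
  exact: (mulv_dim_lt nilA (A32 A) A20).
have A40 : A4 A = 0%VS.
  apply/eqP; rewrite -dimv_eq0 -leqn0 -ltnS -d3.
  exact: (mulv_dim_lt nilA (A43 A) A30).
pose d := vpick (A3 A); have dA : d \in A3 A := memv_pick _.
have d0 : d != 0 by rewrite vpick0.
have A3d : (A3 A <= <[d]>)%VS by apply: sub_line; rewrite d3.
have dz x : d ** x = 0 /\ x ** d = 0 := A4_0 A40 dA x.
pose w := vpick (A2 A :\: A3 A)%VS.
have wA : w \in A2 A by apply: (subvP (diffvSl _ _)); apply: memv_pick.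
have A2w : (A2 A <= <[w]> + <[d]>)%VS.
  have dd : (\dim (A2 A :\: A3 A) <= 1)%N.
    have := dimv_cap_compl (A2 A) (A3 A); rewrite (capv_idPr (A32 A)) d3 d2.
    by rewrite add1n => -[->].
  apply: subv_trans (addvS (sub_line dd) A3d).
  by rewrite addv_diff addvSl.
have wd x y : exists m n, x ** y = m *: w + n *: d.
  have /memv_addP[_ /vlineP[m ->] [_ /vlineP[n ->] ->]] := subvP A2w _ (A2P x y).
  by exists m, n.
have wl x : exists l, w ** x = l *: d.
  by apply/vlineP; apply: (subvP A3d); apply: mulv_mem.
have wr x : exists l, x ** w = l *: d.
  by apply/vlineP; apply: (subvP A3d); apply: A3_mulr.
have wA2 x : x \in A2 A -> w ** x = 0.
  by move=> xA; apply/eqP; rewrite -memv0 -[0%VS]A40; exact: mulv_A2.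
have A2w0 x : x \in A2 A -> x ** w = 0.
  by move=> xA; apply/eqP; rewrite -memv0 -[0%VS]A40; exact: mulv_A2.
(* The linear form given by left multiplication with w is not 0, because A^3 is not; p is a
   generator outside its kernel, and q is moved into the kernel. *)
have [p [q [g wp wq]]] : exists p q, [/\ gens p q, w ** p != 0 & w ** q = 0].
  have := sub_span_padded (@dim_complement _ _ (A2 A) 2 _).
  rewrite dimA d2 => /(_ isT); rewrite /mkseq /=; set p := nth _ _ _; set q := nth _ _ 1%N.
  move=> sp; have g : gens p q.
    exact: subv_trans (sub_complement (A2 A)) (addvS sp (subvv _)).
  have main p' q' : gens p' q' -> w ** p' != 0 ->
      exists p q, [/\ gens p q, w ** p != 0 & w ** q = 0].
    move=> g' wp'; have [l el] := wl p'; have [m em] := wl q'.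
    have l0 : l != 0 by apply: contraNneq wp' => l0; rewrite el l0 scale0r.
    exists (1 *: p' + 0 *: q'), (- (m / l) *: p' + 1 *: q'); split.
    - by apply: gens_lin => //; rewrite mulr1 mul0r subr0 oner_neq0.
    - by rewrite scale1r scale0r addr0.
    - rewrite linearDr !linearZr_LR /= el em scalerA scale1r -scalerDl.
      by rewrite mulNr divfK // addNr scale0r.
  have [wp|wp] := eqVneq (w ** p) 0; last exact: main g wp.
  have [wq|wq] := eqVneq (w ** q) 0; last exact: main (gens_sym g) wq.
  case/negP: A30; rewrite -subv0; apply: mulv_sub => x y xA.
  have /memv_addP[_ /vlineP[m ->] [_ /vlineP[n ->] ->]] := subvP A2w x xA.
  have [k [l [s [sA ->]]]] := gensP y g.
  rewrite linearDl !linearDr !linearZl_LR !linearZr_LR /= wp wq (wA2 s sA).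
  by rewrite !(dz _).1 !scaler0 !addr0 mem0v.
have [l el] := wl p; have [r0 er0] := wr p; have [r1 er1] := wr q.
have l0 : l != 0 by apply: contraNneq wp => l0; rewrite el l0 scale0r.
have [m00 [n00 e00]] := wd p p; have [m01 [n01 e01]] := wd p q.
have [m10 [n10 e10]] := wd q p; have [m11 [n11 e11]] := wd q q.
have dinj (k k' : F) : k *: d = k' *: d -> k = k'.
  move/eqP; rewrite -subr_eq0 -scalerBl scaler_eq0 (negPf d0) orbF subr_eq0.
  by move/eqP.
(* Associativity of the triple x, y, z, read on the line of [d]; it is applied to the eight triples
   from p and q. *)
have L x y z m n m' n' k k' : x ** y = m *: w + n *: d -> y ** z = m' *: w + n' *: d ->
    w ** z = k *: d -> x ** w = k' *: d -> m * k = m' * k'.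
  move=> exy eyz ewz exw; apply: dinj; have := amulA x y z.
  rewrite exy eyz linearDl linearDr !linearZl_LR !linearZr_LR /= ewz exw.
  by rewrite (dz _).1 (dz _).2 !scaler0 !addr0 !scalerA => ->.
have wq0 : w ** q = 0 *: d by rewrite scale0r.
have E000 : m00 * l = m00 * r0 := L _ _ _ _ _ _ _ _ _ e00 e00 el er0.
have E010 : m01 * l = m10 * r0 := L _ _ _ _ _ _ _ _ _ e01 e10 el er0.
have E100 : m10 * l = m00 * r1 := L _ _ _ _ _ _ _ _ _ e10 e00 el er1.
have E110 : m11 * l = m10 * r1 := L _ _ _ _ _ _ _ _ _ e11 e10 el er1.
have E001 : m00 * 0 = m01 * r0 := L _ _ _ _ _ _ _ _ _ e00 e01 wq0 er0.
have E011 : m01 * 0 = m11 * r0 := L _ _ _ _ _ _ _ _ _ e01 e11 wq0 er0.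
have E101 : m10 * 0 = m01 * r1 := L _ _ _ _ _ _ _ _ _ e10 e01 wq0 er1.
have E111 : m11 * 0 = m11 * r1 := L _ _ _ _ _ _ _ _ _ e11 e11 wq0 er1.
have nz : ~ [/\ m00 = 0, m01 = 0, m10 = 0 & m11 = 0].
  case=> z0 z1 z2 z3; have : (A2 A <= <[d]>)%VS.
    apply: mulv_sub => x y _; have [k1 [k2 [s [sA ->]]]] := gensP x g.
    have [k1' [k2' [s' [s'A ->]]]] := gensP y g.
    have sd u : u \in A2 A -> forall v, u ** v \in <[d]>%VS /\ v ** u \in <[d]>%VS.
      by move=> uA v; split; apply: (subvP A3d); [exact: mulv_mem|exact: A3_mulr].
    rewrite linearDl; apply: memvD; last exact: (sd s sA _).1.
    rewrite linearDr; apply: memvD; last exact: (sd s' s'A _).2.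
    rewrite mul_lin e00 e01 e10 e11 z0 z1 z2 z3 !scale0r !add0r.
    by do !apply: memvD; do 2 apply: memvZ; exact: memv_line.
  by move/dimvS; rewrite d2 dim_vline d0.
have mulI0 (x y : F) : x != 0 -> y * x = 0 -> y = 0.
  by move=> x0 /eqP; rewrite mulf_eq0 (negPf x0) orbF => /eqP.
have r1z : r1 = 0.
  apply/eqP; apply: contraT => r10; case: nz.
  have z1 : m01 = 0 by apply: (mulI0 r1) => //; rewrite -E101 mulr0.
  have z3 : m11 = 0 by apply: (mulI0 r1) => //; rewrite -E111 mulr0.
  have z2 : m10 = 0 by apply: (mulI0 r1) => //; rewrite -E110 z3 mul0r.
  by split=> //; apply: (mulI0 r1) => //; rewrite -E100 z2 mul0r.
have z2 : m10 = 0 by apply: (mulI0 l) => //; rewrite E100 r1z mulr0.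
have z1 : m01 = 0 by apply: (mulI0 l) => //; rewrite E010 z2 mul0r.
have z3 : m11 = 0 by apply: (mulI0 l) => //; rewrite E110 z2 mul0r.
have m0 : m00 != 0 by apply/negP => /eqP z0; apply: nz.
have {}e01 : p ** q = n01 *: d by rewrite e01 z1 scale0r add0r.
have {}e10 : q ** p = n10 *: d by rewrite e10 z2 scale0r add0r.
have {}e11 : q ** q = n11 *: d by rewrite e11 z3 scale0r add0r.
have D3 : p ** p ** p = (m00 * l) *: d.
  by rewrite e00 linearDl !linearZl_LR /= el (dz _).1 scaler0 addr0 scalerA.
have ml0 : m00 * l != 0 by rewrite mulf_neq0.
have ppq : p ** p ** q = 0.
  by rewrite e00 linearDl !linearZl_LR /= wq (dz _).1 !scaler0 addr0.
have qpp : q ** (p ** p) = 0.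
  by rewrite e00 linearDr !linearZr_LR /= er1 r1z (dz _).2 scale0r !scaler0 addr0.
have pp2 : p ** p ** (p ** p) = 0.
  by rewrite amulA D3 linearZl_LR /= (dz _).1 scaler0.
(* The multiple of p^2 subtracted from q is the one that makes cp = 0. *)
pose k := n10 / (m00 * l); pose c := q - k *: (p ** p).
have kE : k * (m00 * l) = n10 by rewrite divfK.
apply: in_list_iso (chain_in_list ((n01 - n10) / (m00 * l)) (n11 / (m00 * l))).
apply: (@iso_chain p c) => //.
- have sp : (A2 A <= <[p ** p]> + <[p ** p ** p]>)%VS.
    have dD : d \in <[p ** p ** p]>%VS.
      by apply/vlineP; exists (m00 * l)^-1; rewrite D3 scalerA mulVf // scale1r.
    apply: subv_trans A2w _; rewrite subv_add -!memvE andbC.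
    rewrite (subvP (addvSr _ _) _ dD) /=.
    have -> : w = m00^-1 *: (p ** p) - (n00 / m00) *: d.
      by rewrite e00 scalerDr !scalerA mulVf // scale1r [m00^-1 * _]mulrC addrK.
    apply: memv_add; first by apply: memvZ; apply: memv_line.
    by rewrite memvN; apply: memvZ.
  apply: subv_trans g _; rewrite !span_cons span_nil !addv0 subv_add.
  set S := (<[p]> + (<[p ** p]> + (<[c]> + <[p ** p ** p]>)))%VS.
  have pS : p \in S by apply: (subvP (addvSl _ _)); apply: memv_line.
  have sS : (A2 A <= S)%VS.
    apply: subv_trans sp _; rewrite subv_add; apply/andP; split.
      by apply: subv_trans (addvSr _ _); apply: addvSl.
    by do 2 apply: subv_trans (addvSr _ _); apply: addvSr.
  have cS : c \in S.
    by do 2 apply: (subvP (addvSr _ _)); apply: (subvP (addvSl _ _)); apply: memv_line.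
  rewrite sS andbT subv_add -!memvE pS /=.
  have -> : q = c + k *: (p ** p) by rewrite subrK.
  by apply: memvD => //; apply: memvZ; apply: (subvP sS); apply: A2P.
- rewrite linearBr linearZr_LR /= amulA e01 D3 !scalerA kE divfK // -scalerBl.
  by [].
- by rewrite linearBl linearZl_LR /= e10 D3 scalerA kE subrr.
- rewrite linearBl linearZl_LR !linearBr !linearZr_LR /= ppq qpp pp2 e11 D3.
  by rewrite !(scaler0, subr0) scalerA divfK.
- by rewrite linearBr linearZr_LR /= ppq pp2 scaler0 subr0.
- by rewrite linearBl linearZl_LR /= qpp pp2 scaler0 subr0.
Qed.

Lemma every_in_list : in_list A.
Proof.
have [A30|A30] := pselect (A3 A = 0%VS).
  apply: in_list_cube0 => x y z; apply/eqP; rewrite -memv0 -[0%VS]A30; exact: A3P.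
have [d3|d3] := leqP 3 (\dim (A2 A)); first by exists A4_15 => //; exact: iso15.
apply: in_list_chain => //; apply/eqP; rewrite eqn_leq -ltnS d3 /=.
have A20 : A2 A != 0%VS.
  apply/eqP => A20; apply: A30; apply/eqP; rewrite -subv0 -[X in (_ <= X)%VS]A20.
  exact: A32.
apply: leq_ltn_trans _ (mulv_dim_lt nilA (A32 A) A20).
by rewrite lt0n dimv_eq0; apply/eqP.
Qed.

End Completeness.

Theorem mainTheorem1 (F : fieldType) :
  (forall A : algebra F, \dim (fullv : {vspace A}) = 4%N -> nilpotent A ->
     exists2 L : listed F, admissible L & A ≅ L)
  /\ (forall L L' : listed F, admissible L -> admissible L' ->
        listed_number L <> listed_number L' -> ~ (L ≅ L'))
  /\ (forall delta eps : F, delta != 0 -> eps != 0 ->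
        (A4_3 delta ≅ A4_3 eps <->
         exists2 nu : F, nu != 0 & delta = nu ^+ 2 * eps))
  /\ (forall delta eps : F, delta <> eps -> ~ (A4_4 delta ≅ A4_4 eps))
  /\ (forall alpha beta gamma delta : F,
        alpha != 0 -> beta != 0 -> gamma != 0 -> delta != 0 ->
        (A4_8 alpha beta ≅ A4_8 gamma delta <->
         qf_equiv (diag_qf alpha beta (alpha * beta))
                  (diag_qf gamma delta (gamma * delta))))
  /\ (forall alpha beta gamma delta : F, alpha != 0 -> gamma != 0 ->
        (A4_9 alpha beta ≅ A4_9 gamma delta <->
         beta = delta /\
         exists s t : F, t ^+ 2 - s * t + delta * s ^+ 2 = alpha / gamma))
  /\ (2%N \notin [pchar F] -> forall alpha : F, A4_10 alpha ≅ A4_10 (0 : F))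
  /\ (2%N \in [pchar F] -> forall alpha beta : F,
        (A4_10 alpha ≅ A4_10 beta <->
         exists T : F, T ^+ 2 + T + alpha + beta = 0))
  /\ (2%N \in [pchar F] -> forall delta eps : F,
        (A4_17 delta ≅ A4_17 eps <->
         exists T : F, T ^+ 2 + T + delta + eps = 0))
  /\ (2%N \notin [pchar F] -> forall delta eps : F,
        (A4_18 delta ≅ A4_18 eps <->
         exists2 nu : F, nu != 0 & eps = nu ^+ 2 * delta))
  /\ (2%N \in [pchar F] -> forall delta eps : F,
        (A4_18 delta ≅ A4_18 eps <->
         exists u v x y : F,
           [/\ u * y + v * x != 0, u ^+ 2 + v ^+ 2 * delta != 0 &
               eps = (x ^+ 2 + y ^+ 2 * delta) / (u ^+ 2 + v ^+ 2 * delta)]))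
  /\ (2%N \in [pchar F] -> forall delta eps : F,
        (A4_19 delta ≅ A4_19 eps <->
         exists T : F, T ^+ 2 + T + delta + eps = 0))
  /\ (forall delta eps : F, delta != -1 -> eps != -1 ->
        delta <> eps -> ~ (A4_21 delta ≅ A4_21 eps))
  /\ (2%N \notin [pchar F] -> forall delta eps : F, delta != 0 -> eps != 0 ->
        (A4_23 delta ≅ A4_23 eps <->
         exists2 nu : F, nu != 0 & eps = nu ^+ 2 * delta))
  /\ (forall alpha beta gamma alpha' beta' gamma' : F,
        admissible (A4_25 alpha beta gamma) ->
        admissible (A4_25 alpha' beta' gamma') ->
        let sigma := beta / (1 - alpha) in
        let sigma' := beta' / (1 - alpha') in
        (A4_25 alpha beta gamma ≅ A4_25 alpha' beta' gamma' <->
         exists phi nu : F,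
           [/\ phi != 0, nu != 0,
               sigma' ^+ 2 + gamma' = phi ^+ 2 * (sigma ^+ 2 + gamma),
               gamma = nu ^+ 2 * gamma' &
               let psi := nu * phi in
               exists omega : F,
                 [/\ omega = 1 \/ omega = -1,
                     - omega != (1 + alpha) / (1 - alpha) * psi &
                     let lambda :=
                       (psi * (1 + alpha) - omega * (1 - alpha)) /
                       (psi * (1 + alpha) + omega * (1 - alpha)) in
                     let mu := sigma' * (1 - lambda) in
                     (alpha' = lambda /\ beta' = mu) \/
                     [/\ lambda != 0, alpha' = lambda^-1 &
                         beta' = - (mu * lambda^-1)]]]))
  /\ (forall alpha beta gamma : F, admissible (A4_26 alpha beta gamma) ->
        additive_subgroup (H26 alpha beta gamma))
  /\ (forall alpha beta gamma alpha' beta' gamma' : F,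
        admissible (A4_26 alpha beta gamma) ->
        admissible (A4_26 alpha' beta' gamma') ->
        let sigma := beta / (1 + alpha) in
        let sigma' := beta' / (1 + alpha') in
        (A4_26 alpha beta gamma ≅ A4_26 alpha' beta' gamma' <->
         (exists2 nu : F, nu != 0 &
            gamma = nu ^+ 2 * gamma' /\ sigma = nu * sigma') /\
         (exists2 h : F, H26 alpha beta gamma h &
            1 / (1 + alpha') = 1 / (1 + alpha) + h))).
Proof.
split; first by move=> A dimA nilA; exact: every_in_list.
split; first exact: listed_not_iso.
split; first exact: iso3.
split; first by move=> delta eps n /iso4_eq.
split; first exact: iso8.
split; first by move=> *; exact: iso9.
split; first by move=> ch al; exact: iso10_zero.
split; first by move=> ch al be; exact: iso10.
split; first by move=> ch de ep; exact: iso17.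
split; first by move=> ch de ep; exact: iso18_odd.
split; first by move=> ch de ep; exact: iso18_char2.
split; first by move=> ch de ep; exact: iso19.
split; first by move=> de ep _ _ n /iso21_eq.
split; first by move=> ch de ep de0 ep0; exact: iso23.
split; first exact: iso25.
split; first exact: additive_H26.
exact: iso26.
Qed.
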